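(* Let $\phi \in \mathcal{G}AP$ admit an $AP$ asymmetric factorization $\phi=\phi_{-}\, e_{\lambda}\, \phi_{e}$ (with $\lambda\in\mathbb{R}$, $\phi_-\in\mathcal{G}AP^-$, $\phi_e\in\mathcal{G}L^\infty(\mathbb{R})$, $\widetilde{\phi_e}=\phi_e$), and let $W\!H_\phi : L^2_+(\mathbb{R})\to L^2(\mathbb{R}_+)$ be the Wiener-Hopf plus Hankel operator with Fourier symbol $\phi$. Let $\ell:L^2(\mathbb{R}_+)\to L^2(\mathbb{R})$ be an arbitrary extension operator. Then the operator $$W\!H_\phi^- = \ell_0 r_+ \mathcal{F}^{-1}\phi_{e}^{-1}\cdot \mathcal{F}\, \ell^e r_+ \mathcal{F}^{-1}e_{-\lambda}\cdot \mathcal{F}\, \ell^e r_+ \mathcal{F}^{-1}\phi_{-}^{-1}\cdot \mathcal{F}\,\ell \;:\; L^2(\mathbb{R}_+)\to L^2_+(\mathbb{R})$$ is a reflexive generalized inverse of $W\!H_\phi$. Additionally: (a) if $\lambda < 0$, then $W\!H_\phi^-$ is a right-inverse of $W\!H_\phi$; (b) if $\lambda > 0$, then $W\!H_\phi^-$ is a left-inverse of $W\!H_\phi$; (c) if $\lambda = 0$, then $W\!H_\phi^-$ is the inverse of $W\!H_\phi$.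
   Context: Operators: $\mathbb{R}_+=(0,+\infty)$; $L^2_+(\mathbb{R})$ is the subspace of $L^2(\mathbb{R})$ of functions supported in the closure of $\mathbb{R}_+$; $r_+:L^2(\mathbb{R})\to L^2(\mathbb{R}_+)$ is restriction; $\ell_0:L^2(\mathbb{R}_+)\to L^2_+(\mathbb{R})$ is extension by zero; $\ell^e:L^2(\mathbb{R}_+)\to L^2(\mathbb{R})$ is even extension. An extension operator $\ell:L^2(\mathbb{R}_+)\to L^2(\mathbb{R})$ is a linear operator with $r_+\ell=I$ on $L^2(\mathbb{R}_+)$. $\mathcal{F}$ is the Fourier transformation on $L^2(\mathbb{R})$, with the convention $\mathcal{F}f(\xi)=\int_{\mathbb{R}} e^{i\xi x}f(x)\,dx$ (extended to $L^2$ as usual). $J\varphi(x)=\widetilde{\varphi}(x)=\varphi(-x)$ is the reflection. For $\phi\in L^\infty(\mathbb{R})$, $W_\phi=r_+\mathcal{F}^{-1}\phi\cdot\mathcal{F}$ and $H_\phi=r_+\mathcal{F}^{-1}\phi\cdot\mathcal{F}J$ (both $L^2_+(\mathbb{R})\to L^2(\mathbb{R}_+)$) are the Wiener-Hopf and Hankel operators, and $W\!H_\phi=W_\phi+H_\phi=r_+\mathcal{F}^{-1}\phi\cdot\mathcal{F}\,\ell^e r_+$. Function classes: $e_\lambda(x)=e^{i\lambda x}$ for $\lambda, x\in\mathbb{R}$. $AP$ is the smallest closed subalgebra of $L^\infty(\mathbb{R})$ containing all $e_\lambda$, $\lambda\in\mathbb{R}$; $AP^-$ is the smallest closed subalgebra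 of $L^\infty(\mathbb{R})$ containing all $e_\lambda$ with $\lambda\le 0$. $\mathcal{G}B$ denotes the group of invertible elements of a Banach algebra $B$. A function $\phi\in\mathcal{G}AP$ admits an $AP$ asymmetric factorization if $\phi=\phi_-\,e_\lambda\,\phi_e$ with $\lambda\in\mathbb{R}$, $\phi_-\in\mathcal{G}AP^-$, $\phi_e\in\mathcal{G}L^\infty(\mathbb{R})$ and $\widetilde{\phi_e}=\phi_e$. A bounded linear operator $T^-:Y\to X$ is a reflexive generalized inverse of a bounded linear operator $T:X\to Y$ between Banach spaces if $TT^-T=T$ and $T^-TT^-=T^-$. *)

(* Defs.v *)
From HB Require Import structures.
From mathcomp Require Import all_boot all_order all_algebra.
From mathcomp Require Import all_classical all_reals all_analysis.
From mathcomp Require Import measurable_realfun ess_sup_inf hoelder.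
From mathcomp.real_closed Require Import complex.

Set Implicit Arguments.
Unset Strict Implicit.
Unset Printing Implicit Defensive.
Import Order.TTheory GRing.Theory Num.Theory.
Import numFieldNormedType.Exports Normc.
Local Open Scope classical_set_scope.
Local Open Scope ring_scope.
Local Open Scope complex_scope.
Local Open Scope quotient_scope.

(* [CLspace mu p1], for [p1 : 1 <= p], is the normed space over [R[i]] of the
   classes of complex functions in L^p(mu) modulo equality mu-a.e. A class is
   coerced to a function by choosing a representative. *)

Section CLp_functions.
Context d (T : measurableType d) (R : realType).
Variables (mu : {measure set T -> \bar R}) (p : \bar R).

Definition cmeasurable (f : T -> R[i]) : Prop :=
  measurable_fun [set: T] (fun x => complex.Re (f x)) /\
  measurable_fun [set: T] (fun x => complex.Im (f x)).

Definition cLnorm (f : T -> R[i]) : \bar R :=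
  'N[mu]_p[EFin \o (fun x => normc (f x))].

Definition in_CLp (f : T -> R[i]) : Prop :=
  cmeasurable f /\ (cLnorm f < +oo)%E.

Record CLfun := MkCLfun { CLfun_fun :> T -> R[i] ; CLfunP : in_CLp CLfun_fun }.

HB.instance Definition _ := gen_eqMixin CLfun.
HB.instance Definition _ := gen_choiceMixin CLfun.

Definition cae_eq (f g : CLfun) : bool := `[< {ae mu, forall x, f x = g x} >].

Lemma cae_eq_refl : reflexive cae_eq.
Proof. by move=> f; apply/asboolP; apply/nearW. Qed.

Lemma cae_eq_sym : symmetric cae_eq.
Proof.
by move=> f g; apply/idP/idP => /asboolP h; apply/asboolP; apply: filterS h.
Qed.

Lemma cae_eq_trans : transitive cae_eq.
Proof.
move=> f g h /asboolP gf /asboolP fh; apply/asboolP.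
by apply: filterS2 gf fh => x -> ->.
Qed.

Canonical cae_eq_canonical := EquivRel cae_eq cae_eq_refl cae_eq_sym cae_eq_trans.

Lemma cmeasurable_normc f : cmeasurable f ->
  measurable_fun [set: T] (fun x => normc (f x)).
Proof.
case=> mr mi; rewrite (_ : (fun x => _) =
   (fun y => y `^ 2^-1) \o (fun x => complex.Re (f x) ^+ 2 + complex.Im (f x) ^+ 2)).
  apply: measurableT_comp; first exact: measurable_powR.
  by apply: measurable_funD; exact: measurable_funX.
apply/funext => x /=; rewrite powR12_sqrt ?addr_ge0 ?sqr_ge0//.
by case: (f x).
Qed.

Lemma cLnorm_ge0 f : (0 <= cLnorm f)%E.
Proof. exact: Lnorm_ge0. Qed.

End CLp_functions.

Section CLp_norm.
Context d (T : measurableType d) (R : realType).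
Variables (mu : {measure set T -> \bar R}) (p : \bar R) (p1 : (1 <= p)%E).
Implicit Types f g : T -> R[i].
Local Notation N := (cLnorm mu p).

Lemma le_cLnorm (u v : T -> R) :
  measurable_fun setT u -> measurable_fun setT v ->
  {ae mu, forall x, 0 <= u x <= v x} ->
  ('N[mu]_p[EFin \o u] <= 'N[mu]_p[EFin \o v])%E.
Proof.
move=> mu_ mv uv; rewrite unlock /Lnorm.
case: p p1 => [r||//] r1.
- have r0 : 0 < r by rewrite (lt_le_trans ltr01)// -lee_fin.
  have m (w : T -> R) : measurable_fun setT w ->
    measurable_fun setT (fun x => (`| (EFin \o w) x | `^ r)%E : \bar R).
    move=> mw; apply/measurable_EFinP.
    apply: (@measurableT_comp _ _ _ _ _ _ (@powR R ^~ r)) => //.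
    exact: measurableT_comp.
  apply: gt0_ler_poweR; rewrite ?invr_ge0 ?(ltW r0)//.
  + by rewrite in_itv/= leey integral_ge0// => x _; exact: poweR_ge0.
  + by rewrite in_itv/= leey integral_ge0// => x _; exact: poweR_ge0.
  + apply: ae_ge0_le_integral => //.
    * by move=> x _; exact: poweR_ge0.
    * exact: m.
    * by move=> x _; exact: poweR_ge0.
    * exact: m.
    * apply: filterS uv => x /andP[u0 uv] _ /=.
      rewrite lee_fin ge0_ler_powR ?(ltW r0)// ?nnegrE//.
      by rewrite !ger0_norm// (le_trans u0).
- case: ifPn => // mu0; apply: le_ess_sup; apply: filterS uv => x /andP[u0 uv] /=.
  by rewrite lee_fin !ger0_norm// (le_trans u0).
Qed.

Lemma eq_cLnorm f g : cmeasurable f -> cmeasurable g ->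
  {ae mu, forall x, f x = g x} -> N f = N g.
Proof.
move=> mf mg fg; apply/eqP; rewrite eq_le; apply/andP; split;
  apply: le_cLnorm; try exact: cmeasurable_normc;
  by apply: filterS fg => x ->; rewrite lexx andbT; case: (g x) => a b; exact: sqrtr_ge0.
Qed.

Lemma cmeasurableD f g : cmeasurable f -> cmeasurable g ->
  cmeasurable (fun x => f x + g x).
Proof.
move=> [fr fi] [gr gi]; split; under eq_fun do rewrite raddfD/=;
  exact: measurable_funD.
Qed.

Lemma cmeasurableM f g : cmeasurable f -> cmeasurable g ->
  cmeasurable (fun x => f x * g x).
Proof.
move=> [fr fi] [gr gi]; split.
- rewrite (_ : (fun x => _) = (fun x => complex.Re (f x) * complex.Re (g x) - complex.Im (f x) * complex.Im (g x))).
    by apply: measurable_funB; exact: measurable_funM.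
  by apply/funext => x; case: (f x) => a b; case: (g x).
- rewrite (_ : (fun x => _) = (fun x => complex.Re (f x) * complex.Im (g x) + complex.Im (f x) * complex.Re (g x))).
    by apply: measurable_funD; exact: measurable_funM.
  by apply/funext => x; case: (f x) => a b; case: (g x).
Qed.

Lemma cmeasurable_cst (c : R[i]) : cmeasurable (fun _ : T => c).
Proof. by split; exact: measurable_cst. Qed.

Lemma normc_ge0 (z : R[i]) : 0 <= normc z.
Proof. by case: z => a b; exact: sqrtr_ge0. Qed.

Lemma cLnormD f g : cmeasurable f -> cmeasurable g ->
  (N (fun x => f x + g x)%R <= N f + N g)%E.
Proof.
move=> mf mg.
apply: le_trans (eminkowski _ (cmeasurable_normc mf) (cmeasurable_normc mg) p1).
apply: le_cLnorm.
- exact/cmeasurable_normc/cmeasurableD.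
- by apply: measurable_funD; exact: cmeasurable_normc.
- by apply/nearW => x; rewrite normc_ge0 le_normcD.
Qed.

Lemma in_CLpD f g : in_CLp mu p f -> in_CLp mu p g ->
  in_CLp mu p (fun x => f x + g x).
Proof.
move=> [mf lf] [mg lg]; split; first exact: cmeasurableD.
by apply: le_lt_trans (cLnormD mf mg) _; rewrite lte_add_pinfty.
Qed.

Lemma cLnormZ (c : R[i]) f : in_CLp mu p f ->
  N (fun x => c * f x)%R = ((normc c)%:E * N f)%E.
Proof.
move=> [mf lf].
have hf : (fun x => normc (f x)) \in Lfun mu p.
  by apply/andP; split; rewrite inE //; exact: cmeasurable_normc.
rewrite -[normc c]ger0_norm ?normc_ge0//.
rewrite (_ : N f = 'N[mu]_p[EFin \o Lfun_Sub p1 hf]%E)//.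
rewrite -LnormZ; congr Lnorm; apply/funext => x /=.
by rewrite normcM.
Qed.

Lemma in_CLpZ (c : R[i]) f : in_CLp mu p f -> in_CLp mu p (fun x => c * f x).
Proof.
move=> lf; split.
  by apply: cmeasurableM; [exact: cmeasurable_cst|exact: lf.1].
by rewrite cLnormZ// lte_mul_pinfty// ?lee_fin ?normc_ge0//; exact: lf.2.
Qed.

Lemma in_CLp0 : in_CLp mu p (fun=> 0).
Proof.
split; first exact: cmeasurable_cst.
rewrite /cLnorm (_ : _ \o _ = cst 0%E).
  by rewrite Lnorm0// gt_eqF// (lt_le_trans _ p1).
by apply/funext => x /=; congr EFin; exact: normc0.
Qed.

End CLp_norm.

(* The bound [1 <= p] is a (phantom) argument of the type, so that the
   normed space structure can be attached to it *)
Definition CLspace d (T : measurableType d) (R : realType)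
    (mu : {measure set T -> \bar R}) (p : \bar R) (p1 : (1 <= p)%E) : Type :=
  {eq_quot (@cae_eq d T R mu p)}.

Section CLspace.
Context d (T : measurableType d) (R : realType).
Variables (mu : {measure set T -> \bar R}) (p : \bar R) (p1 : (1 <= p)%E).
Local Notation L := (CLspace mu p1).
Implicit Types F G H : L.

HB.instance Definition _ := Choice.on L.
HB.instance Definition _ := EqQuotient.on L.

Definition CLspace_repr (F : L) : CLfun mu p := repr F.
Definition CLspace_fun (F : L) : T -> R[i] := CLspace_repr F.
Coercion CLspace_fun : CLspace >-> Funclass.

Definition CLzero : L := \pi_L (MkCLfun (in_CLp0 mu p1)).

(* The class in L^p of a function of L^p; the value outside of L^p is [0] *)
Definition CLclass (f : T -> R[i]) : L :=
  match pselect (in_CLp mu p f) with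
  | left fL => \pi_L (MkCLfun fL)
  | right _ => CLzero
  end.

Lemma CLspaceP F : in_CLp mu p F.
Proof. exact: CLfunP. Qed.

Lemma CLspace_ext F G : {ae mu, forall x, F x = G x} -> F = G.
Proof. by move=> FG; rewrite -[F]reprK -[G]reprK; apply/eqmodP/asboolP. Qed.

Lemma CLclassE f : in_CLp mu p f -> {ae mu, forall x, CLclass f x = f x}.
Proof.
move=> fL; rewrite /CLclass; case: pselect => // fL'.
have : repr (\pi_L (MkCLfun fL')) = MkCLfun fL' %[mod {eq_quot (@cae_eq _ _ _ mu p)}].
  by rewrite reprK.
by move=> /eqmodP/asboolP.
Qed.

Lemma CLzeroE : {ae mu, forall x, CLzero x = 0}.
Proof.
have -> : CLzero = CLclass (fun=> 0).
  rewrite /CLclass; case: pselect => // h.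
  by congr (\pi_L _); congr MkCLfun; exact: Prop_irrelevance.
exact/CLclassE/in_CLp0.
Qed.

Definition CLadd F G : L := CLclass (fun x => F x + G x).
Definition CLscale (c : R[i]) F : L := CLclass (fun x => c * F x).
Definition CLopp F : L := CLscale (-1) F.

Lemma CLaddE F G : {ae mu, forall x, CLadd F G x = F x + G x}.
Proof. by apply/CLclassE/in_CLpD => //; exact: CLspaceP. Qed.

Lemma CLscaleE c F : {ae mu, forall x, CLscale c F x = c * F x}.
Proof. by apply/CLclassE/in_CLpZ => //; exact: CLspaceP. Qed.

Lemma CLaddA : associative CLadd.
Proof.
move=> F G H; apply: CLspace_ext.
apply: filterS2 (filterI (CLaddE F (CLadd G H)) (CLaddE G H))
  (filterI (CLaddE (CLadd F G) H) (CLaddE F G)) => x [-> ->] [-> ->].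
by rewrite addrA.
Qed.

Lemma CLaddC : commutative CLadd.
Proof. by move=> F G; congr CLclass; apply/funext => x; rewrite addrC. Qed.

Lemma CLadd0 : left_id CLzero CLadd.
Proof.
move=> F; apply: CLspace_ext.
by move: (CLaddE CLzero F) CLzeroE; apply: filterS2 => x -> ->; rewrite add0r.
Qed.

Lemma CLaddN : left_inverse CLzero CLopp CLadd.
Proof.
move=> F; apply: CLspace_ext.
move: (CLaddE (CLopp F) F) (CLscaleE (-1) F) CLzeroE.
by apply: filterS3 => x -> -> ->; rewrite mulN1r addNr.
Qed.

HB.instance Definition _ :=
  GRing.isZmodule.Build L CLaddA CLaddC CLadd0 CLaddN.

Lemma CLscaleA (a b : R[i]) F : CLscale a (CLscale b F) = CLscale (a * b) F.
Proof.
apply: CLspace_ext.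
move: (CLscaleE a (CLscale b F)) (CLscaleE b F) (CLscaleE (a * b) F).
by apply: filterS3 => x -> -> ->; rewrite mulrA.
Qed.

Lemma CLscale1 : left_id 1 CLscale.
Proof.
by move=> F; apply: CLspace_ext; move: (CLscaleE 1 F); apply: filterS => x ->; rewrite mul1r.
Qed.

Lemma CLscaleDr : right_distributive CLscale +%R.
Proof.
move=> c F G; apply: CLspace_ext.
apply: filterS3 (filterI (CLscaleE c (F + G)) (CLaddE F G))
  (CLaddE (CLscale c F) (CLscale c G)) (filterI (CLscaleE c F) (CLscaleE c G)).
by move=> x [-> ->] -> [-> ->]; rewrite mulrDr.
Qed.

Lemma CLscaleDl F : {morph CLscale^~ F : a b / a + b}.
Proof.
move=> a b; apply: CLspace_ext.
apply: filterS3 (CLscaleE (a + b) F) (CLaddE (CLscale a F) (CLscale b F))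
  (filterI (CLscaleE a F) (CLscaleE b F)) => x -> -> [-> ->].
by rewrite mulrDl.
Qed.

HB.instance Definition _ := GRing.Zmodule_isLmodule.Build R[i] L
  CLscaleA CLscale1 CLscaleDr CLscaleDl.

(* As a scalar of the normed space, the norm is a (real) complex number *)
Definition CLnorm F : R[i] := (fine (cLnorm mu p F))%:C.

Lemma CLnorm_fin F : cLnorm mu p F \is a fin_num.
Proof.
by rewrite ge0_fin_numE ?cLnorm_ge0//; have [] := CLspaceP F.
Qed.

Lemma CLnormD F G : CLnorm (F + G) <= CLnorm F + CLnorm G.
Proof.
have [mF _] := CLspaceP F; have [mG _] := CLspaceP G.
rewrite /CLnorm -rmorphD/= lecR -lee_fin EFinD !fineK ?CLnorm_fin//.
apply: (le_trans _ (cLnormD mu p1 mF mG)).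
rewrite (eq_cLnorm p1 _ _ (CLaddE F G))//.
- by have [] := CLspaceP (F + G).
- exact: cmeasurableD.
Qed.

Lemma CLnormZ c F : CLnorm (c *: F) = `|c| * CLnorm F.
Proof.
have [mF _] := CLspaceP F.
rewrite /CLnorm (_ : `|c| = (normc c)%:C); last by case: c.
rewrite -rmorphM/=; congr (_%:C).
rewrite (eq_cLnorm p1 _ _ (CLscaleE c F)).
- by rewrite (cLnormZ p1 c (CLspaceP F)) fineM// CLnorm_fin.
- by have [] := CLspaceP (c *: F).
- by apply: cmeasurableM => //; exact: cmeasurable_cst.
Qed.

Lemma CLnorm_eq0 F : CLnorm F = 0 -> F = 0.
Proof.
have [mF _] := CLspaceP F.
move=> [/eqP]; rewrite -eqe fineK ?CLnorm_fin// => /eqP.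
move=> /Lnorm_eq0_eq0 h; apply: CLspace_ext.
have /measurable_EFinP mn := cmeasurable_normc mF.
have {}h := h mn (lt_le_trans lte01 p1).
move: h CLzeroE; apply: filterS2 => x /(_ I) [/eq0_normc ->] ->; exact: erefl.
Qed.

HB.instance Definition _ := Lmodule_isNormed.Build R[i] L
  CLnormD CLnormZ CLnorm_eq0.

End CLspace.

Section CLoo.
Context d (T : measurableType d) (R : realType) (mu : {measure set T -> \bar R}).
Local Notation L := (CLspace mu (leey 1%E)).
Implicit Types phi psi chi : L.

Lemma in_CLooP (f : T -> R[i]) : in_CLp mu +oo%E f <->
  cmeasurable f /\ exists M : R, {ae mu, forall x, normc (f x) <= M}.
Proof.
rewrite /in_CLp /cLnorm; split => -[mf h]; split => //.
- move: h; rewrite unlock /Lnorm; case: ifPn => [mu0|].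
    move=> /ess_supr_bounded[M hM]; exists M; apply: filterS hM => x /=.
    by rewrite ger0_norm// normc_ge0.
  rewrite -leNgt => mu0 _; exists 0; exists setT; split => //.
  by apply/eqP; rewrite eq_le mu0 measure_ge0.
- case: h => M hM; rewrite unlock /Lnorm; case: ifPn => [mu0|//].
  apply: (@le_lt_trans _ _ M%:E); last exact: ltry.
  apply/ess_supP; apply: filterS hM => x /=.
  by rewrite lee_fin ger0_norm// normc_ge0.
Qed.

Lemma in_CLooM (f g : T -> R[i]) : in_CLp mu +oo%E f -> in_CLp mu +oo%E g ->
  in_CLp mu +oo%E (fun x => f x * g x).
Proof.
move=> /in_CLooP[mf [M hM]] /in_CLooP[mg [N hN]]; apply/in_CLooP.
split; first exact: cmeasurableM.
exists (M * N); apply: filterS2 hM hN => x fM gN.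
by rewrite normcM ler_pM ?normc_ge0.
Qed.

Lemma in_CLoo1 : in_CLp mu +oo%E (fun=> 1).
Proof.
apply/in_CLooP; split; first exact: cmeasurable_cst.
by exists (normc 1); apply/nearW.
Qed.

Definition CLmul phi psi : L := CLclass mu (leey 1%E) (fun x => phi x * psi x).
Definition CLone : L := CLclass mu (leey 1%E) (fun=> 1).

Lemma CLmulE phi psi : {ae mu, forall x, CLmul phi psi x = phi x * psi x}.
Proof. by apply/CLclassE/in_CLooM; exact: CLspaceP. Qed.

Lemma CLoneE : {ae mu, forall x, CLone x = 1}.
Proof. exact/CLclassE/in_CLoo1. Qed.

Lemma CLmulA : associative CLmul.
Proof.
move=> f g h; apply: CLspace_ext.
apply: filterS2 (filterI (CLmulE f (CLmul g h)) (CLmulE g h))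
  (filterI (CLmulE (CLmul f g) h) (CLmulE f g)) => x [-> ->] [-> ->].
by rewrite mulrA.
Qed.

Lemma CLmulC : commutative CLmul.
Proof. by move=> f g; congr CLclass; apply/funext => x; rewrite mulrC. Qed.

Lemma CLmul1 : left_id CLone CLmul.
Proof.
move=> f; apply: CLspace_ext.
by apply: filterS2 (CLmulE CLone f) CLoneE => x -> ->; rewrite mul1r.
Qed.

Lemma CLmulDl : left_distributive CLmul +%R.
Proof.
move=> f g h; apply: CLspace_ext.
apply: filterS3 (filterI (CLmulE (f + g) h) (CLaddE f g))
  (CLaddE (CLmul f h) (CLmul g h)) (filterI (CLmulE f h) (CLmulE g h)).
by move=> x [-> ->] -> [-> ->]; rewrite mulrDl.
Qed.

HB.instance Definition _ := GRing.Zmodule_isComPzRing.Build L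
  CLmulA CLmulC CLmul1 CLmulDl.

End CLoo.

(* Lebesgue measure on R_+ = (0, +oo), as a measure on R that is concentrated
   on R_+: its L^2 space is [L^2(R_+)], functions being identified when they are
   equal a.e. on R_+, whatever their values outside of R_+ *)
Definition lebesgue_pos (R : realType) :
    {measure set (measurableTypeR R) -> \bar R} :=
  mrestr (@lebesgue_measure R) (measurable_itv `]0, +oo[).

Notation L2 R := (CLspace (@lebesgue_measure R) (lee1n 2)).
Notation L2pos R := (CLspace (@lebesgue_pos R) (lee1n 2)).
Notation Loo R := (CLspace (@lebesgue_measure R) (leey 1%E)).

Notation L2_class f := (CLclass (@lebesgue_measure _) (lee1n 2) f).
Notation L2pos_class f := (CLclass (@lebesgue_pos _) (lee1n 2) f).
Notation Loo_class f := (CLclass (@lebesgue_measure _) (leey 1%E) f).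

Section L2plus.
Context (R : realType).

(* [L^2_+(R)]: the support is in [0, +oo), the closure of R_+ *)
Definition supp_pos : {pred L2 R} :=
  fun F => `[< {ae @lebesgue_measure R, forall x, (x < 0)%R -> F x = 0} >].

Lemma supp_pos_submod : submod_closed supp_pos.
Proof.
split.
  apply/asboolP; have := CLzeroE (@lebesgue_measure R) (lee1n 2).
  have ae_filter := ae_filter_ringOfSetsType (@lebesgue_measure R).
  by apply: filterS => x -> _.
move=> a F G /asboolP F0 /asboolP G0; apply/asboolP.
have ae_filter := ae_filter_ringOfSetsType (@lebesgue_measure R).
apply: filterS3 (filterI F0 G0) (CLaddE (a *: F) G) (CLscaleE a F).
by move=> x [F0x G0x] -> -> x0; rewrite F0x// G0x// mulr0 addr0.
Qed.

HB.instance Definition _ :=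
  GRing.isSubmodClosed.Build R[i] (L2 R) supp_pos supp_pos_submod.

Record L2plus := MkL2plus { L2plus_val :> L2 R ; _ : L2plus_val \in supp_pos }.

HB.instance Definition _ := [isSub for L2plus_val].
HB.instance Definition _ := [Choice of L2plus by <:].
HB.instance Definition _ := [SubChoice_isSubLmodule of L2plus by <:].

Definition L2plus_norm (F : L2plus) : R[i] := `|L2plus_val F|.

Lemma L2plus_normD F G : L2plus_norm (F + G) <= L2plus_norm F + L2plus_norm G.
Proof. exact: ler_normD. Qed.

Lemma L2plus_normZ c F : L2plus_norm (c *: F) = `|c| * L2plus_norm F.
Proof. exact: normrZ. Qed.

Lemma L2plus_norm_eq0 F : L2plus_norm F = 0 -> F = 0.
Proof. by move=> /eqP; rewrite normr_eq0 => /eqP F0; exact: val_inj. Qed.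

HB.instance Definition _ := Lmodule_isNormed.Build R[i] L2plus
  L2plus_normD L2plus_normZ L2plus_norm_eq0.

End L2plus.

Section operators.
Context (R : realType).
Local Notation mu := (@lebesgue_measure R).

Definition restr (F : L2 R) : L2pos R := L2pos_class F.

Lemma ext0_supp (F : L2pos R) :
  L2_class (fun x : R => if 0 < x then F x else 0) \in @supp_pos R.
Proof.
apply/asboolP; have ae_filter := ae_filter_ringOfSetsType mu.
rewrite [L2_class _]/CLclass; case: pselect => [fL|nfL].
  have := CLclassE (lee1n 2) fL; rewrite /CLclass; case: pselect => // fL'.
  rewrite (Prop_irrelevance fL' fL).
  by apply: filterS => x -> x0; rewrite ltNge (ltW x0).
by have := CLzeroE mu (lee1n 2); apply: filterS => x ->.
Qed.

Definition ext0 (F : L2pos R) : L2plus R := MkL2plus (ext0_supp F).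

Definition ext_even (F : L2pos R) : L2 R := L2_class (fun x : R => F `|x|).

Definition reflection (p : \bar R) (p1 : (1 <= p)%E) (F : CLspace mu p1) :
    CLspace mu p1 :=
  CLclass mu p1 (fun x : R => F (- x)).

Definition expi (t : R) : R[i] := cos t +i* sin t.

Definition cintegral (D : set R) (f : R -> R[i]) : R[i] :=
  (\int[mu]_(x in D) complex.Re (f x)) +i* (\int[mu]_(x in D) complex.Im (f x)).

(* The Fourier-Plancherel transformation: the limit in L^2, as n tends to
   infinity, of the Fourier integrals of the truncations of [F] to [-n, n] *)
Definition fourier (F : L2 R) : L2 R :=
  lim ((fun n : nat => L2_class (fun xi : R =>
          cintegral `[- n%:R, n%:R] (fun x : R => expi (xi * x) * F x)))
       @ \oo).

Definition fourier_inv (F : L2 R) : L2 R := xget 0 [set G | fourier G = F].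

Definition mulop (phi : Loo R) (F : L2 R) : L2 R :=
  L2_class (fun x : R => phi x * F x).

Definition conv_op (phi : Loo R) (F : L2 R) : L2 R :=
  fourier_inv (mulop phi (fourier F)).

Definition wiener_hopf (phi : Loo R) (F : L2plus R) : L2pos R :=
  restr (conv_op phi F).

Definition hankel (phi : Loo R) (F : L2plus R) : L2pos R :=
  restr (conv_op phi (reflection F)).

Definition wiener_hopf_plus_hankel (phi : Loo R) (F : L2plus R) : L2pos R :=
  wiener_hopf phi F + hankel phi F.

Definition extension_operator (ell : {linear L2pos R -> L2 R}) : Prop :=
  forall F, restr (ell F) = F.

Definition e_ (lambda : R) : Loo R := Loo_class (fun x : R => expi (lambda * x)).

Definition closed_subalgebra (A : set (Loo R)) : Prop :=
  [/\ closed A, A 0,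
      forall (c : R[i]) phi psi, A phi -> A psi -> A (c *: phi + psi) &
      forall phi psi, A phi -> A psi -> A (phi * psi)].

Definition AP : set (Loo R) := smallest closed_subalgebra (range e_).

Definition APminus : set (Loo R) :=
  smallest closed_subalgebra (e_ @` [set lambda | lambda <= 0]).

(* The invertible elements of a subalgebra [B] of L^oo with [1] in [B] *)
Definition invertibles (B : set (Loo R)) : set (Loo R) :=
  [set phi | B phi /\ exists2 psi, B psi & phi * psi = 1].

(* The inverse in the algebra L^oo; it is unique when it exists *)
Definition Loo_inv (phi : Loo R) : Loo R := xget 0 [set psi | phi * psi = 1].

Definition AP_asymmetric_factorization
    (phi phi_minus : Loo R) (lambda : R) (phi_e : Loo R) : Prop :=
  [/\ phi = phi_minus * e_ lambda * phi_e,
      invertibles APminus phi_minus,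
      invertibles setT phi_e &
      reflection phi_e = phi_e].

End operators.

Definition bounded_linear_operator (K : numFieldType) (X Y : normedModType K)
    (T : X -> Y) : Prop :=
  linear T /\ exists M : K, forall x, `|T x| <= M * `|x|.

Definition reflexive_generalized_inverse (K : numFieldType)
    (X Y : normedModType K) (T : X -> Y) (Tm : Y -> X) : Prop :=
  [/\ bounded_linear_operator T, bounded_linear_operator Tm,
      T \o Tm \o T = T & Tm \o T \o Tm = Tm].

(* Main.v *)
Require Import Defs.
From mathcomp Require Import all_boot all_order all_algebra.
From mathcomp Require Import all_classical all_reals all_analysis.
From mathcomp Require Import measurable_realfun ess_sup_inf hoelder.
From mathcomp.real_closed Require Import complex.
From mathcomp Require Import ring lra.
Set Implicit Arguments.
Unset Strict Implicit.
Unset Printing Implicit Defensive.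
Import Order.TTheory GRing.Theory Num.Theory.
Import numFieldNormedType.Exports Normc.
Local Open Scope classical_set_scope.
Local Open Scope ring_scope.
Local Open Scope complex_scope.

(** Of the Fourier-Plancherel transformation F only the following is used: it is
    bounded and linear, F J F = 2 pi, F J = J F, and F turns the translation by
    lambda into the multiplication by e_lambda. With the Poisson kernel
    P_e(x) = 2 e / (e^2 + x^2) and f, g in L^1, the multiplication formula
    (int f^ g = int f g^) applied twice gives
      int f^(xi) g^(-xi) exp(- e |xi|) dxi = int f(x) (int P_e(x - y) g(y) dy) dx.
    For g the conjugate of f, Schur's test bounds the right-hand side by a multiple
    of the square of the L^2 norm of f, uniformly in e, whence the boundedness of F.
    For g the indicator of an interval, e -> 0 gives
    int f^(xi) g^(-xi) dxi = 2 pi int f g, whence F J F = 2 pi.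

    Let T_phi = r_+ F^-1 phi F l^e on L^2(R_+), so that WH_phi = T_phi r_+. Then
    T_phi T_psi = T_(phi psi) if psi is even, because F^-1 psi F preserves the even
    functions, and also if phi is in AP^-: the symbols phi such that F^-1 phi F
    preserves the functions that vanish on R_+ form a closed subalgebra which
    contains e_lambda for lambda <= 0. Hence WH_phi = T_(phi_-) T_(e_lambda)
    T_(phi_e) r_+ with both outer factors invertible, T_(e_lambda) T_(e_-lambda) = 1
    if lambda <= 0, and T_(e_-lambda) T_(e_lambda) = 1 if lambda >= 0. *)

(** * Integrals of complex functions *)

(** Both [fourier] and [fourier_inv] are total by convention: the one is a [lim], the other a choice
    by [xget], and they mean nothing until the limit is shown to exist and [fourier] to be
    bijective. Hence the completeness of L^2 and the bound on integrable functions come before any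
    algebra. No isometry is sought: a bound with a rough constant already makes the transforms of
    the truncations a Cauchy sequence, and the exact constant 2 pi enters only through the inversion
    formula. That formula is checked weakly, against indicators of intervals; they suffice because a
    function whose integral over every interval is 0 vanishes a.e. On the half-line, the Hankel term
    is absorbed by the identity I + J = l^e r_+ on L^2_+. The arbitrary extension [ell] is harmless
    because r_+ F^-1 phi_-^-1 F sees only the restriction to R_+, on which [ell f] and [ext_even f]
    agree. The two multiplication rules for T_phi act on opposite sides, so phi_- splits off on the
    left and phi_e on the right. *)

Section complex_integral.
Context d (T : measurableType d) (R : realType).
Variable mu : {measure set T -> \bar R}.
Implicit Types (f g : T -> R[i]) (c z : R[i]).

Definition cintegrable f :=
  cmeasurable f /\ (\int[mu]_x (normc (f x))%:E < +oo)%E.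

(** [Rintegral] applies [fine] to an extended real, so the value has no meaning when [f] is not
    integrable. Linearity is therefore stated for integrable functions, whereas a.e. equality and
    changes of variables only ask for measurability. *)
Definition cint f : R[i] :=
  (\int[mu]_x complex.Re (f x)) +i* (\int[mu]_x complex.Im (f x)).

Lemma normr_Re_le z : `|complex.Re z| <= normc z.
Proof.
case: z => a b /=; rewrite -sqrtr_sqr ler_wsqrtr// lerDl; exact: sqr_ge0.
Qed.

Lemma normr_Im_le z : `|complex.Im z| <= normc z.
Proof.
case: z => a b /=; rewrite -sqrtr_sqr ler_wsqrtr// lerDr; exact: sqr_ge0.
Qed.

Lemma cmeasurable_Re f : cmeasurable f -> measurable_fun setT (fun x => complex.Re (f x)).
Proof. by case. Qed.

Lemma cmeasurable_Im f : cmeasurable f -> measurable_fun setT (fun x => complex.Im (f x)).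
Proof. by case. Qed.

Lemma cintegrable_normc f : cintegrable f ->
  mu.-integrable setT (fun x => (normc (f x))%:E).
Proof.
move=> [mf h]; apply/integrableP; split.
  exact/measurable_EFinP/cmeasurable_normc.
by under eq_integral do rewrite abse_EFin ger0_norm ?normc_ge0//.
Qed.

Lemma cintegrable_le f (h : T -> R) : cmeasurable f ->
  (forall x, normc (f x) <= h x) -> mu.-integrable setT (EFin \o h) -> cintegrable f.
Proof.
move=> mf fh ih; split=> //.
have /integrableP[] : mu.-integrable setT (fun x => (normc (f x))%:E).
  apply: le_integrable ih => //.
    exact/measurable_EFinP/cmeasurable_normc.
  move=> x _ /=; rewrite lee_fin ger0_norm ?normc_ge0//.
  by rewrite (le_trans (fh x))// ler_norm.
by move=> _; under eq_integral do rewrite abse_EFin ger0_norm ?normc_ge0//.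
Qed.

Lemma cintegrable_Re f : cintegrable f ->
  mu.-integrable setT (fun x => (complex.Re (f x))%:E).
Proof.
move=> fi; apply: le_integrable (cintegrable_normc fi) => //.
  by apply/measurable_EFinP; case: fi => -[].
by move=> x _ /=; rewrite lee_fin (le_trans (normr_Re_le _))// ler_norm.
Qed.

Lemma cintegrable_Im f : cintegrable f ->
  mu.-integrable setT (fun x => (complex.Im (f x))%:E).
Proof.
move=> fi; apply: le_integrable (cintegrable_normc fi) => //.
  by apply/measurable_EFinP; case: fi => -[].
by move=> x _ /=; rewrite lee_fin (le_trans (normr_Im_le _))// ler_norm.
Qed.

Lemma cintegrableD f g : cintegrable f -> cintegrable g ->
  cintegrable (fun x => f x + g x).
Proof.
move=> fi gi; apply: (@cintegrable_le _ (fun x => normc (f x) + normc (g x))).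
- by apply: cmeasurableD; [case: fi|case: gi].
- by move=> x; exact: le_normcD.
- rewrite (_ : _ \o _ = (fun x => (normc (f x))%:E) \+ (fun x => (normc (g x))%:E))%E//.
  by apply: integrableD => //; exact: cintegrable_normc.
Qed.

Lemma cintegrableZ c f : cintegrable f -> cintegrable (fun x => c * f x).
Proof.
move=> fi; apply: (@cintegrable_le _ (fun x => normc c * normc (f x))).
- by apply: cmeasurableM; [exact: cmeasurable_cst|case: fi].
- by move=> x; rewrite normcM.
- by apply: (integrableZl _ _ (cintegrable_normc fi)).
Qed.

Lemma cintegrableN f : cintegrable f -> cintegrable (fun x => - f x).
Proof.
by move=> fi; under eq_fun do rewrite -mulN1r; exact: cintegrableZ.
Qed.

Lemma cintegrableB f g : cintegrable f -> cintegrable g ->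
  cintegrable (fun x => f x - g x).
Proof. by move=> fi gi; apply: cintegrableD => //; exact: cintegrableN. Qed.

Lemma cintD f g : cintegrable f -> cintegrable g ->
  cint (fun x => f x + g x) = cint f + cint g.
Proof.
move=> fi gi; rewrite /cint.
under eq_Rintegral do rewrite raddfD.
under [X in _ +i* X]eq_Rintegral do rewrite raddfD.
by rewrite !RintegralD//; exact: cintegrable_Re || exact: cintegrable_Im.
Qed.

Lemma cintZ c f : cintegrable f -> cint (fun x => c * f x) = c * cint f.
Proof.
move=> fi; rewrite /cint.
have ir := cintegrable_Re fi; have ii := cintegrable_Im fi.
have zl r (h : T -> R) : mu.-integrable setT (EFin \o h) ->
  mu.-integrable setT (EFin \o (fun x => r * h x)).
  by move=> /(integrableZl measurableT r).
case: c => a b.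
rewrite (_ : (fun x => complex.Re _) = (fun x =>
    a * complex.Re (f x) - b * complex.Im (f x))); last first.
  by apply/funext => x; case: (f x).
rewrite (_ : (fun x => complex.Im _) = (fun x =>
    a * complex.Im (f x) + b * complex.Re (f x))); last first.
  by apply/funext => x; case: (f x).
rewrite RintegralB//; [|exact: zl..].
rewrite RintegralD//; [|exact: zl..].
by rewrite !RintegralZl.
Qed.

Lemma cintN f : cintegrable f -> cint (fun x => - f x) = - cint f.
Proof.
by move=> fi; under eq_fun do rewrite -mulN1r; rewrite cintZ// mulN1r.
Qed.

Lemma cintB f g : cintegrable f -> cintegrable g ->
  cint (fun x => f x - g x) = cint f - cint g.
Proof. by move=> fi gi; rewrite cintD// ?cintN//; exact: cintegrableN. Qed.

Lemma normc_cint_le f : cintegrable f ->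
  normc (cint f) <= \int[mu]_x normc (f x).
Proof.
move=> fi; have [->|z0] := eqVneq (cint f) 0.
  by rewrite normc0 Rintegral_ge0// => x _; exact: normc_ge0.
have n0 : normc (cint f) != 0 by apply: contra z0 => /eqP/eq0_normc ->.
(* [|cint f| = cint (c f) = cint (Re (c f))] for the unimodular [c] below *)
pose c := (cint f)^*%C * ((normc (cint f))^-1)%:C.
have cc : c * cint f = (normc (cint f))%:C.
  rewrite /c mulrAC [_^*%C * _]mulrC.
  have -> : cint f * (cint f)^*%C = ((normc (cint f))^+2)%:C.
    case: (cint f) => a b /=; rewrite sqr_sqrtr ?addr_ge0 ?sqr_ge0//.
    by apply/eqP; rewrite eq_complex/=; apply/andP; split; apply/eqP; ring.
  by rewrite -rmorphM/= expr2 -mulrA divff// mulr1.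
have nc : normc c = 1.
  rewrite normcM (_ : normc (_^*%C) = normc (cint f)); last first.
    by case: (cint f) => a b /=; rewrite sqrrN.
  have -> : normc ((normc (cint f))^-1)%:C = (normc (cint f))^-1 :> R.
    by rewrite /= expr0n/= addr0 sqrtr_sqr ger0_norm// invr_ge0 normc_ge0.
  by rewrite divff.
have ci := cintegrableZ c fi.
have -> : normc (cint f) = \int[mu]_x complex.Re (c * f x).
  by have := congr1 (fun z : R[i] => complex.Re z) (cintZ c fi); rewrite cc /= => ->.
apply: le_Rintegral => //; [exact: cintegrable_Re|exact: cintegrable_normc|].
move=> x _; rewrite (le_trans (ler_norm _))// (le_trans (normr_Re_le _))//.
by rewrite normcM nc mul1r.
Qed.

Lemma ae_eq_cint f g : cmeasurable f -> cmeasurable g ->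
  {ae mu, forall x, f x = g x} -> cint f = cint g.
Proof.
move=> [mf1 mf2] [mg1 mg2] fg; rewrite /cint /Rintegral; congr (fine _ +i* fine _);
  apply: ae_eq_integral => //; try exact/measurable_EFinP;
  by apply: filterS fg => x + _ => ->.
Qed.

Lemma ae_eq_cintegrable f g : cmeasurable f -> cmeasurable g ->
  {ae mu, forall x, f x = g x} -> cintegrable f -> cintegrable g.
Proof.
move=> mf mg fg [_ h]; split=> //; move: h.
rewrite (@ae_eq_integral _ _ _ mu setT (fun x => (normc (f x))%:E) (fun x =>
    (normc (g x))%:E))//.
- exact/measurable_EFinP/cmeasurable_normc.
- exact/measurable_EFinP/cmeasurable_normc.
- by apply: filterS fg => x + _ => ->.
Qed.

(** Everything is phrased with the modulus of the difference, so that real dominated convergence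
    applies to [normc (f_ n x - f x)] and the complex integrals follow by [normc_cint_le]. *)
Lemma cint_dominated (f_ : nat -> T -> R[i]) f (h : T -> R) :
  (forall n, cintegrable (f_ n)) -> cintegrable f ->
  mu.-integrable setT (EFin \o h) ->
  {ae mu, forall x, normc (f_ n x - f x) @[n --> \oo] --> 0} ->
  {ae mu, forall x n, normc (f_ n x - f x) <= h x} ->
  normc (cint (f_ n) - cint f) @[n --> \oo] --> 0.
Proof.
move=> fi_ fi hi f0 fh.
have di n : cintegrable (fun x => f_ n x - f x) by exact: cintegrableB.
have mD n : measurable_fun setT (fun x => (normc (f_ n x - f x))%:E).
  by case/integrableP : (cintegrable_normc (di n)).
have [||_ _ cv] := @dominated_convergence _ _ _ mu setT measurableT
  (fun n x => (normc (f_ n x - f x))%:E) (cst 0) (EFin \o h) mD (measurable_cst _) _ hi.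
- by apply: filterS f0 => x fx _; apply: cvg_EFin => //; exact: nearW.
- apply: filterS fh => x fx n _.
  by rewrite abse_EFin lee_fin ger0_norm ?normc_ge0.
have cv0 : (\int[mu]_x normc (f_ n x - f x)) @[n --> \oo] --> 0.
  by move: cv; rewrite integral0 => /fine_cvg.
apply: (@squeeze_cvgr _ _ _ _ (fun=> 0) _ _ _ _ _ cv0) => //; last exact: cvg_cst.
apply: nearW => n; apply/andP; split; first exact: normc_ge0.
rewrite -cintB//; exact: normc_cint_le.
Qed.

End complex_integral.

(** * Fubini's theorem for complex integrals with a bounded kernel *)

Section complex_Fubini.
Context d1 d2 (T1 : measurableType d1) (T2 : measurableType d2) (R : realType).
Variables (m1 : {sigma_finite_measure set T1 -> \bar R})
          (m2 : {sigma_finite_measure set T2 -> \bar R}).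

(** By Tonelli the integrals of the positive and negative parts are measurable in [x]; so is their
    difference, and [fine] is a measurable map. *)
Lemma measurable_Rintegral_section (h : T1 * T2 -> R) : measurable_fun setT h ->
  measurable_fun setT (fun x => \int[m2]_y h (x, y)).
Proof.
move=> mh; apply: measurableT_comp => //.
have mE : measurable_fun setT (EFin \o h) by exact/measurable_EFinP.
pose f := EFin \o h; rewrite (_ : (fun x => _) = (fun x => \int[m2]_y f^\+ (x, y)
    - \int[m2]_y f^\- (x, y)))%E; last first.
  apply/funext => x; rewrite -[LHS]/(\int[m2]_y f (x, y))%E [LHS]integralE.
  under eq_integral do rewrite funepos_comp/=.
  by under [X in (_ - X = _)%E]eq_integral do rewrite funeneg_comp/=.
apply: emeasurable_funB.
- by apply: measurable_fun_fubini_tonelli_F => //; exact: measurable_funepos.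
- by apply: measurable_fun_fubini_tonelli_F => //; exact: measurable_funeneg.
Qed.

Lemma cmeasurable_cint_section (h : T1 * T2 -> R[i]) : cmeasurable h ->
  cmeasurable (fun x => cint m2 (fun y => h (x, y))).
Proof.
by move=> [mr mi]; split; [exact: measurable_Rintegral_section mr
  |exact: measurable_Rintegral_section mi].
Qed.

(** Every section is assumed integrable, not just almost every one: the inner integrals are then
    finite everywhere and [fine] can be removed point by point. *)
Lemma Rintegral_Fubini (h : T1 * T2 -> R) :
  (m1 \x m2)%E.-integrable setT (EFin \o h) ->
  (forall x, m2.-integrable setT (fun y => (h (x, y))%:E)) ->
  (forall y, m1.-integrable setT (fun x => (h (x, y))%:E)) ->
  \int[m1]_x \int[m2]_y h (x, y) = \int[m2]_y \int[m1]_x h (x, y).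
Proof.
move=> ih i1 i2; congr fine.
transitivity (\int[m1]_x \int[m2]_y (EFin \o h) (x, y))%E.
  by apply: eq_integral => x _; rewrite fineK//;
      exact: (integrable_fin_num measurableT (i1 x)).
rewrite Fubini//; apply: eq_integral => y _.
by rewrite fineK//; exact: (integrable_fin_num measurableT (i2 y)).
Qed.

Lemma bounded_kernel_integrable (k : T2 -> R[i]) (M : R) (g : T2 -> R[i]) :
  cmeasurable k -> (forall z, normc (k z) <= M) -> cintegrable m2 g ->
  cintegrable m2 (fun y => k y * g y).
Proof.
move=> mk kM ig; apply: (@cintegrable_le _ _ _ _ _ (fun y => M * normc (g y))).
- by apply: cmeasurableM => //; case: ig.
- by move=> y; rewrite normcM ler_wpM2r ?normc_ge0.
- exact: (integrableZl _ _ (cintegrable_normc ig)).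
Qed.

End complex_Fubini.

Lemma cmeasurable_comp d1 d2 (T1 : measurableType d1) (T2 : measurableType d2)
    (R : realType) (f : T2 -> R[i]) (phi : T1 -> T2) :
  cmeasurable f -> measurable_fun setT phi -> cmeasurable (fun x => f (phi x)).
Proof. by move=> [mr mi] mphi; split;
  [exact: (measurableT_comp mr mphi)|exact: (measurableT_comp mi mphi)]. Qed.

Section bounded_kernel_Fubini.
Context d1 d2 (T1 : measurableType d1) (T2 : measurableType d2) (R : realType).
Variables (m1 : {sigma_finite_measure set T1 -> \bar R})
          (m2 : {sigma_finite_measure set T2 -> \bar R}).

(** The product has modulus at most M |f x| |g y|, so Tonelli makes it integrable on the product
    space. The bound on the kernel also makes each single section integrable. *)
Lemma cint_bounded_kernel (k : T1 * T2 -> R[i]) (M : R) (f : T1 -> R[i])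
    (g : T2 -> R[i]) : 0 <= M ->
  cmeasurable k -> (forall z, normc (k z) <= M) ->
  cintegrable m1 f -> cintegrable m2 g ->
  cint m1 (fun x => f x * cint m2 (fun y => k (x, y) * g y)) =
  cint m2 (fun y => g y * cint m1 (fun x => k (x, y) * f x)).
Proof.
move=> M0 mk kM fi gi.
have mk1 x : cmeasurable (fun y => k (x, y)).
  exact: cmeasurable_comp mk (pair1_measurable x).
have mk2 y : cmeasurable (fun x => k (x, y)).
  exact: cmeasurable_comp mk (pair2_measurable y).
have kg x : cintegrable m2 (fun y => k (x, y) * g y).
  exact: (bounded_kernel_integrable (M := M)).
have kf y : cintegrable m1 (fun x => k (x, y) * f x).
  exact: (bounded_kernel_integrable (M := M)).
pose h z := f z.1 * (k z * g z.2).
have mh : cmeasurable h.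
  apply: cmeasurableM; last apply: cmeasurableM => //.
  - by apply: cmeasurable_comp measurable_fst; case: fi.
  - by apply: cmeasurable_comp measurable_snd; case: gi.
have hE x y : h (x, y) = g y * (k (x, y) * f x) by rewrite /h /=; ring.
have hM z : normc (h z) <= normc (f z.1) * (M * normc (g z.2)).
  by rewrite !normcM ler_wpM2l ?normc_ge0// ler_wpM2r ?normc_ge0.
have i1 x : cintegrable m2 (fun y => h (x, y)) by exact: (cintegrableZ (f x) (kg x)).
have i2 y : cintegrable m1 (fun x => h (x, y)).
  rewrite (funext (hE^~ y)). exact: (cintegrableZ (g y) (kf y)).
have [mg goo] := gi; have [mf foo] := fi.
have mng : measurable_fun setT (fun y => (normc (g y))%:E).
  exact/measurable_EFinP/cmeasurable_normc.
have mnf : measurable_fun setT (fun x => (normc (f x))%:E).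
  exact/measurable_EFinP/cmeasurable_normc.
have ig0 : (0 <= \int[m2]_y (normc (g y))%:E)%E.
  by apply: integral_ge0 => y _; rewrite lee_fin normc_ge0.
have [c cE] : exists c, (\int[m2]_y (normc (g y))%:E)%E = c%:E.
  by exists (fine (\int[m2]_y (normc (g y))%:E)%E); rewrite fineK// ge0_fin_numE.
have ih : (m1 \x m2)%E.-integrable setT (fun z => (normc (h z))%:E).
  apply/integrable12ltyP; first exact/measurable_EFinP/cmeasurable_normc.
  apply: (@le_lt_trans _ _ (\int[m1]_x ((M * c)%:E * (normc (f x))%:E))%E).
    apply: ge0_le_integral => //.
    - by move=> x _; exact: integral_ge0.
    - apply: (measurable_fun_fubini_tonelli_F (fun z => `|(normc (h z))%:E|%E)) => //.
      by apply: measurableT_comp => //; exact/measurable_EFinP/cmeasurable_normc.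
    - exact: measurable_funeM.
    - move=> x _; rewrite EFinM -cE muleAC -EFinM -ge0_integralZl//; last 2 first.
      + by move=> y _; rewrite lee_fin normc_ge0.
      + by rewrite lee_fin mulr_ge0 ?normc_ge0.
      apply: ge0_le_integral => //.
      + apply: measurableT_comp => //; apply/measurable_EFinP/cmeasurable_normc.
        exact: cmeasurable_comp mh (pair1_measurable x).
      + exact: measurable_funeM.
      + move=> y _; rewrite abse_EFin ger0_norm ?normc_ge0// -EFinM lee_fin.
        by rewrite (le_trans (hM _))//= mulrCA mulrA.
  rewrite ge0_integralZl//; last 2 first.
  + by move=> y _; rewrite lee_fin normc_ge0.
  + by rewrite lee_fin mulr_ge0// -lee_fin -cE.
  by rewrite lte_mul_pinfty// lee_fin mulr_ge0// -lee_fin -cE.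
have ch : cintegrable (m1 \x m2)%E h.
  split=> //; move/integrableP : ih => [_]; congr (_ < _)%E.
  by apply: eq_integral => z _; rewrite abse_EFin ger0_norm ?normc_ge0.
transitivity (cint m1 (fun x => cint m2 (fun y => h (x, y)))).
  by congr cint; apply/funext => x; rewrite /h/= cintZ.
transitivity (cint m2 (fun y => cint m1 (fun x => h (x, y)))); last first.
  congr cint; apply/funext => y; rewrite -cintZ//.
  by congr cint; apply/funext => x.
rewrite /cint/=; congr (_ +i* _).
- apply: (Rintegral_Fubini (h := fun z => complex.Re (h z))).
  + exact: (cintegrable_Re ch).
  + by move=> x; exact: cintegrable_Re (i1 x).
  + by move=> y; exact: cintegrable_Re (i2 y).
- apply: (Rintegral_Fubini (h := fun z => complex.Im (h z))).
  + exact: (cintegrable_Im ch).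
  + by move=> x; exact: cintegrable_Im (i1 x).
  + by move=> y; exact: cintegrable_Im (i2 y).
Qed.

End bounded_kernel_Fubini.

(** * Measure-preserving maps; invariance of Lebesgue measure under translation and reflection *)

Section measure_preserving.
Context d (T : measurableType d) (R : realType).
Variables (mu : {measure set T -> \bar R}) (phi : T -> T).
Hypothesis mphi : measurable_fun setT phi.
Hypothesis phiE : forall A, measurable A -> mu (phi @^-1` A) = mu A.

Lemma ge0_integral_preserving (f : T -> \bar R) : measurable_fun setT f ->
  (forall x, 0 <= f x)%E -> (\int[mu]_x f (phi x) = \int[mu]_x f x)%E.
Proof.
move=> mf f0.
transitivity (\int[pushforward mu phi]_x f x)%E.
  by rewrite ge0_integral_pushforward// preimage_setT.
by apply: eq_measure_integral => A mA _; exact: phiE.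
Qed.

Lemma integral_preserving (f : T -> \bar R) : measurable_fun setT f ->
  (\int[mu]_x f (phi x) = \int[mu]_x f x)%E.
Proof.
move=> mf; rewrite integralE [RHS]integralE.
under eq_integral do rewrite (funepos_comp f phi)/=.
under [X in (_ - X = _)%E]eq_integral do rewrite (funeneg_comp f phi)/=.
by rewrite !ge0_integral_preserving//;
    [exact: measurable_funeneg|exact: measurable_funepos].
Qed.

Lemma ae_preserving (P : set T) : {ae mu, forall x, P x} -> {ae mu, forall x, P (phi x)}.
Proof.
move=> [N [mN N0 PN]]; exists (phi @^-1` N); split.
- by rewrite -[X in measurable X]setTI; exact: mphi.
- by rewrite phiE.
- by move=> x /= nPx; exact: PN.
Qed.

Lemma cint_preserving (f : T -> R[i]) : cmeasurable f ->
  cint mu (fun x => f (phi x)) = cint mu f.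
Proof.
move=> [mr mi]; rewrite /cint /Rintegral; congr (fine _ +i* fine _).
- by rewrite (@integral_preserving (fun x => (complex.Re (f x))%:E))//;
    exact/measurable_EFinP.
- by rewrite (@integral_preserving (fun x => (complex.Im (f x))%:E))//;
    exact/measurable_EFinP.
Qed.

End measure_preserving.

Section lebesgue_invariance.
Context (R : realType).
Local Notation mu := (@lebesgue_measure R).

(** The image measure agrees with Lebesgue measure on half-open intervals, which determine it. *)
Lemma lebesgue_measure_shift (a : R) (A : set (measurableTypeR R)) :
  measurable A -> mu ((fun x : measurableTypeR R => x + a) @^-1` A) = mu A.
Proof.
have ms : measurable_fun [set: measurableTypeR R] (fun x : measurableTypeR R =>
    x + a : measurableTypeR R).
  by apply: measurable_funD.
pose phi (x : measurableTypeR R) := x + a : measurableTypeR R.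
move=> mA; apply/esym; rewrite -[RHS]/(pushforward mu phi A).
apply: lebesgue_measure_unique => // X [[u v] _ <-]; rewrite /= /pushforward /phi.
have -> : (fun x : measurableTypeR R =>
    x + a) @^-1` `]u, v]%classic = `](u - a), (v - a)]%classic.
  by apply/seteqP; split => x /=; rewrite !in_itv/= ltrBlDr lerBrDr.
rewrite !lebesgue_measure_itv/= !lte_fin ltrD2r.
by case: ifP => // _; rewrite -!EFinD opprB addrA subrK.
Qed.

Lemma lebesgue_measure_opp (A : set (measurableTypeR R)) :
  measurable A -> mu ((fun x : measurableTypeR R => - x) @^-1` A) = mu A.
Proof.
have ms : measurable_fun [set: measurableTypeR R] (fun x : measurableTypeR R =>
    - x : measurableTypeR R).
  exact: oppr_measurable.
pose phi (x : measurableTypeR R) := - x : measurableTypeR R.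
move=> mA; apply/esym; rewrite -[RHS]/(pushforward mu phi A).
apply: lebesgue_measure_unique => // X [[u v] _ <-]; rewrite /= /pushforward /phi.
have -> : (fun x : measurableTypeR R =>
    - x) @^-1` `]u, v]%classic = `[(- v), (- u)[%classic.
  by apply/seteqP; split => x /=; rewrite !in_itv/= ltrNr lerNl andbC.
rewrite !lebesgue_measure_itv/= !lte_fin ltrN2.
by case: ifP => // _; rewrite -!EFinD opprK addrC.
Qed.

End lebesgue_invariance.

(** * Abel summation and the Poisson kernel *)

Section expi_theory.
Context (R : realType).
Implicit Types (s t : R).

Lemma expiD s t : expi (s + t) = expi s * expi t.
Proof.
rewrite /expi cosD sinD; apply/eqP; rewrite eq_complex/=.
by apply/andP; split; apply/eqP; ring.
Qed.

Lemma expi0 : expi 0 = 1 :> R[i].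
Proof. by rewrite /expi cos0 sin0. Qed.

Lemma expiNM t : expi (- t) * expi t = 1.
Proof. by rewrite -expiD addNr expi0. Qed.

Lemma normc_expi t : normc (expi t) = 1.
Proof. by rewrite /expi/= cos2Dsin2 sqrtr1. Qed.

Lemma cmeasurable_expi : cmeasurable (@expi R : measurableTypeR R -> R[i]).
Proof.
split; apply: continuous_measurable_fun;
  [exact: continuous_cos|exact: continuous_sin].
Qed.

Lemma cmeasurable_expiM d (T : measurableType d) (f : T -> R) :
  measurable_fun setT f -> cmeasurable (fun x => expi (f x)).
Proof. by move=> mf; exact: (cmeasurable_comp cmeasurable_expi mf). Qed.

End expi_theory.

Section poisson_kernel.
Context (R : realType).
Local Notation mu := (@lebesgue_measure R).
Implicit Types (e x y a b : R).

(** The integrand may contain |x|; on x > 0 it coincides with a function [g] free of absolute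
    values, whose antiderivative [F] is differentiable on the whole line. Evenness doubles the
    integral over the half-line. *)
Lemma ge0_even_FTC2 (f F g : R -> R) (l : R) : (forall x, 0 <= f x) ->
  continuous f -> f =1 f \o -%R -> (forall x, is_derive x 1 F (g x)) ->
  (forall x, 0 < x -> g x = f x) -> F x @[x --> +oo] --> l ->
  (\int[mu]_x (f x)%:E = (2 * (l - F 0))%:E)%E.
Proof.
move=> f0 cf ef dF gf Fl; rewrite ge0_symfun_integralT// -set_itvcy.
have cF x : {for x, continuous F}.
  by apply: differentiable_continuous; apply/derivable1_diffP; case: (dF x).
rewrite (@ge0_continuous_FTC2y _ f F 0 l)//.
- exact: continuous_subspaceT.
- by apply: cvg_at_right_filter; exact: cF.
- move=> x; rewrite in_itv/= andbT => x0; rewrite derive1E.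
  by have [_ ->] := dF x; rewrite gf.
Qed.

Definition abel_kernel e (xi : R) : R := expR (- (e * `|xi|)).
(** Normalized to total mass 2 pi: it is the Fourier transform of the Abel kernel for the kernel
    exp(i xi x) without prefactor. *)
Definition poisson_kernel e x : R := 2 * e / (e ^+ 2 + x ^+ 2).

Lemma continuous_abel e : continuous (abel_kernel e).
Proof.
move=> x; apply: (@continuous_comp _ _ _ (fun x => - (e * `|x|)) expR); last first.
  exact: continuous_expR.
apply: cvgN; apply: cvgM; first exact: cvg_cst.
exact: norm_continuous.
Qed.

Lemma abel_even e x : abel_kernel e (- x) = abel_kernel e x.
Proof. by rewrite /abel_kernel normrN. Qed.

Lemma cvg_expRNM e : 0 < e -> expR (- (e * x)) @[x --> +oo] --> 0.
Proof.
move=> e0; apply: (@cvg_comp _ _ _ (fun x => e * x) (fun x =>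
    expR (- x)) _ (pinfty_nbhs R)).
  exact: gt0_cvgMry.
exact: cvgr_expR.
Qed.

Lemma cvg_expRNM_bounded e (h : R -> R) (M : R) : 0 < e ->
  (forall x, `|h x| <= M) -> expR (- (e * x)) * h x @[x --> +oo] --> 0.
Proof.
move=> e0 hM; apply/norm_cvg0P.
apply: (@squeeze_cvgr _ _ _ _ (fun=> 0) (fun x => expR (- (e * x)) * M)).
- apply: nearW => x; rewrite normr_ge0/= normrM ger0_norm ?expR_ge0//.
  by rewrite ler_wpM2l ?expR_ge0.
- exact: cvg_cst.
- by rewrite -[X in _ --> X](mul0r M); apply: cvgM; [exact: cvg_expRNM|exact: cvg_cst].
Qed.

Lemma integral_abel e : 0 < e -> (\int[mu]_x (abel_kernel e x)%:E = (2 / e)%:E)%E.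
Proof.
move=> e0; have en0 : e != 0 by rewrite gt_eqF.
have dF (x : R) : is_derive x 1 (fun x =>
    expR (- (e * x)) * - e^-1 : R) (expR (- (e * x))).
  apply: is_derive_eq.
  by rewrite /GRing.scale/=; field.
rewrite (ge0_even_FTC2 (l := 0) _ _ _ dF).
- by rewrite mulr0 oppr0 expR0 mul1r sub0r opprK.
- by move=> x; exact: expR_ge0.
- exact: continuous_abel.
- by move=> x /=; rewrite abel_even.
- by move=> x x0; rewrite /abel_kernel gtr0_norm.
- apply: (@cvg_expRNM_bounded _ _ e^-1) => // x.
  by rewrite normrN ger0_norm// invr_ge0 ltW.
Qed.

(* The term [1] makes the integrand nonnegative, as the improper integrals of
   the library require. *)
Lemma integral_abel_cos e x : 0 < e ->
  (\int[mu]_xi ((1 + cos (x * xi)) * abel_kernel e xi)%:E = (2 / e + poisson_kernel e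
      x)%:E)%E.
Proof.
move=> e0; have en0 : e != 0 by rewrite gt_eqF.
have ex0 : e ^+ 2 + x ^+ 2 != 0 by rewrite gt_eqF// ltr_pwDl ?exprn_gt0 ?sqr_ge0.
(* The quotient is the real part of exp(i x xi) / (- e + i x), which comes from integrating exp((- e
   + i x) xi). *)
pose H (xi : R) : R := - e^-1 + (x * sin (x * xi) - e * cos (x * xi)) / (e ^+ 2 + x ^+ 2).
have dF (xi : R) : is_derive xi 1 (fun xi => expR (- (e * xi)) * H xi : R)
    ((1 + cos (x * xi)) * expR (- (e * xi))).
  rewrite /H; apply: is_derive_eq.
  by rewrite /GRing.scale/=; field; rewrite ex0 en0.
rewrite (ge0_even_FTC2 (l := 0) _ _ _ dF).
- rewrite /H !mulr0 oppr0 expR0 sin0 cos0 /poisson_kernel; congr EFin.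
  by field; rewrite ex0 en0.
- move=> xi; rewrite mulr_ge0 ?expR_ge0// -lerBlDl sub0r cos_geN1.
- move=> xi; apply: cvgM; last exact: continuous_abel.
  apply: cvgD; first exact: cvg_cst.
  apply: (@continuous_comp _ _ _ ( *%R x) cos); last exact: continuous_cos.
  exact: mulrl_continuous.
- by move=> xi /=; rewrite abel_even mulrN cosN.
- by move=> xi x0; rewrite /abel_kernel gtr0_norm.
- apply: (@cvg_expRNM_bounded _ _ (e^-1 + (`|x| + e) / (e ^+ 2 + x ^+ 2))) => // xi.
  rewrite /H (le_trans (ler_normD _ _))// normrN ger0_norm ?invr_ge0 ?(ltW e0)// lerD2l.
  rewrite normrM [X in _ * X <= _]ger0_norm ?invr_ge0 ?addr_ge0 ?sqr_ge0//.
  rewrite ler_wpM2r ?invr_ge0 ?addr_ge0 ?sqr_ge0//.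
  rewrite (le_trans (ler_normB _ _))// !normrM (ger0_norm (ltW e0)) lerD//.
    by rewrite ler_piMr// ler_norml sin_geN1 sin_le1.
  by rewrite ler_piMr ?(ltW e0)// ler_norml cos_geN1 cos_le1.
Qed.

Lemma continuous_poisson e : 0 < e -> continuous (poisson_kernel e).
Proof.
move=> e0 x; have ex0 : e ^+ 2 + x ^+ 2 != 0 by rewrite gt_eqF// ltr_pwDl ?exprn_gt0
    ?sqr_ge0.
apply: cvgM; first exact: cvg_cst.
apply: cvgV => //; apply: cvgD; first exact: cvg_cst.
exact: exprn_continuous.
Qed.

Lemma integral_poisson e : 0 < e -> (\int[mu]_x (poisson_kernel e x)%:E = (2 * pi)%:E)%E.
Proof.
move=> e0; have en0 : e != 0 by rewrite gt_eqF.
have ex0 x : e ^+ 2 + x ^+ 2 != 0 by rewrite gt_eqF// ltr_pwDl ?exprn_gt0 ?sqr_ge0.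
have dF (x : R) : is_derive x 1 (fun x => 2 * atan (x / e) : R) (poisson_kernel e x).
  apply: is_derive_eq.
  by rewrite /GRing.scale/= /poisson_kernel; field; rewrite en0 ex0.
rewrite (ge0_even_FTC2 (l := pi) _ _ _ dF).
- by rewrite mul0r atan0 mulr0 subr0.
- by move=> x; rewrite /poisson_kernel divr_ge0 ?mulr_ge0 ?(ltW e0)// addr_ge0 ?sqr_ge0.
- exact: continuous_poisson.
- by move=> x /=; rewrite /poisson_kernel sqrrN.
- by [].
- rewrite (_ : pi = 2 * (pi / 2)); last by field.
  apply: cvgM; first exact: cvg_cst.
  apply: (@cvg_comp _ _ _ (fun x => x / e) atan _ (pinfty_nbhs R)); last exact: cvgy_atan.
  by apply: gt0_cvgMly; rewrite ?invr_gt0.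
Qed.

Lemma integral_poisson_itv e x a b : 0 < e -> a < b ->
  (\int[mu]_(y in `[a, b]) (poisson_kernel e (x - y))%:E =
   (2 * (atan ((b - x) / e) - atan ((a - x) / e)))%:E)%E.
Proof.
move=> e0 ab; have en0 : e != 0 by rewrite gt_eqF.
have ex0 y : e ^+ 2 + y ^+ 2 != 0 by rewrite gt_eqF// ltr_pwDl ?exprn_gt0 ?sqr_ge0.
have dF (y : R) : is_derive y 1 (fun y =>
    2 * atan ((y - x) / e) : R) (poisson_kernel e (x - y)).
  apply: is_derive_eq.
  by rewrite /GRing.scale/= /poisson_kernel; field; rewrite en0 ex0.
have cF : continuous (fun y => 2 * atan ((y - x) / e) : R).
  by move=> y; apply: differentiable_continuous; apply/derivable1_diffP; case: (dF y).
rewrite (@continuous_FTC2 _ _ (fun y => 2 * atan ((y - x) / e)))//.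
- by rewrite -EFinB mulrBr.
- apply: continuous_subspaceT => y.
  apply: (@continuous_comp _ _ _ (fun y => x - y) (poisson_kernel e));
      last exact: continuous_poisson.
  by apply: cvgB; [exact: cvg_cst|exact: cvg_id].
- split.
  + by move=> y _; case: (dF y).
  + by apply: cvg_at_right_filter; exact: cF.
  + by apply: cvg_at_left_filter; exact: cF.
- by move=> y _; rewrite derive1E; have [_ ->] := dF y.
Qed.

(** The Poisson integral of the indicator of [a, b] at x, for e = 1 / (n + 1), is the difference of
    two such terms, with [c = b - x] and [c = a - x]; its limit is read off from the signs. *)
Lemma cvg_atan_dilation (c : R) :
  2 * atan (c * n.+1%:R) @[n --> \oo] --> pi * Num.sg c.
Proof.
have cy : (fun n : nat => n.+1%:R : R) @ \oo --> +oo by rewrite (cvg_shiftS (fun n =>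
    n%:R : R)); exact: cvgr_idn.
have pos (b : R) : 0 < b -> 2 * atan (b * n.+1%:R) @[n --> \oo] --> pi.
  move=> b0; rewrite [X in _ --> X](_ : pi = 2 * (pi / 2)); last by field.
  apply: cvgM; first exact: cvg_cst.
  apply: (@cvg_comp _ _ _ (fun n : nat => n.+1%:R) (fun x =>
      atan (b * x)) _ (pinfty_nbhs R)) => //.
  apply: (@cvg_comp _ _ _ (fun x => b * x) atan _ (pinfty_nbhs R)); last exact: cvgy_atan.
  exact: gt0_cvgMry.
case: (sgrP c) => [->|c0|c0].
- rewrite mulr0 [X in X @ _](_ : _ = fun=> 0); first exact: cvg_cst.
  by apply/funext => n; rewrite mul0r atan0 mulr0.
- by rewrite mulr1; exact: pos.
- rewrite mulrN1 [X in X @ _](_ : _ = fun n : nat => - (2 * atan (- c * n.+1%:R))).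
    by apply: cvgN; apply: pos; rewrite oppr_gt0.
  by apply/funext => n; rewrite mulNr atanN mulrN opprK.
Qed.

Lemma cintegrable_abel e : 0 < e -> cintegrable mu (fun xi => (abel_kernel e xi)%:C).
Proof.
move=> e0; split.
  split => /=; last exact: measurable_cst.
  by apply: continuous_measurable_fun; exact: continuous_abel.
rewrite (_ : \int[mu]_x _ = (2 / e)%:E)%E ?ltry// -integral_abel//.
apply: eq_integral => x _; congr EFin.
by rewrite /= expr0n addr0 sqrtr_sqr ger0_norm// expR_ge0.
Qed.

Lemma cint_abel e x : 0 < e ->
  cint mu (fun xi => expi (x * xi) * (abel_kernel e xi)%:C) = (poisson_kernel e x)%:C.
Proof.
move=> e0; have ia := cintegrable_Re (cintegrable_abel e0).
have mcos : measurable_fun setT (fun xi : measurableTypeR R => cos (x * xi)).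
  by apply: cmeasurable_Re (cmeasurable_expiM _); exact: measurable_funM.
have msin : measurable_fun setT (fun xi : measurableTypeR R => sin (x * xi)).
  by apply: cmeasurable_Im (cmeasurable_expiM _); exact: measurable_funM.
have mabel : measurable_fun setT (abel_kernel e : measurableTypeR R -> R).
  by have [[]] := cintegrable_abel e0.
have icos : mu.-integrable setT (fun xi => (cos (x * xi) * abel_kernel e xi)%:E).
  apply: le_integrable ia => //; first by apply/measurable_EFinP; exact: measurable_funM.
  move=> xi _ /=; rewrite lee_fin normrM ler_piMl// ler_norml.
  by rewrite cos_geN1 cos_le1.
have isin : mu.-integrable setT (fun xi => (sin (x * xi) * abel_kernel e xi)%:E).
  apply: le_integrable ia => //; first by apply/measurable_EFinP; exact: measurable_funM.
  move=> xi _ /=; rewrite lee_fin normrM ler_piMl// ler_norml.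
  by rewrite sin_geN1 sin_le1.
rewrite /cint; congr (_ +i* _).
- rewrite (_ : (fun xi => complex.Re _) = fun xi => cos (x * xi) * abel_kernel e xi);
    last first.
    by apply/funext => xi /=; rewrite mulr0 subr0.
  (* The summand 1 contributes 2 / e, the integral of the Abel kernel itself, and cancels. *)
  have := integral_abel_cos x e0.
  have -> : (\int[mu]_xi ((1 + cos (x * xi)) * abel_kernel e xi)%:E =
     \int[mu]_xi (abel_kernel e xi)%:E + \int[mu]_xi (cos (x * xi) * abel_kernel e
         xi)%:E)%E.
    by rewrite -integralD//; apply: eq_integral => xi _; rewrite mulrDl mul1r.
  rewrite integral_abel//.
  have -> : (\int[mu]_xi (cos (x * xi) * abel_kernel e xi)%:E =
      (\int[mu]_xi (cos (x * xi) * abel_kernel e xi))%R%:E)%E.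
    by rewrite /Rintegral fineK//; exact: (integrable_fin_num measurableT icos).
  by rewrite -EFinD => -[] /addrI.
- rewrite (_ : (fun xi => complex.Im _) = fun xi => sin (x * xi) * abel_kernel e xi);
    last first.
    by apply/funext => xi /=; rewrite mulr0 add0r.
  set s := Rintegral _ _ _.
  (* The sine integrand is odd, so that the reflection turns its integral into the opposite. *)
  suff : s = - s by lra.
  rewrite {1}/s /Rintegral -(@integral_preserving _ _ _ mu (fun x : measurableTypeR R
      => - x)
    (@oppr_measurable _ _) (@lebesgue_measure_opp R)); last first.
    by apply/measurable_EFinP; exact: measurable_funM.
  under eq_integral do rewrite mulrN sinN mulNr abel_even EFinN.
  by rewrite integralN/= ?fineN//; exact: integrable_add_def.
Qed.

End poisson_kernel.

(** * The Fourier transform of integrable functions *)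

Section fourier_L1.
Context (R : realType).
Local Notation mu := (@lebesgue_measure R).
Local Notation T := (measurableTypeR R).
Implicit Types (f g : T -> R[i]) (x y xi a b e : R).

Definition fhat f (xi : T) : R[i] := cint mu (fun x => expi (xi * x) * f x).

Lemma measurable_mulr x : measurable_fun setT (fun y : T => x * y : T).
Proof. exact: measurable_funM. Qed.

Lemma cmeasurable_expi2 : cmeasurable (fun z : T * T => expi (z.1 * z.2)).
Proof.
by apply: cmeasurable_expiM; apply: measurable_funM;
  [exact: measurable_fst|exact: measurable_snd].
Qed.

Lemma cintegrable_expiM f xi : cintegrable mu f ->
  cintegrable mu (fun x => expi (xi * x) * f x).
Proof.
apply: (bounded_kernel_integrable (M := 1)).
  by apply: cmeasurable_expiM; exact: measurable_mulr.
by move=> x; rewrite normc_expi.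
Qed.

Lemma cmeasurable_fhat f : cmeasurable f -> cmeasurable (fhat f).
Proof.
move=> mf; apply: (@cmeasurable_cint_section _ _ T T R mu
  (fun z => expi (z.1 * z.2) * f z.2)).
apply: cmeasurableM; first exact: cmeasurable_expi2.
by apply: (cmeasurable_comp mf); exact: measurable_snd.
Qed.

Lemma normc_fhat_le f xi : cintegrable mu f ->
  normc (fhat f xi) <= \int[mu]_x normc (f x).
Proof.
move=> fi; apply: (le_trans (normc_cint_le (cintegrable_expiM xi fi))).
by under eq_Rintegral do rewrite normcM normc_expi mul1r.
Qed.

Lemma cint_mul_fhat f g : cintegrable mu f -> cintegrable mu g ->
  cint mu (fun x => f x * fhat g x) = cint mu (fun y => g y * fhat f y).
Proof.
move=> fi gi.
have k1 (z : T * T) : normc (expi (z.1 * z.2)) <= 1 by rewrite normc_expi.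
rewrite /fhat (@cint_bounded_kernel _ _ T T R mu mu _ _ f g ler01 cmeasurable_expi2 k1
    fi gi).
by congr cint; apply/funext => y; congr (_ * cint _ _); apply/funext => x /=;
    rewrite [x * y]mulrC.
Qed.

Lemma cmeasurable_opp f : cmeasurable f -> cmeasurable (fun x : T => f (- x)).
Proof. by move=> mf; apply: (cmeasurable_comp mf); exact: oppr_measurable. Qed.

Lemma cmeasurable_shift f a : cmeasurable f -> cmeasurable (fun x : T => f (x + a)).
Proof. by move=> mf; apply: (cmeasurable_comp mf); exact: measurable_funD. Qed.

Lemma cint_opp f : cmeasurable f -> cint mu (fun x => f (- x)) = cint mu f.
Proof.
move=> mf; apply: (@cint_preserving _ _ _ mu (fun x : T => - x)) => //.
  exact: oppr_measurable.
exact: lebesgue_measure_opp.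
Qed.

Lemma cint_shift f a : cmeasurable f -> cint mu (fun x => f (x + a)) = cint mu f.
Proof.
move=> mf; apply: (@cint_preserving _ _ _ mu (fun x : T => x + a)) => //.
  exact: measurable_funD.
exact: lebesgue_measure_shift.
Qed.

Lemma cmeasurable_fhatI f xi : cmeasurable f ->
  cmeasurable (fun x : T => expi (xi * x) * f x).
Proof.
by apply: cmeasurableM; apply: cmeasurable_expiM; exact: measurable_mulr.
Qed.

Lemma fhat_opp f xi : cmeasurable f -> fhat (fun x => f (- x)) xi = fhat f (- xi).
Proof.
move=> mf; rewrite /fhat -[RHS]cint_opp; last exact: cmeasurable_fhatI.
by congr cint; apply/funext => x; rewrite mulrNN.
Qed.

Lemma fhat_shift f a xi : cintegrable mu f ->
  fhat (fun x => f (x - a)) xi = expi (xi * a) * fhat f xi.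
Proof.
move=> fi; rewrite /fhat -cintZ; last exact: cintegrable_expiM.
rewrite -[RHS](@cint_shift _ (- a)); last first.
  apply: cmeasurableM; first exact: cmeasurable_cst.
  by apply: cmeasurable_fhatI; case: fi.
congr cint; apply/funext => x; rewrite mulrA -expiD.
by congr (expi _ * _); ring.
Qed.

Lemma fhat_conj f xi : cintegrable mu f ->
  fhat (fun x => (f x)^*%C) xi = (fhat f (- xi))^*%C.
Proof.
move=> fi; have fi2 := cintegrable_expiM (- xi) fi.
have cE x : cos (- xi * x) = cos (xi * x) by rewrite mulNr cosN.
have sE x : sin (- xi * x) = - sin (xi * x) by rewrite mulNr sinN.
rewrite /fhat /cint.
rewrite [RHS]/=; congr (_ +i* _).
  congr (Rintegral _ _ _); apply/funext => x; rewrite /expi cE sE.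
  by case: (f x) => u v /=; ring.
have := cintegrable_Im fi2.
set h := (fun x => complex.Im (expi (- xi * x) * f x)).
move=> ih; transitivity (\int[mu]_x (- 1 * h x)); last first.
  by rewrite RintegralZl// mulN1r.
congr (Rintegral _ _ _); apply/funext => x; rewrite /h /expi cE sE.
by case: (f x) => u v /=; ring.
Qed.

Lemma fhat_abel_integrable f e : 0 < e -> cintegrable mu f ->
  cintegrable mu (fun xi => fhat f xi * (abel_kernel e xi)%:C).
Proof.
move=> e0 fi.
apply: (bounded_kernel_integrable (M := \int[mu]_x normc (f x))).
- by apply: cmeasurable_fhat; case: fi.
- by move=> xi; exact: normc_fhat_le.
- exact: cintegrable_abel.
Qed.

Lemma cintegrable_opp f : cintegrable mu f -> cintegrable mu (fun x => f (- x)).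
Proof.
move=> [mf foo]; split; first exact: cmeasurable_opp.
rewrite (@integral_preserving _ _ _ mu (fun x : T => - x) (@oppr_measurable _ _)
  (@lebesgue_measure_opp R) (fun x => (normc (f x))%:E))//.
exact/measurable_EFinP/cmeasurable_normc.
Qed.

(** The multiplication formula is used for [q] and [f], then, at each fixed [x], for [m] and the
    reflection of [g]. A transform is bounded but perhaps not integrable; the Abel factor makes [q]
    and [m] integrable, and it turns the transform of [m] into a translated Poisson kernel. *)
Lemma cint_fhat_abel f g e : 0 < e -> cintegrable mu f -> cintegrable mu g ->
  cint mu (fun xi => fhat f xi * fhat g (- xi) * (abel_kernel e xi)%:C) =
  cint mu (fun x => f x * cint mu (fun y => (poisson_kernel e (x - y))%:C * g y)).
Proof.
move=> e0 fi gi; have [mf _] := fi; have [mg _] := gi.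
have gi' := cintegrable_opp gi; have [mg' _] := gi'.
pose q xi := fhat (fun y => g (- y)) xi * (abel_kernel e xi)%:C.
have qi : cintegrable mu q by exact: fhat_abel_integrable.
transitivity (cint mu (fun xi => q xi * fhat f xi)).
  congr cint; apply/funext => xi; rewrite /q fhat_opp//; ring.
rewrite (cint_mul_fhat qi fi); congr cint; apply/funext => x; congr (_ * _).
pose m xi := expi (x * xi) * (abel_kernel e xi)%:C.
have mi : cintegrable mu m by exact/cintegrable_expiM/cintegrable_abel.
have mhat y : fhat m y = (poisson_kernel e (x + y))%:C.
  rewrite -cint_abel// /fhat; congr cint; apply/funext => xi.
  by rewrite mulrA -expiD -mulrDl addrC.
rewrite [LHS](_ : _ = cint mu (fun xi => m xi * fhat (fun y => g (- y)) xi)); last first.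
  by congr cint; apply/funext => xi; rewrite /q /m; ring.
rewrite (cint_mul_fhat mi gi') -[LHS]cint_opp; last first.
  by apply: cmeasurableM => //; apply: cmeasurable_fhat; case: mi.
by congr cint; apply/funext => y; rewrite mhat opprK mulrC.
Qed.

End fourier_L1.

(** * Square-integrable functions and the Cauchy-Schwarz inequality *)

Section L2_functions.
Context d (T : measurableType d) (R : realType).
Variable mu : {measure set T -> \bar R}.
Implicit Types f g : T -> R[i].

(** The squared L^2 norm, kept as an extended real so that an estimate can prove membership in L^2
    instead of presupposing it. *)
Definition sqint f : \bar R := (\int[mu]_x ((normc (f x)) ^+ 2)%:E)%E.

Lemma measurable_sqnormc f : cmeasurable f ->
  measurable_fun setT (fun x => ((normc (f x)) ^+ 2)%:E).
Proof.
by move=> mf; apply/measurable_EFinP; apply: measurable_funX; exact: cmeasurable_normc.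
Qed.

Lemma cLnorm2_sqint f : (cLnorm mu 2%:E f `^ 2 = sqint f)%E.
Proof.
rewrite /cLnorm powR_Lnorm ?pnatr_eq0//; apply: eq_integral => x _.
by rewrite /= ger0_norm ?normc_ge0// powR_mulrn// normc_ge0.
Qed.

Lemma in_CL2P f : in_CLp mu 2%:E f <-> cmeasurable f /\ (sqint f < +oo)%E.
Proof.
rewrite /in_CLp -cLnorm2_sqint; split=> -[mf h]; split=> //.
  by rewrite poweR_lty.
by move: h; rewrite !ltey; apply: contra => /eqP ->; rewrite poweRyr ?pnatr_eq0.
Qed.

Lemma in_CL2_fine f : in_CLp mu 2%:E f ->
  ((fine (cLnorm mu 2%:E f)) ^+ 2)%:E = sqint f.
Proof.
move=> [_ h]; rewrite -cLnorm2_sqint.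
have : cLnorm mu 2%:E f \is a fin_num by rewrite ge0_fin_numE ?cLnorm_ge0.
have : (0 <= cLnorm mu 2%:E f)%E by exact: cLnorm_ge0.
by case: (cLnorm mu 2%:E f) => //= r; rewrite lee_fin => r0 _; rewrite powR_mulrn.
Qed.

Lemma in_CL2M f g : in_CLp mu 2%:E f -> in_CLp mu 2%:E g ->
  cintegrable mu (fun x => f x * g x).
Proof.
move=> /in_CL2P[mf fo] /in_CL2P[mg go].
apply: (@cintegrable_le _ _ _ _ _ (fun x => (normc (f x)) ^+ 2 + (normc (g x)) ^+ 2)).
- exact: cmeasurableM.
- move=> x; rewrite normcM; have := sqr_ge0 (normc (f x) - normc (g x)).
  have := mulr_ge0 (normc_ge0 (f x)) (normc_ge0 (g x)).
  nra.
- have i2 h : cmeasurable h -> (sqint h < +oo)%E ->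
    mu.-integrable setT (fun x => ((normc (h x)) ^+ 2)%:E).
    move=> mh ho; apply/integrableP; split; first exact: measurable_sqnormc.
    by under eq_integral do rewrite abse_EFin ger0_norm ?sqr_ge0//.
  rewrite (_ : _ \o _ = (fun x => ((normc (f x)) ^+ 2)%:E) \+ (fun x =>
      ((normc (g x)) ^+ 2)%:E))%E//.
  by apply: integrableD => //; exact: i2.
Qed.

Lemma cauchy_schwarz f g : in_CLp mu 2%:E f -> in_CLp mu 2%:E g ->
  normc (cint mu (fun x => f x * g x)) <=
  fine (cLnorm mu 2%:E f) * fine (cLnorm mu 2%:E g).
Proof.
move=> fL gL; have fgi := in_CL2M fL gL.
apply: (le_trans (normc_cint_le fgi)).
have [mf fo] := fL; have [mg go] := gL.
have ffin : cLnorm mu 2%:E f \is a fin_num by rewrite ge0_fin_numE ?cLnorm_ge0.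
have gfin : cLnorm mu 2%:E g \is a fin_num by rewrite ge0_fin_numE ?cLnorm_ge0.
have ifin := integrable_fin_num measurableT (cintegrable_normc fgi).
rewrite -lee_fin EFinM (fineK ffin) (fineK gfin) /Rintegral (fineK ifin).
have := @hoelder _ _ _ mu (fun x => normc (f x)) (fun x => normc (g x)) 2 2
  (cmeasurable_normc mf) (cmeasurable_normc mg).
have half : 2^-1 + 2^-1 = 1 :> R by lra.
move=> /(_ _ _ _) h; apply: le_trans (h _ _ _) => //.
rewrite Lnorm1 le_eqVlt; apply/orP; left; apply/eqP; apply: eq_integral => x _.
by rewrite /= normcM ger0_norm// mulr_ge0 ?normc_ge0.
Qed.

End L2_functions.

(** * The L^2 bound for the Fourier transform of integrable functions *)

Section fhat_L2_bound.
Context (R : realType).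
Local Notation mu := (@lebesgue_measure R).
Local Notation T := (measurableTypeR R).
Implicit Types (f g : T -> R[i]) (x y xi a b e : R).

Lemma normcJ (z : R[i]) : normc (z^*)%C = normc z.
Proof. by case: z => a b /=; rewrite sqrrN. Qed.

Lemma mulcJ (z : R[i]) : z * (z^*)%C = ((normc z) ^+ 2)%:C.
Proof.
case: z => a b /=; rewrite sqr_sqrtr ?addr_ge0 ?sqr_ge0//.
by apply/eqP; rewrite eq_complex/=; apply/andP; split; apply/eqP; ring.
Qed.

Lemma normc_real (r : R) : normc r%:C = `|r|.
Proof. by rewrite /= expr0n addr0 sqrtr_sqr. Qed.

Lemma cmeasurableJ f : cmeasurable f -> cmeasurable (fun x => (f x)^*%C).
Proof.
move=> [mr mi]; split.
  rewrite (_ : (fun x => _) = (fun x => complex.Re (f x)))//.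
  by apply/funext => x; case: (f x).
rewrite (_ : (fun x => _) = (fun x => - complex.Im (f x))); last first.
  by apply/funext => x; case: (f x).
exact: measurable_funN.
Qed.

Lemma poisson_ge0 e x : 0 < e -> 0 <= poisson_kernel e x.
Proof. by move=> e0; rewrite /poisson_kernel divr_ge0 ?mulr_ge0 ?(ltW e0)// addr_ge0
    ?sqr_ge0. Qed.

Lemma poissonC e x y : poisson_kernel e (x - y) = poisson_kernel e (y - x).
Proof. by rewrite /poisson_kernel -[(x - y) ^+ 2]sqrrN opprB. Qed.

Lemma poisson_le e x : 0 < e -> poisson_kernel e x <= 2 / e.
Proof.
move=> e0; rewrite /poisson_kernel ler_pdivrMr;
    last by rewrite ltr_pwDl ?exprn_gt0 ?sqr_ge0.
rewrite mulrDr expr2 mulrA divfK ?gt_eqF// lerDl mulr_ge0 ?sqr_ge0//.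
by rewrite divr_ge0// ltW.
Qed.

Lemma measurable_poisson e : 0 < e -> measurable_fun setT (poisson_kernel e : T -> R).
Proof. by move=> e0; apply: continuous_measurable_fun; exact: continuous_poisson. Qed.

Lemma integral_poisson_shift e x : 0 < e ->
  (\int[mu]_y (poisson_kernel e (x - y))%:E = (2 * pi)%:E)%E.
Proof.
move=> e0; rewrite -(integral_poisson e0).
have mP : measurable_fun setT (fun y : T => (poisson_kernel e y)%:E).
  by apply/measurable_EFinP; exact: measurable_poisson.
rewrite -[RHS](@integral_preserving _ _ _ mu (fun y : T =>
    y - x) _ (@lebesgue_measure_shift R (- x)) _ mP); last first.
  exact: measurable_funD.
by apply: eq_integral => y _; rewrite poissonC.
Qed.

(* Schur's test; the bound [a b <= a^2 + b^2] costs a factor [2], which is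
   immaterial here. *)
Lemma poisson_schur f e : 0 < e -> cmeasurable f ->
  (\int[mu]_x \int[mu]_y (poisson_kernel e (x - y) * (normc (f x) * normc (f y)))%:E <=
   (4 * pi)%:E * sqint mu f)%E.
Proof.
move=> e0 mf; pose s := fun x => (normc (f x)) ^+ 2.
have ms : measurable_fun setT s by apply: measurable_funX; exact: cmeasurable_normc.
have s0 x : 0 <= s x by exact: sqr_ge0.
have mP : measurable_fun setT (fun z : T * T => poisson_kernel e (z.1 - z.2)).
  by apply: (measurableT_comp (measurable_poisson e0)); apply: measurable_funB;
    [exact: measurable_fst|exact: measurable_snd].
have m1 : measurable_fun setT (fun z : T * T =>
    (poisson_kernel e (z.1 - z.2) * s z.1)%:E).
  apply/measurable_EFinP; apply: measurable_funM => //.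
  by apply: (measurableT_comp ms); exact: measurable_fst.
have m2 : measurable_fun setT (fun z : T * T =>
    (poisson_kernel e (z.1 - z.2) * s z.2)%:E).
  apply/measurable_EFinP; apply: measurable_funM => //.
  by apply: (measurableT_comp ms); exact: measurable_snd.
have p1 (z : T * T) : (0 <= (poisson_kernel e (z.1 - z.2) * s z.1)%:E)%E.
  by rewrite lee_fin mulr_ge0// poisson_ge0.
have p2 (z : T * T) : (0 <= (poisson_kernel e (z.1 - z.2) * s z.2)%:E)%E.
  by rewrite lee_fin mulr_ge0// poisson_ge0.
(* Integrating the kernel in one variable gives 2 pi: directly for [I1], and for [I2] after Tonelli
   and by symmetry of the kernel. The two together make the constant 4 pi. *)
have I1 : (\int[mu]_x \int[mu]_y (poisson_kernel e (x - y) * s x)%:E = (2 * pi)%:E *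
    sqint mu f)%E.
  rewrite -ge0_integralZl//; last 3 first.
  - exact/measurable_EFinP.
  - by move=> x _; rewrite lee_fin s0.
  - by rewrite lee_fin mulr_ge0// pi_ge0.
  apply: eq_integral => x _; rewrite -(integral_poisson_shift x e0) muleC.
  under eq_integral do rewrite mulrC EFinM.
  rewrite ge0_integralZl// ?lee_fin ?s0//.
  - apply/measurable_EFinP; apply: (measurableT_comp (measurable_poisson e0)).
    exact: measurable_funB.
  - by move=> y _; rewrite lee_fin poisson_ge0.
have I2 : (\int[mu]_x \int[mu]_y (poisson_kernel e (x - y) * s y)%:E = (2 * pi)%:E *
    sqint mu f)%E.
  rewrite (@fubini_tonelli _ _ T T R mu mu _ m2 p2)/= -I1.
  apply: eq_integral => x _; apply: eq_integral => y _.
  by rewrite poissonC.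
apply: (@le_trans _ _ (\int[mu]_x (\int[mu]_y (poisson_kernel e (x - y) * s x)%:E +
   \int[mu]_y (poisson_kernel e (x - y) * s y)%:E))%E).
  have mnf := cmeasurable_normc mf.
  have m3 : measurable_fun setT (fun z : T * T =>
      (poisson_kernel e (z.1 - z.2) * (normc (f z.1) * normc (f z.2)))%:E).
    apply/measurable_EFinP; apply: measurable_funM => //; apply: measurable_funM.
      by apply: (measurableT_comp mnf); exact: measurable_fst.
    by apply: (measurableT_comp mnf); exact: measurable_snd.
  have p3 x y : (0 <= (poisson_kernel e (x - y) * (normc (f x) * normc (f y)))%:E)%E.
    by rewrite lee_fin mulr_ge0 ?poisson_ge0// mulr_ge0 ?normc_ge0.
  apply: ge0_le_integral => //.
  - by move=> x _; apply: integral_ge0 => y _; exact: p3.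
  - exact: (measurable_fun_fubini_tonelli_F _ m3).
  - apply: emeasurable_funD.
      exact: (measurable_fun_fubini_tonelli_F _ m1).
    exact: (measurable_fun_fubini_tonelli_F _ m2).
  move=> x _.
  have q1 := measurableT_comp m1 (@pair1_measurable _ _ T T x).
  have q2 := measurableT_comp m2 (@pair1_measurable _ _ T T x).
  have q3 := measurableT_comp m3 (@pair1_measurable _ _ T T x).
  rewrite -ge0_integralD//=.
  - apply: ge0_le_integral => //=.
      exact: emeasurable_funD.
    move=> y _; rewrite -EFinD lee_fin -mulrDr ler_wpM2l ?poisson_ge0//.
    rewrite /s; have := sqr_ge0 (normc (f x) - normc (f y)).
    have := mulr_ge0 (normc_ge0 (f x)) (normc_ge0 (f y)); nra.
  - by move=> y _; exact: (p1 (x, y)).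
  - by move=> y _; exact: (p2 (x, y)).
rewrite ge0_integralD//=; last 4 first.
- by move=> x _; apply: integral_ge0 => y _; exact: (p1 (x, y)).
- exact: (measurable_fun_fubini_tonelli_F _ m1).
- by move=> x _; apply: integral_ge0 => y _; exact: (p2 (x, y)).
- exact: (measurable_fun_fubini_tonelli_F _ m2).
rewrite I1 I2 -ge0_muleDl ?lee_fin ?mulr_ge0 ?pi_ge0//.
by rewrite -EFinD (_ : 2 * pi + 2 * pi = 4 * pi)//; ring.
Qed.

Lemma cmeasurable_poisson_kernel e : 0 < e ->
  cmeasurable (fun z : T * T => (poisson_kernel e (z.1 - z.2))%:C).
Proof.
move=> e0; split => /=; last exact: measurable_cst.
apply: (measurableT_comp (measurable_poisson e0)); apply: measurable_funB;
  [exact: measurable_fst|exact: measurable_snd].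
Qed.

Lemma poisson_conv_integrable g e x : 0 < e -> cintegrable mu g ->
  cintegrable mu (fun y => (poisson_kernel e (x - y))%:C * g y).
Proof.
move=> e0; apply: (bounded_kernel_integrable (M := 2 / e)).
  exact: (cmeasurable_comp (cmeasurable_poisson_kernel e0) (@pair1_measurable _ _ T T x)).
by move=> y; rewrite normc_real ger0_norm ?poisson_ge0// poisson_le.
Qed.

(** The Poisson kernel is at most 2 / e, so its convolution with an integrable function is
    bounded. *)
Lemma mul_poisson_conv_integrable f g e : 0 < e -> cintegrable mu f -> cintegrable mu g ->
  cintegrable mu (fun x => f x * cint mu (fun y => (poisson_kernel e (x - y))%:C * g y)).
Proof.
move=> e0 fi gi; under eq_fun do rewrite mulrC.
apply: (bounded_kernel_integrable (M := 2 / e * \int[mu]_y normc (g y))) fi.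
  apply: (@cmeasurable_cint_section _ _ T T R mu (fun z =>
      (poisson_kernel e (z.1 - z.2))%:C * g z.2)).
  apply: cmeasurableM; first exact: cmeasurable_poisson_kernel.
  by case: gi => mg _; exact: (cmeasurable_comp mg (@measurable_snd _ _ T T)).
move=> x; apply: (le_trans (normc_cint_le (poisson_conv_integrable x e0 gi))).
have ig := cintegrable_normc gi.
rewrite -RintegralZl//; apply: le_Rintegral => //.
- exact: (cintegrable_normc (poisson_conv_integrable x e0 gi)).
- exact: (integrableZl _ _ ig).
move=> y _; rewrite normcM ler_wpM2r ?normc_ge0//.
by rewrite normc_real ger0_norm ?poisson_ge0// poisson_le.
Qed.

Lemma fhat_abel_bound f e : 0 < e -> cintegrable mu f ->
  (\int[mu]_xi ((normc (fhat f xi)) ^+ 2 * abel_kernel e xi)%:E <= (4 * pi)%:E * sqint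
      mu f)%E.
Proof.
move=> e0 fi; have [mf _] := fi.
pose g x := (f x)^*%C.
have gi : cintegrable mu g.
  by apply: cintegrable_le (cintegrable_normc fi); [exact: cmeasurableJ|move=> x;
      rewrite normcJ].
have mh := cmeasurable_fhat mf.
pose G xi := (normc (fhat f xi)) ^+ 2 * abel_kernel e xi.
pose N := \int[mu]_x normc (f x).
have hN xi : normc (fhat f xi) <= N by exact: normc_fhat_le.
have iG : mu.-integrable setT (EFin \o G).
  have ih := integrableZl measurableT (N ^+ 2) (cintegrable_normc (cintegrable_abel e0)).
  apply: le_integrable ih => //.
  - apply/measurable_EFinP; apply: measurable_funM; first by apply: measurable_funX;
      exact: cmeasurable_normc.
    by apply: continuous_measurable_fun; exact: continuous_abel.
  - move=> xi _; have h0 := normc_ge0 (fhat f xi).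
    have h2 : (normc (fhat f xi)) ^+ 2 <= N ^+ 2.
      by rewrite ler_sqr ?nnegrE// (le_trans h0 (hN xi)).
    have a0 : 0 <= abel_kernel e xi by exact: expR_ge0.
    rewrite -EFinM !abse_EFin lee_fin normc_real /G (ger0_norm a0).
    by rewrite !(ger0_norm (mulr_ge0 (sqr_ge0 _) a0)) ler_wpM2r.
(* As [g] is the conjugate of [f], [fhat g (- xi)] is the conjugate of [fhat f xi], and the product
   is the squared modulus. *)
have GE : cint mu (fun xi =>
    fhat f xi * fhat g (- xi) * (abel_kernel e xi)%:C) = (Rintegral mu setT G)%:C.
  rewrite (_ : (fun xi => _) = fun xi => (G xi)%:C); last first.
    by apply/funext => xi; rewrite fhat_conj// opprK mulcJ -rmorphM.
  by rewrite /cint/=; congr (_ +i* _); rewrite /Rintegral integral0.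
have -> : (\int[mu]_xi (G xi)%:E = (Rintegral mu setT G)%:E)%E.
  by rewrite /Rintegral fineK//; exact: (integrable_fin_num measurableT iG).
have G0 : 0 <= Rintegral mu setT G.
  by apply: Rintegral_ge0 => xi _; rewrite mulr_ge0 ?sqr_ge0// expR_ge0.
have mi := mul_poisson_conv_integrable e0 fi gi.
apply: le_trans (poisson_schur e0 mf).
rewrite -(ger0_norm G0) -normc_real -GE cint_fhat_abel//.
apply: (@le_trans _ _ (\int[mu]_x (normc (f x * cint mu (fun y =>
    (poisson_kernel e (x - y))%:C * g y)))%:E)%E).
  rewrite -[leRHS]fineK; last exact: (integrable_fin_num measurableT (cintegrable_normc
      mi)).
  by rewrite lee_fin; exact: normc_cint_le.
have m3 : measurable_fun setT (fun z : T * T =>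
    (poisson_kernel e (z.1 - z.2) * (normc (f z.1) * normc (f z.2)))%:E).
  have mnf := cmeasurable_normc mf.
  apply/measurable_EFinP; apply: measurable_funM.
    by have [] := cmeasurable_poisson_kernel e0.
  apply: measurable_funM.
    by apply: (measurableT_comp mnf); exact: measurable_fst.
  by apply: (measurableT_comp mnf); exact: measurable_snd.
apply: ge0_le_integral => //.
- by move=> x _; rewrite lee_fin normc_ge0.
- by apply/measurable_EFinP/cmeasurable_normc; case: mi.
- apply: (measurable_fun_fubini_tonelli_F _ m3) => z.
  by rewrite lee_fin mulr_ge0 ?poisson_ge0// mulr_ge0 ?normc_ge0.
move=> x _; have px := poisson_conv_integrable x e0 gi.
rewrite normcM EFinM.
apply: (@le_trans _ _ ((normc (f x))%:E * \int[mu]_y (normc ((poisson_kernel e (x -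
    y))%:C * g y))%:E)%E).
  apply: lee_wpmul2l; first by rewrite lee_fin normc_ge0.
  rewrite -[leRHS]fineK; last exact: (integrable_fin_num measurableT (cintegrable_normc
      px)).
  by rewrite lee_fin; exact: normc_cint_le.
rewrite -ge0_integralZl//; last 3 first.
- by apply/measurable_EFinP/cmeasurable_normc; case: px.
- by move=> y _; rewrite lee_fin normc_ge0.
- by rewrite lee_fin normc_ge0.
rewrite le_eqVlt; apply/orP; left; apply/eqP; apply: eq_integral => y _.
rewrite -EFinM normcM normc_real normcJ ger0_norm ?poisson_ge0//; congr EFin; ring.
Qed.

Lemma cvg_abel xi : abel_kernel n.+1%:R^-1 xi @[n --> \oo] --> (1 : R).
Proof.
rewrite -[X in _ --> X]expR0.
have h0 : - (n.+1%:R^-1 * `|xi|) @[n --> \oo] --> (0 : R).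
  rewrite [X in _ --> X](_ : 0 = - (0 * `|xi|)); last by rewrite mul0r oppr0.
  by apply: cvgN; apply: cvgM; [exact: cvg_harmonic|exact: cvg_cst].
exact: (cvg_comp _ _ h0 (@continuous_expR R 0)).
Qed.

(** For e = 1 / (n + 1) the Abel kernels increase to 1, and the bound of [fhat_abel_bound] does not
    depend on e: monotone convergence removes the damping. *)
Lemma sqint_fhat_le f : cintegrable mu f ->
  (sqint mu (fhat f) <= (4 * pi)%:E * sqint mu f)%E.
Proof.
move=> fi; have [mf _] := fi; have mh := cmeasurable_fhat mf.
pose g (n : nat) (xi : T) : \bar R :=
    ((normc (fhat f xi)) ^+ 2 * abel_kernel n.+1%:R^-1 xi)%:E.
have mg n : measurable_fun setT (g n).
  apply/measurable_EFinP; apply: measurable_funM; first by apply: measurable_funX;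
      exact: cmeasurable_normc.
  by apply: continuous_measurable_fun; exact: continuous_abel.
have g0 n xi : setT xi -> (0 <= g n xi)%E by rewrite lee_fin mulr_ge0 ?sqr_ge0 ?expR_ge0.
have ndg xi : setT xi -> {homo g^~ xi : m n / (m <= n)%N >-> (m <= n)%E}.
  move=> _ m n mn; rewrite lee_fin ler_wpM2l ?sqr_ge0// /abel_kernel ler_expR lerN2.
  by rewrite ler_wpM2r// lef_pV2 ?posrE// ler_nat.
have lim_g xi : limn (g^~ xi) = ((normc (fhat f xi)) ^+ 2)%:E.
  apply/cvg_lim => //; apply: cvg_EFin; first exact: nearW.
  rewrite -[X in _ --> X]mulr1; apply: cvgM; first exact: cvg_cst.
  exact: cvg_abel.
rewrite [leLHS](_ : _ = \int[mu]_xi limn (g^~ xi))%E; last first.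
  by apply: eq_integral => xi _; rewrite lim_g.
have -> := monotone_convergence mu measurableT mg g0 ndg.
apply: lime_le.
  apply: ereal_nondecreasing_is_cvgn => m n mn.
  exact: (ge0_le_integral mu measurableT (g0 m) (mg m) (mg n) (fun x xT =>
      ndg x xT m n mn)).
by apply: nearW => n; apply: fhat_abel_bound.
Qed.

End fhat_L2_bound.

(** * Testing against indicators of intervals *)

Section interval_test.
Context (R : realType).
Local Notation mu := (@lebesgue_measure R).
Local Notation T := (measurableTypeR R).
Implicit Types (f g h : T -> R[i]) (x y xi a b e : R).

Definition chi a b (x : T) : R[i] := (\1_(`[a, b]%classic : set R) x)%:C.

Lemma chiE a b x : chi a b x = if (a <= x) && (x <= b) then 1 else 0.
Proof.
rewrite /chi indicE; have -> : (x \in (`[a, b]%classic : set R)) = (a <= x <= b).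
  by apply/idP/idP => [/set_mem|xab]; rewrite ?inE/= ?in_itv.
by case: ifP.
Qed.

Lemma cmeasurable_chi a b : cmeasurable (chi a b).
Proof.
split; last exact: measurable_cst.
by apply: measurable_indic; exact: measurable_itv.
Qed.

Lemma normc_chi_le1 a b x : normc (chi a b x) <= 1.
Proof. by rewrite chiE; case: ifP => _ /=;
    rewrite ?expr1n ?expr0n/= ?addr0 ?sqrtr1 ?sqrtr0. Qed.

Lemma cintegrable_chi a b : cintegrable mu (chi a b).
Proof.
apply: (@cintegrable_le _ _ _ _ _ (fun x : T => \1_(`[a, b]%classic : set R) x : R)).
- exact: cmeasurable_chi.
- by move=> x; rewrite /chi /= expr0n addr0 sqrtr_sqr ger0_norm.
- exact: integrable_indic_itv.
Qed.

Lemma in_CL2_bounded f (M : R) : cintegrable mu f -> (forall x, normc (f x) <= M) ->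
  in_CLp mu 2%:E f.
Proof.
move=> fi fM; have [mf fo] := fi; apply/in_CL2P; split=> //.
have M0 : 0 <= M by exact: le_trans (normc_ge0 _) (fM 0).
apply: (@le_lt_trans _ _ (\int[mu]_x (M%:E * (normc (f x))%:E))%E).
  apply: ge0_le_integral => //.
  - by move=> x _; rewrite lee_fin sqr_ge0.
  - exact: measurable_sqnormc.
  - by apply: measurable_funeM; exact/measurable_EFinP/cmeasurable_normc.
  - by move=> x _; rewrite -EFinM lee_fin expr2 ler_wpM2r ?normc_ge0.
rewrite ge0_integralZl//.
- by rewrite lte_mul_pinfty.
- exact/measurable_EFinP/cmeasurable_normc.
- by move=> x _; rewrite lee_fin normc_ge0.
Qed.

Lemma in_CL2_chi a b : in_CLp mu 2%:E (chi a b).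
Proof. exact: in_CL2_bounded (cintegrable_chi a b) (@normc_chi_le1 a b). Qed.

Lemma chi_degenerate a b : b <= a -> {ae mu, forall x, chi a b x = 0}.
Proof.
move=> ba; exists [set a]; split; [exact: measurable_set1|exact: lebesgue_measure_set1|].
move=> x /=; apply: contra_notP => /eqP xa; rewrite chiE; case: ifP => // /andP[ax xb].
by move: xa; rewrite eq_le ax (le_trans xb ba).
Qed.

(** The primitive taken from -oo is identically 0, while its derivative is [w] a.e. *)
Lemma integral_ray_eq0 (w : T -> R) : mu.-integrable setT (EFin \o w) ->
  (forall x, \int[mu]_(t in `]-oo, x]) w t = 0) -> {ae mu, forall x, w x = 0}.
Proof.
move=> iw w0.
have iwy y : mu.-integrable `]-oo, y] (EFin \o w).
  by apply: integrableS iw => //; exact: measurable_itv.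
have := FTC1Ny iwy (open_integrable_locally (@openT R) iw).
apply: filterS; first exact: (ae_filter_ringOfSetsType mu).
move=> x [_]; rewrite (_ : (fun x => _) = cst 0); last by apply/funext.
by rewrite derive1E derive_cst.
Qed.

(* [h] integrates to [0] over all rays after truncation, hence vanishes a.e. by
   Lebesgue differentiation. *)
Lemma cint_chi_eq0 h : in_CLp mu 2%:E h ->
  (forall a b, a < b -> cint mu (fun x => h x * chi a b x) = 0) ->
  {ae mu, forall x, h x = 0}.
Proof.
move=> hL h0; have [mh _] := hL; have aeF := ae_filter_ringOfSetsType mu.
have ih a b : cintegrable mu (fun x => h x * chi a b x).
  exact: in_CL2M hL (in_CL2_chi a b).
(* Extended to [b <= a], because the part of [-n, n] in the ray up to [x] is degenerate for
   [x <= - n]. *)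
have {}h0 a b : cint mu (fun x => h x * chi a b x) = 0.
  have [/h0//|ba] := ltP a b.
  rewrite (@ae_eq_cint _ _ _ mu _ (fun=> 0)).
  - by rewrite /cint /Rintegral integral0.
  - by case: (ih a b).
  - exact: cmeasurable_cst.
  - by apply: filterS (chi_degenerate ba) => x ->; rewrite mulr0.
have key n : {ae mu, forall x, h x * chi (- n%:R) n%:R x = 0}.
  pose hn x := h x * chi (- n%:R) n%:R x.
  have hnE x t : hn t * (\1_(`]-oo, x]%classic : set R) t)%:C =
      h t * chi (- n%:R) (Num.min x n%:R) t.
    rewrite /hn -mulrA; congr (_ * _); rewrite !chiE indicE.
    have -> : (t \in (`]-oo, x]%classic : set R)) = (t <= x).
      by apply/idP/idP => [/set_mem|xab]; rewrite ?inE/= ?in_itv.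
    by rewrite le_min; case: (- n%:R <= t); case: (t <= x); case: (t <= n%:R);
      rewrite /= ?mulr1 ?mulr0 ?mul0r.
  have re0 : {ae mu, forall x, complex.Re (hn x) = 0}.
    apply: integral_ray_eq0; first exact: (cintegrable_Re (ih _ _)).
    move=> x; rewrite Rintegral_mkcond.
    have /(congr1 (fun z : R[i] => complex.Re z)) /= := h0 (- n%:R) (Num.min x n%:R).
    apply: etrans; congr (Rintegral _ _ _); apply/funext => t; rewrite -hnE patchE indicE.
    by case: (hn t) => u v; case: ifP => _ /=; rewrite ?mulr0 ?mulr1 ?subr0.
  have im0 : {ae mu, forall x, complex.Im (hn x) = 0}.
    apply: integral_ray_eq0; first exact: (cintegrable_Im (ih _ _)).
    move=> x; rewrite Rintegral_mkcond.
    have /(congr1 (fun z : R[i] => complex.Im z)) /= := h0 (- n%:R) (Num.min x n%:R).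
    apply: etrans; congr (Rintegral _ _ _); apply/funext => t; rewrite -hnE patchE indicE.
    by case: (hn t) => u v; case: ifP => _ /=; rewrite ?mulr0 ?mulr1 ?add0r.
  by apply: filterS2 re0 im0 => x; rewrite -/(hn x); case: (hn x) => u v /= -> ->.
apply: filterS (ae_foralln key) => x hx.
have [n xn] : exists n : nat, `|x| <= n%:R.
  by exists (Num.bound `|x|); rewrite ltW// archi_boundP.
by move: (hx n); rewrite chiE -ler_norml xn mulr1.
Qed.

(** Both sides are limits of the same sequence [u], given by the Abel-Poisson identity at e = 1 / (n
    + 1). On the frequency side the limit is dominated because both transforms lie in L^2, so that
    their product is integrable; on the other side because the Poisson integrals of the indicator
    are bounded by 2 pi. *)
Lemma cint_fhat_chi f a b : a < b -> cintegrable mu f -> in_CLp mu 2%:E f ->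
  cint mu (fun xi => fhat f xi * fhat (chi a b) (- xi)) =
  (2 * pi)%:C * cint mu (fun x => f x * chi a b x).
Proof.
move=> ab fi fL; have [mf _] := fi.
have hatL g : cintegrable mu g -> in_CLp mu 2%:E g -> in_CLp mu 2%:E (fhat g).
  move=> gi /in_CL2P[mg go]; apply/in_CL2P; split; first exact: cmeasurable_fhat.
  apply: (le_lt_trans (sqint_fhat_le gi)).
  by rewrite lte_mul_pinfty// lee_fin mulr_ge0// pi_ge0.
have ci := cintegrable_chi a b; have [mc _] := ci.
have FL := hatL f fi fL.
pose G xi := fhat f xi * fhat (chi a b) (- xi).
have Gi : cintegrable mu G.
  rewrite /G; under eq_fun do rewrite -fhat_opp//.
  apply: in_CL2M => //; apply: hatL; first exact: cintegrable_opp.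
  apply: (@in_CL2_bounded _ 1); first exact: cintegrable_opp.
  by move=> x; exact: normc_chi_le1.
pose u (n : nat) := cint mu (fun xi => G xi * (abel_kernel n.+1%:R^-1 xi)%:C).
have e0 (n : nat) : 0 < n.+1%:R^-1 :> R by rewrite invr_gt0.
have ab1 (n : nat) xi : 0 <= abel_kernel n.+1%:R^-1 xi <= 1.
  by rewrite expR_ge0/= -expR0 ler_expR oppr_le0 mulr_ge0// ltW.
have Gni n : cintegrable mu (fun xi => G xi * (abel_kernel n.+1%:R^-1 xi)%:C).
  under eq_fun do rewrite mulrC.
  apply: (bounded_kernel_integrable (M := 1)) Gi.
    by case: (cintegrable_abel (e0 n)).
  move=> xi; rewrite normc_real; have /andP[h0 h1] := ab1 n xi.
  by rewrite ger0_norm.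
have nr1 (r : R) : normc (r%:C - 1) = `|r - 1|.
  by rewrite -normc_real rmorphB.
have uG : normc (u n - cint mu G) @[n --> \oo] --> 0.
  apply: (cint_dominated Gni Gi (cintegrable_normc Gi)).
    apply: aeW => xi; rewrite (_ : 0 = normc (G xi) * (1 - 1));
        last by rewrite subrr mulr0.
    rewrite (_ : (fun n => _) = (fun n : nat =>
        normc (G xi) * (1 - abel_kernel n.+1%:R^-1 xi))).
      by apply: cvgM; [exact: cvg_cst|apply: cvgB; [exact: cvg_cst|exact: cvg_abel]].
    apply/funext => n; have /andP[h0 h1] := ab1 n xi.
    rewrite -[X in _ - X]mulr1 -mulrBr normcM; congr (_ * _).
    by rewrite nr1 distrC ger0_norm// subr_ge0.
  apply: aeW => xi n; have /andP[h0 h1] := ab1 n xi.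
  rewrite -[X in _ - X]mulr1 -mulrBr normcM ler_piMr ?normc_ge0//.
  rewrite nr1 distrC ger0_norm ?subr_ge0//.
  by rewrite lerBlDr lerDl.
(* The Poisson integral of the indicator of [a, b], from [integral_poisson_itv] with division by e
   written as multiplication by n + 1. *)
pose q (n : nat) x : R := 2 * atan ((b - x) * n.+1%:R) - 2 * atan ((a - x) * n.+1%:R).
have uE n : u n = cint mu (fun x => f x * (q n x)%:C).
  rewrite /u /G cint_fhat_abel//; congr cint; apply/funext => x; congr (_ * _).
  have := integral_poisson_itv x (e0 n) ab; rewrite invrK => hq.
  rewrite /q -mulrBr /cint.
  rewrite (_ : (fun y => complex.Im _) = cst 0); last first.
    by apply/funext => y /=; rewrite mulr0 mul0r addr0.
  congr (_ +i* _); last by rewrite /Rintegral integral0.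
  transitivity (fine (\int[mu]_(y in `[a,
      b]) (poisson_kernel n.+1%:R^-1 (x - y))%:E)%E); last by rewrite hq.
  rewrite -/(Rintegral mu `[a, b] (fun y =>
      poisson_kernel n.+1%:R^-1 (x - y))) [RHS]Rintegral_mkcond.
  congr (Rintegral _ _ _); apply/funext => y; rewrite patchE /chi indicE.
  by case: ifP => _ /=; rewrite ?mulr1 ?mulr0 ?mul0r ?subr0.
pose g x := (2 * pi)%:C * (f x * chi a b x).
have fci : cintegrable mu (fun x =>
    f x * chi a b x) by exact: in_CL2M fL (in_CL2_chi a b).
have gi : cintegrable mu g by exact: cintegrableZ.
have atan_le (r : R) : `|2 * atan r| <= pi.
  have := atan_gtNpi2 r; have := atan_ltpi2 r.
  by rewrite normrM ger0_norm// -ler_pdivlMl// ler_norml [2^-1 * _]mulrC =>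
      /ltW -> /ltW ->.
have qle n x : `|q n x| <= 2 * pi.
  by rewrite (le_trans (ler_normB _ _))// (_ : 2 * pi = pi + pi) ?lerD//; ring.
have mq n : cmeasurable (fun x : T => (q n x)%:C).
  split; last exact: measurable_cst.
  have matan c : measurable_fun setT (fun x : T => 2 * atan ((c - x) * n.+1%:R)).
    apply: measurable_funM => //.
    apply: (measurableT_comp (continuous_measurable_fun (@continuous_atan R))).
    by apply: measurable_funM => //; exact: measurable_funB.
  by apply: measurable_funB; exact: matan.
pose c x : R := if (a <= x) && (x <= b) then 2 * pi else 0.
have gE x : g x = f x * (c x)%:C.
  rewrite /g mulrCA chiE /c; congr (_ * _).
  by case: ifP => _; rewrite ?mulr1 ?mulr0.
have cle x : `|c x| <= 2 * pi.
  have pi2 : 0 <= 2 * pi :> R by rewrite mulr_ge0 ?pi_ge0.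
  by rewrite /c; case: ifP => _; rewrite ?normr0// ger0_norm.
have diffE n x : normc (f x * (q n x)%:C - g x) = normc (f x) * `|q n x - c x|.
  by rewrite gE -mulrBr -rmorphB normcM normc_real.
have qi n : cintegrable mu (fun x => f x * (q n x)%:C).
  under eq_fun do rewrite mulrC.
  apply: (bounded_kernel_integrable (M := 2 * pi)) => //.
  by move=> x; rewrite normc_real.
have ug : normc (u n - cint mu g) @[n --> \oo] --> 0.
  rewrite [X in X @ _](_ : _ = fun n => normc (cint mu (fun x =>
      f x * (q n x)%:C) - cint mu g)); last first.
    by apply/funext => n; rewrite uE.
  apply: (cint_dominated qi gi (integrableZl measurableT (4 * pi) (cintegrable_normc
      fi))).
    (* At the endpoints the limit of [q] is pi, half of the value 2 pi of [c]; they form a null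
       set. *)
    exists [set a; b]; split.
    - by apply: measurableU; exact: measurable_set1.
    - apply: countable_lebesgue_measure0; exact: finite_set_countable.
    - move=> x /=; apply: contra_notP => /not_orP[/eqP xa /eqP xb].
      rewrite [X in X @ _](_ : _ = fun n => normc (f x) * `|q n x - c x|); last first.
        by apply/funext => n; exact: diffE.
      rewrite -(mulr0 (normc (f x))); apply: cvgM; first exact: cvg_cst.
      apply/norm_cvg0P; rewrite -(subrr (c x)); apply: cvgB; last exact: cvg_cst.
      rewrite (_ : c x = pi * Num.sg (b - x) - pi * Num.sg (a - x)).
        by apply: cvgB; exact: cvg_atan_dilation.
      rewrite /c; case: (ltgtP x a) xa => // [xa|ax] _.
        by rewrite !gtr0_sg ?subr_gt0// ?subrr// (lt_trans xa).
      case: (ltgtP x b) xb => // [xb|bx] _ /=.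
        rewrite gtr0_sg ?subr_gt0// ltr0_sg ?subr_lt0//; ring.
      by rewrite !ltr0_sg ?subr_lt0// subrr.
  apply: aeW => x n; rewrite diffE [leRHS]mulrC ler_wpM2l ?normc_ge0//.
  rewrite (le_trans (ler_normB _ _))// (le_trans (lerD (qle n x) (cle x)))//; lra.
rewrite -cintZ//; apply/eqP; rewrite -subr_eq0; apply/eqP/eq0_normc.
apply/eqP; rewrite eq_le normc_ge0 andbT.
(* The distance between the two limits is at most this sum for every [n]. *)
have uv : normc (u n - cint mu G) + normc (u n - cint mu g) @[n --> \oo] --> 0.
  by rewrite -[X in _ --> X]addr0; apply: cvgD.
rewrite -/G -/g.
apply: (cvgr_to_ge uv); apply: nearW => n.
rewrite (_ : cint mu G - cint mu g = (u n - cint mu g) - (u n - cint mu G)); last by ring.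
rewrite addrC (le_trans (le_normcD _ _))// lerD2r.
by rewrite normcN.
Qed.

End interval_test.

(** * Completeness of L^2 *)

Section CLspace_norm.
Context d (T : measurableType d) (R : realType).
Variables (mu : {measure set T -> \bar R}) (p : \bar R) (p1 : (1 <= p)%E).
Local Notation L := (CLspace mu p1).
Implicit Types (F G : L) (u : nat -> L).

(** The norm of the normed space is an element of R[i]; estimates and limits are carried out with
    this real counterpart. *)
Definition rnorm F : R := fine (cLnorm mu p F).

Lemma CLspace_normE F : `|F| = (rnorm F)%:C.
Proof. by []. Qed.

Lemma rnorm_ge0 F : 0 <= rnorm F.
Proof. by rewrite fine_ge0// cLnorm_ge0. Qed.

Lemma rnormD F G : rnorm (F + G) <= rnorm F + rnorm G.
Proof. by rewrite -lecR rmorphD -!CLspace_normE; exact: ler_normD. Qed.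

Lemma rnormN F : rnorm (- F) = rnorm F.
Proof. by have := normrN F; rewrite !CLspace_normE => -[]. Qed.

Lemma rnormB F G : rnorm (F - G) <= rnorm F + rnorm G.
Proof. by rewrite (le_trans (rnormD _ _))// rnormN. Qed.

Lemma rnorm_eq0 F : rnorm F = 0 -> F = 0.
Proof. by move=> F0; apply/eqP; rewrite -normr_eq0 CLspace_normE F0. Qed.

Lemma rnormZ (c : R[i]) F : rnorm (c *: F) = normc c * rnorm F.
Proof.
have := normrZ c F; rewrite !CLspace_normE.
rewrite (_ : `|c| = (normc c)%:C); last by case: c.
by rewrite -rmorphM => -[].
Qed.

Lemma CLspace_addE F G : {ae mu, forall x, (F + G : L) x = F x + G x}.
Proof. exact: CLaddE. Qed.

Lemma CLspace_scaleE (c : R[i]) F : {ae mu, forall x, (c *: F : L) x = c * F x}.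
Proof. exact: CLscaleE. Qed.

Lemma CLoppE F : {ae mu, forall x, (- F : L) x = - F x}.
Proof.
have aeF := ae_filter_ringOfSetsType mu.
by apply: filterS (CLspace_scaleE (-1) F) => x; rewrite scaleN1r mulN1r.
Qed.

Lemma CLsubE F G : {ae mu, forall x, (F - G : L) x = F x - G x}.
Proof.
have aeF := ae_filter_ringOfSetsType mu.
by apply: filterS2 (CLspace_addE F (- G)) (CLoppE G) => x -> ->.
Qed.

Lemma cvg_CLspaceP u F : u @ \oo --> F <-> rnorm (F - u n) @[n --> \oo] --> 0.
Proof.
split=> [/cvgrPdist_lt uF|uF].
  apply/cvgrPdist_lt => e e0; have eC : 0 < e%:C :> R[i] by rewrite ltcR.
  apply: filterS (uF _ eC) => n.
  by rewrite CLspace_normE ltcR sub0r normrN ger0_norm ?rnorm_ge0.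
(* A positive element of R[i] has imaginary part 0, so a complex radius is a real one. *)
apply/cvgrPdist_lt => -[e e'] /=; rewrite ltcE/= => /andP[/eqP -> e0].
move/cvgrPdist_lt : uF => /(_ _ e0); apply: filterS => n.
by rewrite sub0r normrN ger0_norm ?rnorm_ge0// -ltcR CLspace_normE.
Qed.

Lemma rnorm_le_ae F G : {ae mu, forall x, normc (F x) <= normc (G x)} ->
  rnorm F <= rnorm G.
Proof.
move=> FG; apply: fine_le; [exact: CLnorm_fin|exact: CLnorm_fin|].
have [mF _] := CLspaceP F; have [mG _] := CLspaceP G.
have aeF := ae_filter_ringOfSetsType mu.
apply: le_cLnorm => //; try exact: cmeasurable_normc.
by apply: filterS FG => x ->; rewrite normc_ge0.
Qed.

End CLspace_norm.

Section L2_sqint.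
Context d (T : measurableType d) (R : realType).
Variable mu : {measure set T -> \bar R}.
Local Notation L := (CLspace mu (lee1n 2)).
Implicit Types (F G : L) (u : nat -> L).

Lemma rnorm_sqint F : ((rnorm F) ^+ 2)%:E = sqint mu F.
Proof. exact: in_CL2_fine (CLspaceP F). Qed.

Lemma ae_eq_sqint (f g : T -> R[i]) : cmeasurable f -> cmeasurable g ->
  {ae mu, forall x, f x = g x} -> sqint mu f = sqint mu g.
Proof.
move=> mf mg fg; have aeF := ae_filter_ringOfSetsType mu.
apply: ae_eq_integral => //; try exact: measurable_sqnormc.
by apply: filterS fg => x + _ => ->.
Qed.

Lemma rnorm_class (f : T -> R[i]) : in_CLp mu 2%:E f ->
  ((rnorm (CLclass mu (lee1n 2) f)) ^+ 2)%:E = sqint mu f.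
Proof.
move=> fL; rewrite rnorm_sqint; apply: ae_eq_sqint.
- by case: (CLspaceP (CLclass mu (lee1n 2) f)).
- by case: fL.
- exact: CLclassE.
Qed.

Lemma sqint_sub F G : sqint mu (fun x => F x - G x) = ((rnorm (F - G)) ^+ 2)%:E.
Proof.
rewrite rnorm_sqint; apply: ae_eq_sqint.
- by rewrite -[fun x => _]/(fun x => F x + - G x); apply: cmeasurableD;
    [case: (CLspaceP F)|under eq_fun do rewrite -mulN1r; apply: cmeasurableM;
     [exact: cmeasurable_cst|case: (CLspaceP G)]].
- by case: (CLspaceP (F - G)).
- have aeF := ae_filter_ringOfSetsType mu.
  by apply: filterS (CLsubE F G) => x ->.
Qed.

End L2_sqint.

Section L2_completeness.
Context d (T : measurableType d) (R : realType).
Variable mu : {measure set T -> \bar R}.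
Local Notation L := (CLspace mu (lee1n 2)).
Implicit Types (F G : L) (u : nat -> L).

Lemma sqr_normc (z : R[i]) : (normc z) ^+ 2 = complex.Re z ^+ 2 + complex.Im z ^+ 2.
Proof. by case: z => a b /=; rewrite sqr_sqrtr// addr_ge0 ?sqr_ge0. Qed.

Lemma sum_half_le n : \sum_(0 <= k < n) (2^-1 ^+ k : R) <= 2.
Proof.
suff -> : \sum_(0 <= k < n) (2^-1 ^+ k : R) = 2 - 2 * 2^-1 ^+ n.
  by rewrite gerBl mulr_ge0// exprn_ge0// invr_ge0.
elim: n => [|n IHn]; first by rewrite big_geq// expr0 mulr1 subrr.
by rewrite big_nat_recr//= IHn exprS; field.
Qed.

Lemma cmeasurableB (f g : T -> R[i]) : cmeasurable f -> cmeasurable g ->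
  cmeasurable (fun x => f x - g x).
Proof.
move=> mf mg; apply: cmeasurableD => //; under eq_fun do rewrite -mulN1r.
by apply: cmeasurableM => //; exact: cmeasurable_cst.
Qed.

(** Up to the constant [a 0], the sequence is the series of its increments, which converges
    absolutely by comparison with [D]. *)
Lemma cvg_sum_abs (a : nat -> R) (D : nat -> R) (C : R) :
  (forall k, `|a k.+1 - a k| <= D k) ->
  (forall n, \sum_(0 <= k < n) D k <= C) -> cvgn a.
Proof.
move=> aD DC.
have D0 k : 0 <= D k by exact: le_trans (normr_ge0 _) (aD k).
have cD : cvgn (series D).
  apply: nondecreasing_is_cvgn.
    by apply/nondecreasing_seqP => n; rewrite /series/= big_nat_recr//= lerDl.
  by exists C => _ [n _ <-]; exact: DC.
have : cvgn (series (telescope a)).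
  apply: normed_cvg; apply: series_le_cvg cD => n; first exact: normr_ge0.
    exact: D0.
  exact: aD.
rewrite telescopeK => h.
have -> : a = (fun n => (a n - a 0%N) + a 0%N) by apply/funext => n; rewrite subrK.
by apply: is_cvgD => //; exact: is_cvg_cst.
Qed.

(* With [D k = |v k.+1 - v k|], [D k <= 2^-k + 2^k (D k)^2] and the integrals of
   [2^k (D k)^2] are summable, so that [D k] is summable a.e. *)
Lemma fast_L2_cvg (v : nat -> L) :
  (forall k, rnorm (v k.+1 - v k) <= 2^-1 ^+ k) ->
  {ae mu, forall x, cvgn (fun k => complex.Re (v k x)) /\ cvgn (fun k =>
      complex.Im (v k x))}.
Proof.
move=> vk; pose D (k : nat) (x : T) : R := normc (v k.+1 x - v k x).
have mv k : cmeasurable (v k) by case: (CLspaceP (v k)).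
pose t (k : nat) (x : T) : \bar R := (2 ^+ k * (D k x) ^+ 2)%:E.
have t0 k x : (0 <= t k x)%E by rewrite lee_fin mulr_ge0 ?sqr_ge0 ?exprn_ge0.
have mD k : cmeasurable (fun x => v k.+1 x - v k x) by exact: cmeasurableB.
have mt k : measurable_fun setT (t k).
  by rewrite /t; under eq_fun do rewrite EFinM; apply: measurable_funeM;
      exact: (measurable_sqnormc (mD k)).
have it k : (\int[mu]_x t k x <= (2^-1 ^+ k)%:E)%E.
  rewrite /t; under eq_integral do rewrite EFinM.
  rewrite ge0_integralZl//; last 2 first.
  - exact: (measurable_sqnormc (mD k)).
  - by move=> x _; rewrite lee_fin sqr_ge0.
  rewrite -/(sqint mu (fun x => v k.+1 x - v k x)) sqint_sub -EFinM lee_fin.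
  apply: (@le_trans _ _ (2 ^+ k * (2^-1 ^+ k) ^+ 2)).
    have p0 : 0 <= 2^-1 ^+ k :> R by rewrite exprn_ge0// invr_ge0.
    by rewrite ler_wpM2l ?exprn_ge0// ler_sqr ?nnegrE ?rnorm_ge0.
  by rewrite expr2 mulrA -exprMn divff// expr1n mul1r.
have iS : mu.-integrable setT (fun x => \sum_(k <oo) t k x)%E.
  apply/integrableP; split; first exact: ge0_emeasurable_sum.
  rewrite (eq_integral (fun x => \sum_(k <oo) t k x)%E); last first.
    by move=> x _; rewrite gee0_abs// nneseries_ge0.
  rewrite integral_nneseries//; apply: (@le_lt_trans _ _ 2%:E); last exact: ltry.
  apply: lime_le; first by apply: is_cvg_nneseries => k _ _; exact: integral_ge0.
  apply: nearW => n; apply: (@le_trans _ _ (\sum_(0 <= k < n) (2^-1 ^+ k)%:E)%E).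
    exact: lee_sum.
  by rewrite sumEFin lee_fin sum_half_le.
have aeF := ae_filter_ringOfSetsType mu.
apply: filterS (integrable_ae measurableT iS) => x /(_ I) fS.
have Dle n : \sum_(0 <= k < n) D k x <= 2 + fine (\sum_(k <oo) t k x)%E.
  apply: (@le_trans _ _ (\sum_(0 <= k < n) (2^-1 ^+ k + 2 ^+ k * (D k x) ^+ 2))).
    apply: ler_sum => k _; set q := D k x.
    have q0 : 0 <= q by exact: normc_ge0.
    have p0 : 0 < 2^-1 ^+ k :> R by rewrite exprn_gt0// invr_gt0.
    have -> : 2 ^+ k = (2^-1 ^+ k)^-1 :> R by rewrite -exprVn invrK.
    move: p0; move: (2^-1 ^+ k : R) => r r0.
    rewrite -(ler_pM2l r0) mulrDr mulrA divff ?gt_eqF// mul1r.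
    have h1 := sqr_ge0 (r - q); have h2 := mulr_ge0 (ltW r0) q0.
    nra.
  rewrite big_split/= lerD ?sum_half_le//.
  rewrite -lee_fin fineK// -sumEFin;
      exact: (nneseries_lim_ge (P := xpredT) n (fun k _ _ => t0 k x)).
split; apply: (@cvg_sum_abs _ (D^~ x) _ _ Dle) => k.
  by rewrite -raddfB; exact: normr_Re_le.
by rewrite -raddfB; exact: normr_Im_le.
Qed.

(** The Riesz-Fischer argument: a subsequence with increments at most 2^-k converges a.e., and
    Fatou's lemma bounds the distance from its limit to the original sequence. *)
Lemma L2_complete u :
  (forall e : R, 0 < e -> exists N, forall m n, (N <= m)%N -> (N <= n)%N ->
     rnorm (u m - u n) <= e) ->
  exists F, u @ \oo --> F.
Proof.
move=> cu.
have h0 k : 0 < 2^-1 ^+ k :> R by rewrite exprn_gt0// invr_gt0.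
have [N hN] := choice (fun k => cu _ (h0 k)).
(* The sum dominates each of [N 0], ..., [N k], so [s k] is beyond all these thresholds at once. *)
pose s k := (\sum_(j < k.+1) N j)%N.
have Ns j k : (j <= k)%N -> (N j <= s k)%N.
  move=> jk; rewrite /s (bigD1 (Ordinal (n := k.+1) (m := j) jk))//=; exact: leq_addr.
pose v k := u (s k).
have vc : forall k, rnorm (v k.+1 - v k) <= 2^-1 ^+ k.
  by move=> k; apply: hN; apply: Ns => //.
(* The upper limit is measurable whether or not the sequence converges, and equals the limit where
   it exists; elsewhere, on a null set, [w] has irrelevant values. *)
pose w x : R[i] := fine (limn_esup (fun k => (complex.Re (v k x))%:E)) +i*
                   fine (limn_esup (fun k => (complex.Im (v k x))%:E)).
have mv k : cmeasurable (v k) by case: (CLspaceP (v k)).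
have mu_ k : cmeasurable (u k) by case: (CLspaceP (u k)).
have mw : cmeasurable w.
  have mlim (a : nat -> T -> R) : (forall k, measurable_fun setT (a k)) ->
      measurable_fun setT (fun x => fine (limn_esup (fun k => (a k x)%:E))).
    move=> ma; apply: (measurableT_comp (fine_measurable measurableT)).
    by apply: (measurable_fun_limn_esup (f := fun k x => (a k x)%:E)) => k;
        apply/measurable_EFinP.
  by split; apply: mlim => k; case: (mv k).
have limE (a : nat -> R) : cvgn a -> a @ \oo --> fine (limn_esup (fun k => (a k)%:E)).
  move=> ca; rewrite is_cvg_limn_esupE; last by apply/cvg_ex; exists (limn a)%:E;
      apply: cvg_EFin => //; exact: nearW.
  rewrite (_ : limn _ = (limn a)%:E)//; apply/cvg_lim => //.
  by apply: cvg_EFin => //; exact: nearW.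
have aeF := ae_filter_ringOfSetsType mu.
(* Fatou is applied to the subsequence started at index [j]: all its terms lie beyond [N j], hence
   within 2^-j of [u n]. *)
have key j n : (N j <= n)%N -> (sqint mu (fun x =>
    (w x - u n x)%R) <= ((2^-1 ^+ j) ^+ 2)%:E)%E.
  move=> jn; pose f (k : nat) (x : T) : \bar R :=
      ((normc (v (k + j)%N x - u n x)) ^+ 2)%:E.
  have mf k : measurable_fun setT (f k) by apply: measurable_sqnormc; exact: cmeasurableB.
  have f0 k x : setT x -> (0 <= f k x)%E by rewrite lee_fin sqr_ge0.
  have := fatou mu measurableT mf f0.
  have -> : (\int[mu]_x limn_einf (f^~ x) = sqint mu (fun x => (w x - u n x)%R))%E.
    apply: ae_eq_integral => //.
    - apply: measurableT_comp => //; apply: measurable_fun_limn_esup => k.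
      by apply: measurableT_comp.
    - by apply: measurable_sqnormc; exact: cmeasurableB.
    apply: filterS (fast_L2_cvg vc) => x [/limE cr /limE ci] _.
    have fx : f k x @[k --> \oo] --> ((normc (w x - u n x)) ^+ 2)%:E.
      apply: cvg_EFin; first exact: nearW.
      rewrite sqr_normc !raddfB/=.
      rewrite (_ : fine \o _ = (fun k =>
          (complex.Re (v (k + j)%N x) - complex.Re (u n x)) ^+ 2 +
         (complex.Im (v (k + j)%N x) - complex.Im (u n x)) ^+ 2)); last first.
        by apply/funext => k /=; rewrite sqr_normc !raddfB.
      rewrite -(cvg_shiftn j) in cr; rewrite -(cvg_shiftn j) in ci.
      by apply: cvgD; apply: (@cvgM _ _ _ _ (fun k => _ - _) (fun k => _ - _));
          apply: cvgB => //; exact: cvg_cst.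
    by have [] := cvg_limn_einf_sup fx.
  move=> /le_trans; apply; rewrite limn_einf_lim; apply: lime_le;
      first exact: is_cvg_einfs.
  apply: nearW => k; apply: (@le_trans _ _ (\int[mu]_x f k x)%E).
    by apply: ereal_inf_lbound; exists k => //=.
  rewrite -/(sqint mu (fun x => v (k + j)%N x - u n x)) sqint_sub lee_fin.
  rewrite ler_sqr ?nnegrE ?rnorm_ge0 ?(ltW (h0 _))//.
  by apply: hN => //; apply: Ns; exact: leq_addl.
have wL : in_CLp mu 2%:E w.
  have dL : in_CLp mu 2%:E (fun x => w x - u (N 0%N) x).
    apply/in_CL2P; split; first exact: cmeasurableB.
    by apply: (le_lt_trans (key 0%N _ (leqnn _))); exact: ltry.
  have := in_CLpD (lee1n 2) dL (CLspaceP (u (N 0%N))).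
  by under eq_fun do rewrite subrK.
exists (CLclass mu (lee1n 2) w); apply/cvg_CLspaceP.
have wu j n : (N j <= n)%N -> rnorm (CLclass mu (lee1n 2) w - u n) <= 2^-1 ^+ j.
  move=> jn; rewrite -ler_sqr ?nnegrE ?rnorm_ge0 ?(ltW (h0 _))// -lee_fin.
  rewrite -sqint_sub; apply: le_trans (key j n jn); rewrite le_eqVlt; apply/orP; left;
      apply/eqP.
  apply: ae_eq_sqint; [|exact: cmeasurableB|].
    by apply: cmeasurableB => //; case: (CLspaceP (CLclass mu (lee1n 2) w)).
  by apply: filterS (CLclassE (lee1n 2) wL) => x ->.
apply/cvgrPdist_lt => e e0.
have : (2^-1 : R) ^+ j @[j --> \oo] --> 0.
  by apply: cvg_expr; rewrite ger0_norm ?invr_ge0// invf_lt1 ?ltr1n.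
move/cvgrPdist_lt => /(_ e e0) [j _ /(_ j (leqnn _))] /=.
rewrite sub0r normrN ger0_norm ?(ltW (h0 _))// => je.
exists (N j) => //= n jn; rewrite sub0r normrN ger0_norm ?rnorm_ge0//.
exact: le_lt_trans (wu j n jn) je.
Qed.

End L2_completeness.

(** * The Fourier-Plancherel transformation *)

Section CLclass_theory.
Context d (T : measurableType d) (R : realType).
Variables (mu : {measure set T -> \bar R}) (p : \bar R) (p1 : (1 <= p)%E).
Local Notation L := (CLspace mu p1).
Implicit Types (f g : T -> R[i]) (F G : L).

Lemma CLclass_id F : CLclass mu p1 F = F.
Proof. exact/CLspace_ext/CLclassE/CLspaceP. Qed.

Lemma eq_CLclass f g : in_CLp mu p f -> in_CLp mu p g ->
  {ae mu, forall x, f x = g x} -> CLclass mu p1 f = CLclass mu p1 g.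
Proof.
move=> fL gL fg; have aeF := ae_filter_ringOfSetsType mu; apply: CLspace_ext.
by apply: filterS3 (CLclassE p1 fL) (CLclassE p1 gL) fg => x -> -> ->.
Qed.

Lemma CLclass_unique f F : in_CLp mu p f -> {ae mu, forall x,
    f x = F x} -> CLclass mu p1 f = F.
Proof. by move=> fL fF; rewrite -[RHS]CLclass_id; apply: eq_CLclass => //;
    exact: CLspaceP. Qed.

Lemma CLclassD f g : in_CLp mu p f -> in_CLp mu p g ->
  CLclass mu p1 (fun x => f x + g x) = CLclass mu p1 f + CLclass mu p1 g.
Proof.
move=> fL gL; have aeF := ae_filter_ringOfSetsType mu.
apply: CLclass_unique; first exact: in_CLpD.
by apply: filterS3 (CLclassE p1 fL) (CLclassE p1 gL) (CLspace_addE (CLclass mu p1 f)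
    (CLclass mu p1 g)) => x <- <- ->.
Qed.

Lemma CLclassZ (c : R[i]) f : in_CLp mu p f ->
  CLclass mu p1 (fun x => c * f x) = c *: CLclass mu p1 f.
Proof.
move=> fL; have aeF := ae_filter_ringOfSetsType mu.
apply: CLclass_unique; first exact: in_CLpZ.
by apply: filterS2 (CLclassE p1 fL) (CLspace_scaleE c (CLclass mu p1 f)) => x <- ->.
Qed.

End CLclass_theory.

Section plancherel_existence.
Context (R : realType).
Local Notation mu := (@lebesgue_measure R).
Local Notation T := (measurableTypeR R).
Local Notation L2R := (CLspace mu (lee1n 2)).
Implicit Types (F G : L2R) (f g : T -> R[i]).

Definition truncf (n : nat) f (x : T) : R[i] := f x * chi (- n%:R) n%:R x.
Definition trunc n F : L2R := L2_class (truncf n F).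
(* Junk unless [F] is integrable: no truncation is involved. *)
Definition fhat1 F : L2R := L2_class (fhat F).

Lemma normc_truncf_le n f x : normc (truncf n f x) <= normc (f x).
Proof. by rewrite normcM ler_piMr ?normc_ge0// normc_chi_le1. Qed.

Lemma cmeasurable_truncf n f : cmeasurable f -> cmeasurable (truncf n f).
Proof. by move=> mf; apply: cmeasurableM => //; exact: cmeasurable_chi. Qed.

Lemma in_CL2_le f g : cmeasurable f -> (forall x, normc (f x) <= normc (g x)) ->
  in_CLp mu 2%:E g -> in_CLp mu 2%:E f.
Proof.
move=> mf fg [mg go]; split=> //; apply: le_lt_trans go.
apply: (le_cLnorm (lee1n 2)); try exact: cmeasurable_normc.
by apply: aeW => x; rewrite normc_ge0 fg.
Qed.

Lemma in_CL2_truncf n f : in_CLp mu 2%:E f -> in_CLp mu 2%:E (truncf n f).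
Proof.
move=> fL; apply: (in_CL2_le _ _ fL); last exact: normc_truncf_le.
by apply: cmeasurable_truncf; case: fL.
Qed.

Lemma truncE n F : {ae mu, forall x, trunc n F x = F x * chi (- n%:R) n%:R x}.
Proof. exact/CLclassE/in_CL2_truncf/CLspaceP. Qed.

Lemma cintegrable_trunc n F : cintegrable mu (trunc n F).
Proof.
have [mF _] := CLspaceP F; have [mt _] := CLspaceP (trunc n F).
have aeF := ae_filter_ringOfSetsType mu.
apply: (ae_eq_cintegrable (cmeasurable_truncf n mF) mt).
  by apply: filterS (truncE n F) => x ->.
exact: in_CL2M (CLspaceP F) (in_CL2_chi _ _).
Qed.

Lemma fhat_ae f g : cmeasurable f -> cmeasurable g ->
  {ae mu, forall x, f x = g x} -> fhat f = fhat g.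
Proof.
move=> mf mg fg; apply/funext => xi; apply: ae_eq_cint; try exact: cmeasurable_fhatI.
have aeF := ae_filter_ringOfSetsType mu.
by apply: filterS fg => x ->.
Qed.

Lemma in_CL2_fhat F : cintegrable mu F -> in_CLp mu 2%:E (fhat F).
Proof.
move=> Fi; have /in_CL2P[mF Fo] := CLspaceP F; apply/in_CL2P; split;
    first exact: cmeasurable_fhat.
apply: (le_lt_trans (sqint_fhat_le Fi)).
by rewrite lte_mul_pinfty// lee_fin mulr_ge0// pi_ge0.
Qed.

(** The root of the constant in [sqint_fhat_le]. The true operator norm is the root of 2 pi, but
    continuity is all that is drawn from this bound. *)
Definition fourier_bound : R := Num.sqrt (4 * pi).

Lemma fourier_bound_ge0 : 0 <= fourier_bound.
Proof. exact: sqrtr_ge0. Qed.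

Lemma rnorm_fhat1_le F : cintegrable mu F ->
  rnorm (fhat1 F) <= fourier_bound * rnorm F.
Proof.
move=> Fi; have p0 : 0 <= 4 * pi :> R by rewrite mulr_ge0// pi_ge0.
rewrite -ler_sqr ?nnegrE ?rnorm_ge0 ?mulr_ge0 ?rnorm_ge0 ?fourier_bound_ge0//.
rewrite -lee_fin rnorm_class; last exact: in_CL2_fhat.
by rewrite exprMn sqr_sqrtr// EFinM rnorm_sqint; exact: sqint_fhat_le.
Qed.

Lemma cintegrable_class F f : cmeasurable f -> cintegrable mu f ->
  {ae mu, forall x, F x = f x} -> cintegrable mu F.
Proof.
move=> mf fi Ff; have [mF _] := CLspaceP F.
have aeF := ae_filter_ringOfSetsType mu.
by apply: (ae_eq_cintegrable mf mF) fi; apply: filterS Ff => x ->.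
Qed.

Lemma cintegrable_CLlin (c : R[i]) F G : cintegrable mu F -> cintegrable mu G ->
  cintegrable mu (c *: F + G : L2R).
Proof.
move=> Fi Gi; have [mF _] := CLspaceP F; have [mG _] := CLspaceP G.
have aeF := ae_filter_ringOfSetsType mu.
have h := cintegrableD (cintegrableZ c Fi) Gi.
apply: (cintegrable_class _ h); first by case: h.
by apply: filterS2 (CLspace_addE (c *: F) G) (CLspace_scaleE c F) => x -> ->.
Qed.

Lemma fhat1_linear (c : R[i]) F G : cintegrable mu F -> cintegrable mu G ->
  fhat1 (c *: F + G) = c *: fhat1 F + fhat1 G.
Proof.
move=> Fi Gi; have [mF _] := CLspaceP F; have [mG _] := CLspaceP G.
have aeF := ae_filter_ringOfSetsType mu.
have FL := in_CL2_fhat Fi; have GL := in_CL2_fhat Gi.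
rewrite /fhat1 -(CLclassZ _ c FL) -CLclassD//; last exact: (in_CLpZ (lee1n 2) c FL).
congr CLclass; have h := cintegrableD (cintegrableZ c Fi) Gi.
rewrite (@fhat_ae _ (fun x => c * F x + G x)).
- apply/funext => xi; rewrite /fhat -cintZ; last exact: cintegrable_expiM.
  rewrite -cintD; [|exact/cintegrableZ/cintegrable_expiM|exact: cintegrable_expiM].
  by congr cint; apply/funext => x; rewrite mulrDr mulrCA.
- by case: (CLspaceP (c *: F + G)).
- by case: h.
- by apply: filterS2 (CLspace_addE (c *: F) G) (CLspace_scaleE c F) => x -> ->.
Qed.

Lemma trunc_linear n (c : R[i]) F G : trunc n (c *: F + G) = c *: trunc n F + trunc n G.
Proof.
have aeF := ae_filter_ringOfSetsType mu; apply: CLspace_ext.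
apply: filterS3 (truncE n (c *: F + G)) (CLspace_addE (c *: F) G) (filterI (truncE n F)
    (filterI (truncE n G)
  (filterI (CLspace_scaleE c F) (filterI (CLspace_addE (c *: trunc n F) (trunc n G))
      (CLspace_scaleE c (trunc n F)))))).
by move=> x -> -> [F1 [G1 [-> [-> ->]]]]; rewrite F1 G1 mulrDl mulrA.
Qed.

Lemma rnorm_trunc_le n F : rnorm (trunc n F) <= rnorm F.
Proof.
have aeF := ae_filter_ringOfSetsType mu.
apply: rnorm_le_ae; apply: filterS (truncE n F) => x ->.
exact: normc_truncf_le.
Qed.

Lemma cvg_sqr0 (a : nat -> R) : (forall n, 0 <= a n) ->
  (a n) ^+ 2 @[n --> \oo] --> 0 -> a @ \oo --> 0.
Proof.
move=> a0 ca; rewrite -(sqrtr0 R).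
rewrite (_ : a = Num.sqrt \o (fun n => (a n) ^+ 2)); last first.
  by apply/funext => n /=; rewrite sqrtr_sqr ger0_norm.
exact: (cvg_comp _ _ ca (@sqrt_continuous R 0)).
Qed.

Lemma cvg_trunc F : trunc n F @[n --> \oo] --> F.
Proof.
apply/cvg_CLspaceP; apply: cvg_sqr0 => [n|]; first exact: rnorm_ge0.
have [mF _] := CLspaceP F; have aeF := ae_filter_ringOfSetsType mu.
pose f (n : nat) (x : T) : \bar R := ((normc (F x - truncf n F x)) ^+ 2)%:E.
have mf n : measurable_fun setT (f n).
  by apply/measurable_sqnormc/cmeasurableB => //; exact: cmeasurable_truncf.
have i0 : mu.-integrable setT (fun x => ((normc (F x)) ^+ 2)%:E).
  apply/integrableP; split; first exact: measurable_sqnormc.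
  have /in_CL2P[_] := CLspaceP F; congr (_ < _)%E; apply: eq_integral => x _.
  by rewrite abse_EFin ger0_norm// sqr_ge0.
have fE n x : f n x = ((normc (F x)) ^+ 2 * (if `|x| <= n%:R then 0 else 1))%:E.
  rewrite /f /truncf chiE -ler_norml; case: ifP => _.
    by rewrite mulr1 subrr normc0 expr0n mulr0.
  by rewrite mulr0 subr0 mulr1.
have [||_ _ cv] := @dominated_convergence _ _ _ mu setT measurableT f (cst 0%E) _ mf
    (measurable_cst _) _ i0.
- apply: aeW => x _; apply: cvg_near_cst; exists (Num.bound `|x|) => //= n /= xn.
  rewrite fE ifT ?mulr0//; apply: (le_trans (ltW (archi_boundP (normr_ge0 x)))).
  by rewrite ler_nat.
- apply: aeW => x n _; rewrite fE abse_EFin lee_fin ger0_norm.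
    by case: ifP => _; rewrite ?mulr0 ?mulr1// sqr_ge0.
  by case: ifP => _; rewrite ?mulr0 ?mulr1// sqr_ge0.
move: cv; rewrite integral0 => /fine_cvg.
rewrite (_ : fine \o _ = (fun n => rnorm (F - trunc n F) ^+ 2))//.
apply/funext => n /=; rewrite -[RHS]/(fine (_ %:E)) rnorm_sqint; congr fine.
apply: ae_eq_sqint; [exact: cmeasurableB mF (cmeasurable_truncf n mF)|by case:
    (CLspaceP (F - trunc n F))|].
by apply: filterS2 (CLsubE F (trunc n F)) (truncE n F) => x -> ->.
Qed.

Lemma cintegral_itv_fhat n F xi :
  cintegral `[- n%:R, n%:R] (fun x : R => expi (xi * x) * F x) = fhat (trunc n F) xi.
Proof.
have [mF _] := CLspaceP F; have [mt _] := CLspaceP (trunc n F).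
rewrite -(@fhat_ae (truncf n F))//; last 2 first.
- exact: cmeasurable_truncf.
- have aeF := ae_filter_ringOfSetsType mu.
  by apply: filterS (truncE n F) => x ->.
rewrite /cintegral /fhat /cint; congr (_ +i* _); rewrite Rintegral_mkcond;
  congr (Rintegral _ _ _); apply/funext => x; rewrite patchE /truncf /chi indicE;
  by case: ifP => _; rewrite ?mulr1 ?mulr0.
Qed.

(** This shows that the [lim] in the definition of [fourier] exists: the truncations converge in
    L^2, [fhat1] is linear and bounded on integrable classes, and L^2 is complete. *)
Lemma fourier_cvg F : fhat1 (trunc n F) @[n --> \oo] --> fourier F.
Proof.
have h : (fun n : nat => L2_class (fun xi : R =>
          cintegral `[- n%:R, n%:R] (fun x : R => expi (xi * x) * F x))) =
   (fun n => fhat1 (trunc n F)).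
  by apply/funext => n; congr CLclass; apply/funext => xi; exact: cintegral_itv_fhat.
have [|G uG] := @L2_complete _ _ _ mu (fun n => fhat1 (trunc n F)); last first.
  by rewrite /fourier h; apply/cvg_ex; exists G.
move=> e e0; have c0 := fourier_bound_ge0.
have [del d0 dK] : exists2 del : R, 0 < del & fourier_bound * (del + del) <= e.
  move: (fourier_bound) c0 => K K0; have K1 : 0 < K + 1 by rewrite ltr_wpDl.
  (* The resulting value is e K / (K + 1); the [+ 1] keeps the denominator positive for every K >=
     0. *)
  exists (e / (2 * (K + 1))); first by rewrite divr_gt0// mulr_gt0.
  rewrite [leLHS](_ : _ = e * (K / (K + 1))); last by field; rewrite gt_eqF.
  by rewrite ler_piMr ?(ltW e0)// ler_pdivrMr// mul1r lerDl.
have cF := (cvg_CLspaceP _ _).1 (@cvg_trunc F).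
move/cvgrPdist_lt : cF => /(_ _ d0)[N _ hN].
exists N => m n Nm Nn.
have small k : (N <= k)%N -> rnorm (F - trunc k F) <= del.
  by move=> /hN/=; rewrite sub0r normrN ger0_norm ?rnorm_ge0// => /ltW.
have -> : fhat1 (trunc m F) - fhat1 (trunc n F) = fhat1 (trunc m F - trunc n F).
  rewrite addrC -scaleN1r -fhat1_linear; [|exact: cintegrable_trunc..].
  by rewrite scaleN1r addrC.
have ci : cintegrable mu (trunc m F - trunc n F : L2R).
  by rewrite addrC -scaleN1r; apply: cintegrable_CLlin; exact: cintegrable_trunc.
apply: (le_trans (rnorm_fhat1_le ci)); apply: le_trans dK.
have -> : trunc m F - trunc n F = (F - trunc n F) - (F - trunc m F).
  by rewrite opprB [RHS]addrC subrKA.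
apply: ler_wpM2l => //; apply: (le_trans (rnormB _ _)).
by apply: lerD; exact: small.
Qed.

Lemma fourier_linear (c : R[i]) F G : fourier (c *: F + G) = c *: fourier F + fourier G.
Proof.
have h1 := @fourier_cvg (c *: F + G).
have h2 : fhat1 (trunc n (c *: F + G)) @[n --> \oo] --> c *: fourier F + fourier G.
  rewrite (_ : (fun n => _) = (fun n => c *: fhat1 (trunc n F) + fhat1 (trunc n G)));
      last first.
    apply/funext => n; rewrite trunc_linear fhat1_linear//; exact: cintegrable_trunc.
  by apply: cvgD; [apply: cvgZr; exact: fourier_cvg|exact: fourier_cvg].
exact: (cvg_unique _ h1 h2).
Qed.

Lemma rnorm_fourier_le F : rnorm (fourier F) <= fourier_bound * rnorm F.
Proof.
have h := (cvg_CLspaceP _ _).1 (@fourier_cvg F).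
have h' : rnorm (fourier F - fhat1 (trunc n F)) + fourier_bound * rnorm F @[n --> \oo] -->
    0 + fourier_bound * rnorm F by apply: cvgD => //; exact: cvg_cst.
rewrite -[leRHS]add0r; apply: (cvgr_to_ge h'); apply: nearW => n.
rewrite -{1}[fourier F](subrK (fhat1 (trunc n F))) (le_trans (rnormD _ _))// lerD2l.
apply: (le_trans (rnorm_fhat1_le (cintegrable_trunc n F))).
by rewrite ler_wpM2l ?fourier_bound_ge0// rnorm_trunc_le.
Qed.

Lemma trunc_trunc m n F : (m <= n)%N -> trunc n (trunc m F) = trunc m F.
Proof.
move=> mn; have aeF := ae_filter_ringOfSetsType mu; apply: CLspace_ext.
apply: filterS2 (truncE n (trunc m F)) (truncE m F) => x -> ->.
rewrite -mulrA; congr (_ * _); rewrite !chiE -!ler_norml.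
case: ifP => [xm|_]; last by rewrite mul0r.
by rewrite mul1r ifT// (le_trans xm)// ler_nat.
Qed.

(** For bounded support the truncations are eventually constant, and the transform is given by the
    integral formula. Indicators of intervals and translated truncations are reached this way. *)
Lemma fourier_compact m F : trunc m F = F -> fourier F = fhat1 F.
Proof.
move=> mF; have h1 := @fourier_cvg F.
have h2 : fhat1 (trunc n F) @[n --> \oo] --> fhat1 F.
  apply: cvg_near_cst; exists m => //= n mn.
  by rewrite -{1}mF trunc_trunc// mF.
exact: (cvg_unique _ h1 h2).
Qed.

End plancherel_existence.

(** * The bilinear pairing on L^2 *)

Section pairing.
Context (R : realType).
Local Notation mu := (@lebesgue_measure R).
Local Notation T := (measurableTypeR R).
Local Notation L2R := (CLspace mu (lee1n 2)).
Implicit Types (F G : L2R) (f g : T -> R[i]) (a b : R) (u v : nat -> L2R).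

(** Without conjugation, so that both the Fourier transformation and the reflection are symmetric
    for it. *)
Definition pairing F G : R[i] := cint mu (fun x => F x * G x).

Lemma pairingC F G : pairing F G = pairing G F.
Proof. by congr cint; apply/funext => x; rewrite mulrC. Qed.

Lemma normc_pairing_le F G : normc (pairing F G) <= rnorm F * rnorm G.
Proof. exact: cauchy_schwarz (CLspaceP F) (CLspaceP G). Qed.

Lemma cintegrable_pairing F G : cintegrable mu (fun x => F x * G x).
Proof. exact: in_CL2M (CLspaceP F) (CLspaceP G). Qed.

Lemma pairing_ae F G f : cmeasurable f ->
  {ae mu, forall x, F x * G x = f x} -> pairing F G = cint mu f.
Proof. by move=> mf; apply: ae_eq_cint mf; case: (cintegrable_pairing F G). Qed.

Lemma pairingBl F F' G : pairing (F - F') G = pairing F G - pairing F' G.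
Proof.
have aeF := ae_filter_ringOfSetsType mu.
have h1 := cintegrable_pairing F G; have h2 := cintegrable_pairing F' G.
rewrite (@pairing_ae _ _ (fun x => F x * G x - F' x * G x)).
- exact: cintB.
- by case: (cintegrableB h1 h2).
- by apply: filterS (CLsubE F F') => x ->; rewrite mulrBl.
Qed.

(** Carries identities from truncations to all of L^2; the scalar is 1 for the symmetry of the
    transformation and 2 pi for its inversion. *)
Lemma cvg_pairing_eq u v F F' G G' (c : R[i]) : u @ \oo --> F -> v @ \oo --> F' ->
  (forall n, pairing (u n) G = c * pairing (v n) G') -> pairing F G = c * pairing F' G'.
Proof.
move=> uF vF uv; apply/eqP; rewrite -subr_eq0; apply/eqP/eq0_normc.
apply/eqP; rewrite eq_le normc_ge0 andbT.
have h : rnorm (F - u n) * rnorm G + normc c * (rnorm (F' - v n) * rnorm G') @[n -->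
    \oo] -->
    0 * rnorm G + normc c * (0 * rnorm G').
  apply: cvgD; first by apply: cvgM; [exact: (cvg_CLspaceP _ _).1|exact: cvg_cst].
  apply: cvgM; first exact: cvg_cst.
  by apply: cvgM; [exact: (cvg_CLspaceP _ _).1|exact: cvg_cst].
rewrite !mul0r mulr0 addr0 in h.
apply: (cvgr_to_ge h); apply: nearW => n.
have -> : pairing F G - c * pairing F' G' =
   pairing (F - u n) G - c * pairing (F' - v n) G'.
  rewrite !pairingBl uv; ring.
apply: (le_trans (le_normcD _ _)); rewrite normcN normcM.
apply: lerD; first exact: normc_pairing_le.
by apply: ler_wpM2l; [exact: normc_ge0|exact: normc_pairing_le].
Qed.

Lemma pairing_fhat1 F G : cintegrable mu F -> cintegrable mu G ->
  pairing (fhat1 F) G = pairing F (fhat1 G).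
Proof.
move=> Fi Gi; have aeF := ae_filter_ringOfSetsType mu.
have [mF _] := Fi; have [mG _] := Gi.
have hF := CLclassE (lee1n 2) (in_CL2_fhat Fi);
    have hG := CLclassE (lee1n 2) (in_CL2_fhat Gi).
rewrite (@pairing_ae _ _ (fun x => G x * fhat F x)); first last.
- by apply: filterS hF => x; rewrite mulrC => ->.
- by apply: cmeasurableM => //; exact: cmeasurable_fhat.
rewrite (@pairing_ae _ _ (fun x => F x * fhat G x)).
- exact: cint_mul_fhat.
- by apply: cmeasurableM => //; exact: cmeasurable_fhat.
- by apply: filterS hG => x ->.
Qed.

(** The multiplication formula holds for truncations, which are integrable; they are removed one
    argument at a time. *)
Lemma pairing_fourier F G : pairing (fourier F) G = pairing F (fourier G).
Proof.
have step m : pairing (fourier F) (trunc m G) = 1 * pairing F (fhat1 (trunc m G)).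
  apply: (cvg_pairing_eq (@fourier_cvg _ F) (@cvg_trunc _ F)) => n.
  by rewrite mul1r; apply: pairing_fhat1; exact: cintegrable_trunc.
rewrite pairingC [RHS]pairingC -[RHS]mul1r.
apply: (cvg_pairing_eq (@cvg_trunc _ G) (@fourier_cvg _ G)) => n.
by rewrite pairingC step [in RHS]pairingC.
Qed.

Definition chiL a b : L2R := L2_class (chi a b).

Lemma pairing_chiL F a b : pairing F (chiL a b) = cint mu (fun x => F x * chi a b x).
Proof.
have aeF := ae_filter_ringOfSetsType mu.
apply: pairing_ae; first by case: (in_CL2M (CLspaceP F) (in_CL2_chi a b)).
by apply: filterS (CLclassE (lee1n 2) (in_CL2_chi a b)) => x ->.
Qed.

Lemma pairing_chiL_eq0 F : (forall a b, a < b -> pairing F (chiL a b) = 0) -> F = 0.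
Proof.
move=> h; have aeF := ae_filter_ringOfSetsType mu; apply: CLspace_ext.
have h0 : {ae mu, forall x, F x = 0}.
  by apply: cint_chi_eq0; [exact: CLspaceP|move=> a b ab; rewrite -pairing_chiL h].
by apply: filterS2 h0 (CLzeroE mu (lee1n 2)) => x -> ->.
Qed.

End pairing.

(** * Composition with measure-preserving maps on L^2 *)

Section measure_preserving_L2.
Context (R : realType).
Local Notation mu := (@lebesgue_measure R).
Local Notation T := (measurableTypeR R).
Local Notation L2R := (CLspace mu (lee1n 2)).
Variable phi : T -> T.
Hypothesis mphi : measurable_fun setT phi.
Hypothesis phiE : forall A, measurable A -> mu (phi @^-1` A) = mu A.
Implicit Types (F G : L2R) (f g : T -> R[i]).

Definition compL F : L2R := L2_class (fun x => F (phi x)).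

Lemma sqint_comp f : cmeasurable f -> sqint mu (fun x => f (phi x)) = sqint mu f.
Proof.
move=> mf; apply: (ge0_integral_preserving mphi phiE (measurable_sqnormc mf)) => x.
by rewrite lee_fin sqr_ge0.
Qed.

Lemma in_CL2_comp f : in_CLp mu 2%:E f -> in_CLp mu 2%:E (fun x => f (phi x)).
Proof.
move=> /in_CL2P[mf fo]; apply/in_CL2P; split; first exact: (cmeasurable_comp mf mphi).
by rewrite sqint_comp.
Qed.

Lemma compLE F : {ae mu, forall x, compL F x = F (phi x)}.
Proof. exact/CLclassE/in_CL2_comp/CLspaceP. Qed.

Lemma rnorm_compL F : rnorm (compL F) = rnorm F.
Proof.
have [mF _] := CLspaceP F.
apply/eqP; rewrite -(@eqrXn2 _ 2%N) ?rnorm_ge0//; apply/eqP.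
have [] : ((rnorm (compL F)) ^+ 2)%:E = ((rnorm F) ^+ 2)%:E; last by [].
rewrite rnorm_class; last exact/in_CL2_comp/CLspaceP.
by rewrite sqint_comp// rnorm_sqint.
Qed.

Lemma compL_linear (c : R[i]) F G : compL (c *: F + G) = c *: compL F + compL G.
Proof.
have aeF := ae_filter_ringOfSetsType mu; apply: CLspace_ext.
have h : {ae mu, forall x, (c *: F + G : L2R) (phi x) = c * F (phi x) + G (phi x)}.
  apply: (ae_preserving mphi phiE (P := fun x => (c *: F + G : L2R) x = c * F x + G x)).
  by apply: filterS2 (CLspace_addE (c *: F) G) (CLspace_scaleE c F) => x -> ->.
apply: filterS3 (compLE (c *: F + G)) h (filterI (CLspace_addE (c *: compL F) (compL G))
  (filterI (CLspace_scaleE c (compL F)) (filterI (compLE F) (compLE G)))).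
by move=> x -> -> [-> [-> [-> ->]]].
Qed.

Lemma compLB F G : compL (F - G) = compL F - compL G.
Proof. by rewrite addrC -scaleN1r compL_linear scaleN1r addrC. Qed.

Lemma cvg_compL (u : nat -> L2R) F : u @ \oo --> F -> compL (u n) @[n --> \oo] -->
    compL F.
Proof.
move=> /cvg_CLspaceP uF; apply/cvg_CLspaceP.
by under eq_fun do rewrite -compLB rnorm_compL.
Qed.

End measure_preserving_L2.

(** * Multiplication by bounded symbols; continuity of operators on L^2 *)

Section multiplication.
Context (R : realType).
Local Notation mu := (@lebesgue_measure R).
Local Notation T := (measurableTypeR R).
Local Notation L2R := (CLspace mu (lee1n 2)).
Local Notation LooR := (CLspace mu (leey 1%E)).
Implicit Types (F G : L2R) (phi psi : LooR).

Lemma Loo_bound phi : {ae mu, forall x, normc (phi x) <= rnorm phi}.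
Proof.
have aeF := ae_filter_ringOfSetsType mu.
have fin := CLnorm_fin phi.
have : {ae mu, forall x, ((normc (phi x))%:E <= cLnorm mu +oo%E phi)%E}.
  rewrite /cLnorm unlock /Lnorm; case: ifPn => [_|].
    by apply: filterS (ess_sup_ge mu (abse \o (EFin \o (fun x => normc (phi x))))) => x;
      rewrite /= ger0_norm ?normc_ge0.
  (* The L^oo norm is 0 by convention when the measure is zero; then the whole space is a null
     set. *)
  rewrite -leNgt => mu0; exists setT; split => //.
  by apply/eqP; rewrite eq_le mu0 measure_ge0.
by apply: filterS => x; rewrite -[cLnorm _ _ _]fineK.
Qed.

Lemma in_CL2_Loo_mul phi F : in_CLp mu 2%:E (fun x => phi x * F x).
Proof.
have [mF _] := CLspaceP F; have [mp _] := CLspaceP phi.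
split; first exact: cmeasurableM.
have [mZ Zo] := in_CLpZ (lee1n 2) (rnorm phi)%:C (CLspaceP F).
apply: le_lt_trans Zo; apply: (le_cLnorm (lee1n 2)).
- by apply: cmeasurable_normc; exact: cmeasurableM.
- exact: cmeasurable_normc.
have aeF := ae_filter_ringOfSetsType mu.
apply: filterS (Loo_bound phi) => x px; rewrite normc_ge0 !normcM.
by rewrite ler_wpM2r ?normc_ge0// normc_real ger0_norm ?rnorm_ge0.
Qed.

Lemma mulopE phi F : {ae mu, forall x, mulop phi F x = phi x * F x}.
Proof. exact/CLclassE/in_CL2_Loo_mul. Qed.

Lemma rnorm_mulop_le phi F : rnorm (mulop phi F) <= rnorm phi * rnorm F.
Proof.
have aeF := ae_filter_ringOfSetsType mu.
rewrite -[X in X * _](ger0_norm (rnorm_ge0 _)) -normc_real -rnormZ.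
apply: rnorm_le_ae.
apply: filterS3 (mulopE phi F) (CLspace_scaleE (rnorm phi)%:C F) (Loo_bound phi) =>
    x -> -> px.
by rewrite !normcM ler_wpM2r ?normc_ge0// normc_real ger0_norm ?rnorm_ge0.
Qed.

Lemma mulop_linear phi (c : R[i]) F G : mulop phi (c *: F + G) = c *: mulop phi F +
    mulop phi G.
Proof.
have aeF := ae_filter_ringOfSetsType mu; apply: CLspace_ext.
apply: filterS3 (mulopE phi (c *: F + G)) (filterI (CLspace_addE (c *: F) G)
    (CLspace_scaleE c F))
  (filterI (CLspace_addE (c *: mulop phi F) (mulop phi G))
  (filterI (CLspace_scaleE c (mulop phi F)) (filterI (mulopE phi F) (mulopE phi G)))).
by move=> x -> [-> ->] [-> [-> [-> ->]]]; rewrite mulrDr mulrCA.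
Qed.

Lemma mulop_linear_l (c : R[i]) phi psi F :
  mulop (c *: phi + psi) F = c *: mulop phi F + mulop psi F.
Proof.
have aeF := ae_filter_ringOfSetsType mu; apply: CLspace_ext.
apply: filterS3 (mulopE (c *: phi + psi) F) (filterI (CLspace_addE (c *: phi) psi)
    (CLspace_scaleE c phi))
  (filterI (CLspace_addE (c *: mulop phi F) (mulop psi F))
  (filterI (CLspace_scaleE c (mulop phi F)) (filterI (mulopE phi F) (mulopE psi F)))).
by move=> x -> [-> ->] [-> [-> [-> ->]]]; rewrite mulrDl mulrA.
Qed.

Lemma mulopM phi psi F : mulop (phi * psi) F = mulop phi (mulop psi F).
Proof.
have aeF := ae_filter_ringOfSetsType mu; apply: CLspace_ext.
apply: filterS3 (mulopE (phi * psi) F) (CLmulE phi psi)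
  (filterI (mulopE phi (mulop psi F)) (mulopE psi F)).
by move=> x -> -> [-> ->]; rewrite mulrA.
Qed.

Lemma mulop1 F : mulop 1 F = F.
Proof.
have aeF := ae_filter_ringOfSetsType mu; apply: CLspace_ext.
by apply: filterS2 (mulopE 1 F) (CLoneE mu) => x -> ->; rewrite mul1r.
Qed.

Lemma mulopB phi F G : mulop phi (F - G) = mulop phi F - mulop phi G.
Proof. by rewrite addrC -scaleN1r mulop_linear scaleN1r addrC. Qed.

Lemma cvg_lipschitz (op : L2R -> L2R) (C : R) (u : nat -> L2R) F :
  (forall F G, op (F - G) = op F - op G) -> (forall F, rnorm (op F) <= C * rnorm F) ->
  u @ \oo --> F -> op (u n) @[n --> \oo] --> op F.
Proof.
move=> opB opC /cvg_CLspaceP uF; apply/cvg_CLspaceP.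
have h : C * rnorm (F - u n) @[n --> \oo] --> 0.
  by rewrite -(mulr0 C); apply: cvgM => //; exact: cvg_cst.
apply: (@squeeze_cvgr _ _ _ _ (fun=> 0) (fun n => C * rnorm (F - u n))) => //;
    last exact: cvg_cst.
by apply: nearW => n; rewrite rnorm_ge0/= -opB.
Qed.

Lemma cvg_mulop phi (u : nat -> L2R) F : u @ \oo --> F ->
  mulop phi (u n) @[n --> \oo] --> mulop phi F.
Proof. by apply: cvg_lipschitz; [exact: mulopB|exact: rnorm_mulop_le]. Qed.

Lemma fourierB F G : fourier (F - G) = fourier F - fourier G.
Proof. by rewrite addrC -scaleN1r fourier_linear scaleN1r addrC. Qed.

Lemma fourierZ (c : R[i]) F : fourier (c *: F) = c *: fourier F.
Proof.
have f0 : fourier (0 : L2R) = 0 by rewrite -[X in fourier X](subrr 0) fourierB subrr.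
by rewrite -[c *: F]addr0 fourier_linear f0 addr0.
Qed.

Lemma cvg_fourier (u : nat -> L2R) F : u @ \oo --> F ->
  fourier (u n) @[n --> \oo] --> fourier F.
Proof. by apply: cvg_lipschitz; [exact: fourierB|exact: rnorm_fourier_le]. Qed.

End multiplication.

(** * Reflection, translation and the inversion formula *)

Section symmetries.
Context (R : realType).
Local Notation mu := (@lebesgue_measure R).
Local Notation T := (measurableTypeR R).
Local Notation L2R := (CLspace mu (lee1n 2)).
Local Notation LooR := (CLspace mu (leey 1%E)).
Implicit Types (F G : L2R) (phi psi : LooR) (a : R).
Local Notation refl := (@reflection R 2%:E (lee1n 2)).

Definition translate a F : L2R := compL (fun x : T => x - a) F.

Let mopp : measurable_fun [set: T] (fun x : T => - x : T).
Proof. exact: oppr_measurable. Qed.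

Let mshift a : measurable_fun [set: T] (fun x : T => x - a : T).
Proof. exact: measurable_funD. Qed.

Lemma reflE F : {ae mu, forall x, refl F x = F (- x)}.
Proof. exact: (compLE mopp (@lebesgue_measure_opp R)). Qed.

Lemma shiftE a F : {ae mu, forall x, translate a F x = F (x - a)}.
Proof. exact: (compLE (mshift a) (@lebesgue_measure_shift R (- a))). Qed.

Lemma rnorm_refl F : rnorm (refl F) = rnorm F.
Proof. exact: (rnorm_compL mopp (@lebesgue_measure_opp R)). Qed.

Lemma cvg_refl (u : nat -> L2R) F : u @ \oo --> F -> refl (u n) @[n --> \oo] --> refl F.
Proof. exact: (cvg_compL mopp (@lebesgue_measure_opp R)). Qed.

Lemma cvg_shift a (u : nat -> L2R) F : u @ \oo --> F -> translate a (u n) @[n --> \oo]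
    --> translate a F.
Proof. exact: (cvg_compL (mshift a) (@lebesgue_measure_shift R (- a))). Qed.

Lemma ae_opp (P : T -> Prop) : {ae mu, forall x, P x} -> {ae mu, forall x, P (- x)}.
Proof. exact: (ae_preserving mopp (@lebesgue_measure_opp R)). Qed.

Lemma ae_shift a (P : T -> Prop) : {ae mu, forall x, P x} -> {ae mu, forall x, P (x - a)}.
Proof. exact: (ae_preserving (mshift a) (@lebesgue_measure_shift R (- a))). Qed.

Lemma pairing_refl F G : pairing (refl F) G = pairing F (refl G).
Proof.
have aeF := ae_filter_ringOfSetsType mu.
have [mF _] := CLspaceP F; have [mG _] := CLspaceP G.
have m1 : cmeasurable (fun x : T => F (- x) * G x).
  by apply: cmeasurableM => //; exact: cmeasurable_opp.
have m2 : cmeasurable (fun x : T => F x * G (- x)).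
  by apply: cmeasurableM => //; exact: cmeasurable_opp.
rewrite (pairing_ae m1); last by apply: filterS (reflE F) => x ->.
rewrite (pairing_ae m2); last by apply: filterS (reflE G) => x ->.
rewrite -(cint_opp m2); congr cint; apply/funext => x; by rewrite opprK.
Qed.

Lemma trunc_refl n F : trunc n (refl F) = refl (trunc n F).
Proof.
have aeF := ae_filter_ringOfSetsType mu; apply: CLspace_ext.
apply: filterS3 (truncE n (refl F)) (reflE F) (filterI (reflE (trunc n F)) (ae_opp
    (truncE n F))).
by move=> x -> -> [-> ->]; rewrite !chiE -!ler_norml normrN.
Qed.

Lemma fhat1_ae F (f : T -> R[i]) : cmeasurable f -> {ae mu, forall x, F x = f x} ->
  fhat1 F = L2_class (fhat f).
Proof.
move=> mf Ff; have [mF _] := CLspaceP F; rewrite /fhat1 (@fhat_ae _ F f)//.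
Qed.

Lemma fhat1_refl F : cintegrable mu F -> fhat1 (refl F) = refl (fhat1 F).
Proof.
move=> Fi; have aeF := ae_filter_ringOfSetsType mu; have [mF _] := Fi.
rewrite (fhat1_ae (cmeasurable_opp mF) (reflE F)).
apply: CLclass_unique.
  have -> : fhat (fun x => F (- x)) = (fun xi => fhat F (- xi)).
    by apply/funext => xi; rewrite fhat_opp.
  exact: (in_CL2_comp mopp (@lebesgue_measure_opp R) (in_CL2_fhat Fi)).
apply: filterS2 (reflE (fhat1 F)) (ae_opp (CLclassE (lee1n 2) (in_CL2_fhat Fi))) =>
    x -> ->.
by rewrite fhat_opp.
Qed.

Lemma fourier_refl F : fourier (refl F) = refl (fourier F).
Proof.
have h1 := @fourier_cvg _ (refl F).
have h2 : fhat1 (trunc n (refl F)) @[n --> \oo] --> refl (fourier F).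
  rewrite (_ : (fun n => _) = (fun n => refl (fhat1 (trunc n F)))).
    by apply: cvg_refl; exact: fourier_cvg.
  by apply/funext => n; rewrite trunc_refl fhat1_refl//; exact: cintegrable_trunc.
exact: (cvg_unique _ h1 h2).
Qed.

Lemma e_E a : {ae mu, forall x, e_ a x = expi (a * x)}.
Proof.
apply: CLclassE; apply/in_CLooP; split.
  by apply: cmeasurable_expiM; exact: measurable_mulr.
by exists 1; apply: aeW => x; rewrite normc_expi.
Qed.

(** A translated truncation still has bounded support, so that [fourier_compact] applies to it. *)
Lemma trunc_shift a n F (m : nat) : n%:R + `|a| <= m%:R ->
  trunc m (translate a (trunc n F)) = translate a (trunc n F).
Proof.
move=> nam; have aeF := ae_filter_ringOfSetsType mu; apply: CLspace_ext.
apply: filterS3 (truncE m (translate a (trunc n F))) (shiftE a (trunc n F)) (ae_shift a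
    (truncE n F)).
move=> x -> -> ->; rewrite !chiE -!ler_norml.
case: ifP => [xn|_]; last by rewrite mulr0 mul0r.
rewrite ifT ?mulr1//; apply: le_trans nam.
by rewrite -[x in `|x|](subrK a) (le_trans (ler_normD _ _))// lerD2r.
Qed.

Lemma fhat1_shift a F : cintegrable mu F -> fhat1 (translate a F) = mulop (e_ a) (fhat1
    F).
Proof.
move=> Fi; have aeF := ae_filter_ringOfSetsType mu; have [mF _] := Fi.
rewrite (fhat1_ae (cmeasurable_shift (- a) mF) (shiftE a F)).
have hE : fhat (fun x => F (x - a)) = (fun xi => expi (a * xi) * fhat F xi).
  by apply/funext => xi; rewrite fhat_shift// mulrC [xi * a]mulrC mulrC.
have FL := CLclassE (lee1n 2) (in_CL2_fhat Fi).
have ae1 : {ae mu, forall x, fhat (fun x => F (x - a)) x = mulop (e_ a) (fhat1 F) x}.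
  by apply: filterS3 (mulopE (e_ a) (fhat1 F)) FL (e_E a) => x -> -> ->; rewrite hE.
apply: CLclass_unique => //; rewrite hE.
apply: (in_CL2_le _ _ (in_CL2_fhat Fi)).
  by apply: cmeasurableM; [apply: cmeasurable_expiM;
      exact: measurable_mulr|exact: cmeasurable_fhat].
by move=> x; rewrite normcM normc_expi mul1r.
Qed.

Lemma fourier_shift a F : fourier (translate a F) = mulop (e_ a) (fourier F).
Proof.
have h1 := cvg_fourier (@cvg_shift a _ _ (@cvg_trunc _ F)).
have h2 : fourier (translate a (trunc n F)) @[n --> \oo] --> mulop (e_ a) (fourier F).
  rewrite (_ : (fun n => _) = (fun n => mulop (e_ a) (fhat1 (trunc n F)))).
    by apply: cvg_mulop; exact: fourier_cvg.
  apply/funext => n.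
  have am : n%:R + `|a| <= (n + Num.bound `|a|)%:R.
    by rewrite natrD lerD2l ltW// archi_boundP.
  rewrite (fourier_compact (trunc_shift F am)) fhat1_shift//.
  exact: cintegrable_trunc.
exact: (cvg_unique _ h1 h2).
Qed.

Lemma trunc_chiL a (b : R) (m : nat) : `|a| <= m%:R -> `|b| <= m%:R -> trunc m (chiL a
    b) = chiL a b.
Proof.
rewrite !ler_norml => /andP[a1 a2] /andP[b1 b2].
have aeF := ae_filter_ringOfSetsType mu; apply: CLspace_ext.
apply: filterS2 (truncE m (chiL a b)) (CLclassE (lee1n 2) (in_CL2_chi a b)) => x -> ->.
rewrite !chiE; case: ifP => [/andP[ax xb]|_]; last by rewrite mul0r.
by rewrite mul1r ifT// (le_trans a1 ax) (le_trans xb b2).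
Qed.

(** Paired with the indicator of an interval, the outer transformation and the reflection move to
    the indicator by symmetry; once [F] is replaced by its truncations, the identity is
    [cint_fhat_chi]. *)
Lemma fourier_inversion F : fourier (refl (fourier F)) = (2 * pi)%:C *: F.
Proof.
have aeF := ae_filter_ringOfSetsType mu.
have Zl (c : R[i]) G H : pairing (c *: G) H = c * pairing G H.
  have h := cintegrableZ c (cintegrable_pairing G H).
  rewrite (@pairing_ae _ _ _ (fun x => c * (G x * H x))).
  - by rewrite cintZ//; exact: cintegrable_pairing.
  - by case: h.
  - by apply: filterS (CLspace_scaleE c G) => x ->; rewrite mulrA.
apply/eqP; rewrite -subr_eq0; apply/eqP; apply: pairing_chiL_eq0 => a b ab.
rewrite pairingBl Zl; apply/eqP; rewrite subr_eq0; apply/eqP.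
rewrite pairing_fourier pairing_refl.
apply: (cvg_pairing_eq (@fourier_cvg _ F) (@cvg_trunc _ F)) => n.
have Fi := cintegrable_trunc n F.
have am : exists m : nat, `|a| <= m%:R /\ `|b| <= m%:R.
  exists (Num.bound `|a| + Num.bound `|b|)%N; rewrite natrD; split.
    by rewrite (le_trans (ltW (archi_boundP (normr_ge0 a))))// lerDl.
  by rewrite (le_trans (ltW (archi_boundP (normr_ge0 b))))// lerDr.
have [m [ma mb]] := am.
rewrite (fourier_compact (trunc_chiL ma mb)) pairing_chiL -cint_fhat_chi//;
    last exact: CLspaceP.
have ci : cintegrable mu (chiL a b).
  by rewrite -(trunc_chiL ma mb); exact: cintegrable_trunc.
have chat : fhat (chiL a b) = fhat (chi a b).
  apply: fhat_ae; [by case: ci|exact: cmeasurable_chi|].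
  exact: (CLclassE (lee1n 2) (in_CL2_chi a b)).
apply: pairing_ae.
  apply: cmeasurableM; first by apply: cmeasurable_fhat; case: Fi.
  by apply: cmeasurable_opp; apply: cmeasurable_fhat; exact: cmeasurable_chi.
rewrite -chat.
apply: filterS3 (CLclassE (lee1n 2) (in_CL2_fhat Fi)) (reflE (fhat1 (chiL a b)))
  (ae_opp (CLclassE (lee1n 2) (in_CL2_fhat ci))).
by move=> x h1 h2 h3; congr (_ * _); [exact: h1|exact: (etrans h2 h3)].
Qed.

End symmetries.

(** * Restriction to the half-line and convolution operators *)

Section half_line.
Context (R : realType).
Local Notation mu := (@lebesgue_measure R).
Local Notation nu := (@lebesgue_pos R).
Local Notation T := (measurableTypeR R).
Local Notation L2R := (CLspace mu (lee1n 2)).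
Local Notation LP := (CLspace nu (lee1n 2)).
Local Notation refl := (@reflection R 2%:E (lee1n 2)).
Implicit Types (F : L2R) (G : LP) (f : T -> R[i]).

Definition posf f (x : T) : R[i] := if 0 < x then f x else 0.

Let Rpos : set T := `]0, +oo[%classic.

Let mRpos : measurable Rpos.
Proof. exact: measurable_itv. Qed.

Let in_Rpos (x : T) : (x \in Rpos) = (0 < x).
Proof. by apply/idP/idP; rewrite /Rpos inE/= in_itv/= andbT. Qed.

Lemma cmeasurable_posf f : cmeasurable f -> cmeasurable (posf f).
Proof.
move=> mf; rewrite (_ : posf f = fun x => f x * ((\1_Rpos x)%:C : R[i])).
  apply: cmeasurableM => //; split; last exact: measurable_cst.
  exact: measurable_indic.
by apply/funext => x; rewrite /posf indicE in_Rpos; case: ifP; rewrite ?mulr1 ?mulr0.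
Qed.

(** [lebesgue_pos] gives mass 0 to the complement of R_+, so its null sets may be cut down to R_+ or
    enlarged by that complement. *)
Lemma ae_posP (P : T -> Prop) :
  {ae nu, forall x, P x} <-> {ae mu, forall x, 0 < x -> P x}.
Proof.
split=> -[N [mN N0 PN]].
- exists (N `&` Rpos); split; [exact: measurableI|exact: N0|].
  move=> x /= /not_implyP[x0 nP]; split; first exact: PN.
  by rewrite /Rpos/= in_itv/= x0.
- exists (N `|` ~` Rpos); split; first by apply: measurableU => //; exact: measurableC.
    rewrite /lebesgue_pos/= /mrestr -/Rpos setIUl setICl setU0.
    apply/eqP; rewrite eq_le measure_ge0 andbT -N0; apply: le_measure; rewrite ?inE//.
    exact: measurableI.
  move=> x /= nP; have [x0|x0] := boolP (0 < x); [left|right].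
    by apply: PN => /= /(_ x0).
  by rewrite /Rpos/= in_itv/= andbT; exact/negP.
Qed.

Lemma integral_pos (g : T -> \bar R) : measurable_fun setT g -> (forall x, 0 <= g x)%E ->
  (\int[nu]_x g x = \int[mu]_x (if (0 < x)%R then g x else 0))%E.
Proof.
move=> mg g0.
transitivity (\int[nu]_x (g \_ Rpos) x)%E.
  apply: ae_eq_integral => //.
    by apply/measurable_restrict => //; exact: measurable_funS mg.
  apply/ae_posP; apply: aeW => x x0 _; by rewrite patchE in_Rpos x0.
rewrite -integral_mkcond (_ : \int[nu]_(x in Rpos) g x = \int[mu]_(x in Rpos) g x)%E.
  rewrite integral_mkcond; apply: eq_integral => x _.
  by rewrite patchE in_Rpos.
apply: eq_measure_integral => A mA AR; rewrite /lebesgue_pos/= /mrestr -/Rpos.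
by congr (mu _); exact/setIidPl.
Qed.

Lemma sqint_pos f : cmeasurable f -> sqint nu f = sqint mu (posf f).
Proof.
move=> mf; rewrite /sqint integral_pos.
- by apply: eq_integral => x _; rewrite /posf; case: ifP => // _; rewrite normc0 expr0n.
- exact: measurable_sqnormc.
- by move=> x; rewrite lee_fin sqr_ge0.
Qed.

Lemma sqint_posf_le f : cmeasurable f -> (sqint mu (posf f) <= sqint mu f)%E.
Proof.
move=> mf; apply: ge0_le_integral => //.
- by move=> x _; rewrite lee_fin sqr_ge0.
- exact/measurable_sqnormc/cmeasurable_posf.
- exact: measurable_sqnormc.
- by move=> x _; rewrite lee_fin /posf; case: ifP => // _; rewrite normc0 expr0n sqr_ge0.
Qed.

Lemma in_CL2_pos f : in_CLp mu 2%:E f -> in_CLp nu 2%:E f.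
Proof.
move=> /in_CL2P[mf fo]; apply/in_CL2P; split=> //.
by rewrite sqint_pos//; exact: le_lt_trans (sqint_posf_le mf) fo.
Qed.

Lemma in_CL2_posf f : in_CLp nu 2%:E f -> in_CLp mu 2%:E (posf f).
Proof.
move=> /in_CL2P[mf fo]; apply/in_CL2P; split; first exact: cmeasurable_posf.
by rewrite -sqint_pos.
Qed.

Lemma restrE F : {ae mu, forall x, 0 < x -> restr F x = F x}.
Proof. exact/ae_posP/CLclassE/in_CL2_pos/CLspaceP. Qed.

Lemma L2pos_ext G G' : {ae mu, forall x, 0 < x -> G x = G' x} -> G = G'.
Proof. by move=> GH; apply: CLspace_ext; exact/ae_posP. Qed.

Lemma restr_eqP F F' : restr F = restr F' <-> {ae mu, forall x, 0 < x -> F x = F' x}.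
Proof.
have aeF := ae_filter_ringOfSetsType mu; split=> [FF'|FF'].
  apply: filterS2 (restrE F) (restrE F') => x + + x0.
  by rewrite FF' => /(_ x0) <- /(_ x0) <-.
apply: L2pos_ext; apply: filterS3 (restrE F) (restrE F') FF' => x + + + x0.
by move=> /(_ x0) -> /(_ x0) -> /(_ x0).
Qed.

Lemma measurable_normr : measurable_fun [set: T] (fun x : T => `|x| : T).
Proof. by apply: continuous_measurable_fun; exact: norm_continuous. Qed.

Lemma ae_neq0 : {ae mu, forall x : T, x != 0}.
Proof.
exists [set 0]; split; [exact: measurable_set1|exact: lebesgue_measure_set1|].
by move=> x /=; apply: contra_notP => /eqP.
Qed.

(** Away from 0 the integrand is that of [posf f] plus its reflection, so equality is what the proof
    obtains. The value at 0, not determined by a class on R_+, is discarded with a null set. *)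
Lemma sqint_even f : cmeasurable f ->
  (sqint mu (fun x : T => f `|x|%R) <= sqint nu f + sqint nu f)%E.
Proof.
move=> mf; have mp := cmeasurable_posf mf; have aeF := ae_filter_ringOfSetsType mu.
have mn : cmeasurable (fun x : T =>
    f `|x|) by exact: (cmeasurable_comp mf measurable_normr).
have m1 := measurable_sqnormc mp; have m2 := measurable_sqnormc (cmeasurable_opp mp).
rewrite sqint_pos//.
rewrite -{2}(sqint_comp (@oppr_measurable R setT) (@lebesgue_measure_opp R) mp).
rewrite /sqint -ge0_integralD//; last 2 first.
- by move=> x _; rewrite lee_fin sqr_ge0.
- by move=> x _; rewrite lee_fin sqr_ge0.
rewrite le_eqVlt; apply/orP; left; apply/eqP; apply: ae_eq_integral => //.
- exact: measurable_sqnormc.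
- exact: emeasurable_funD.
apply: filterS ae_neq0 => x x0 _; rewrite /posf oppr_gt0 -EFinD.
have [xp|xn|xE] := ltgtP 0 x.
- by rewrite normc0 expr0n addr0 gtr0_norm.
- by rewrite normc0 expr0n add0r ltr0_norm.
- by rewrite -xE eqxx in x0.
Qed.

Lemma in_CL2_even G : in_CLp mu 2%:E (fun x : T => G `|x|).
Proof.
have /in_CL2P[mG Go] := CLspaceP G; apply/in_CL2P; split.
  exact: (cmeasurable_comp mG measurable_normr).
by apply: (le_lt_trans (sqint_even mG)); rewrite lte_add_pinfty.
Qed.

Lemma ext_evenE G : {ae mu, forall x, ext_even G x = G `|x|}.
Proof. exact/CLclassE/in_CL2_even. Qed.

Lemma ext0E G : {ae mu, forall x, ext0 G x = posf G x}.
Proof. exact/CLclassE/in_CL2_posf/CLspaceP. Qed.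

(** The map x -> |x| does not preserve the measure, so each half-line is treated by itself, the
    negative one through the reflection. *)
Lemma ae_abs (P : T -> Prop) : {ae mu, forall x, 0 < x -> P x} -> {ae mu, forall x,
    P `|x|}.
Proof.
move=> h; have aeF := ae_filter_ringOfSetsType mu.
apply: filterS3 h (ae_opp h) ae_neq0 => x h1 h2 x0.
have [xp|xn|xE] := ltgtP 0 x.
- by rewrite gtr0_norm//; exact: h1.
- by rewrite ltr0_norm//; apply: h2; rewrite oppr_gt0.
- by rewrite -xE eqxx in x0.
Qed.

Lemma ext_evenK G : restr (ext_even G) = G.
Proof.
have aeF := ae_filter_ringOfSetsType mu; apply: L2pos_ext.
apply: filterS2 (restrE (ext_even G)) (ext_evenE G) => x + h x0.
by move=> /(_ x0) ->; rewrite h gtr0_norm.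
Qed.

Lemma ext0K G : restr (ext0 G) = G.
Proof.
have aeF := ae_filter_ringOfSetsType mu; apply: L2pos_ext.
apply: filterS2 (restrE (ext0 G)) (ext0E G) => x + h x0.
by move=> /(_ x0) ->; rewrite h /posf x0.
Qed.

Lemma restr_evenK F : refl F = F -> ext_even (restr F) = F.
Proof.
move=> eF; have aeF := ae_filter_ringOfSetsType mu; apply: CLspace_ext.
have hF : {ae mu, forall x, F (- x) = F x}.
  by apply: filterS (reflE F) => x; rewrite eF => ->.
apply: filterS3 (ext_evenE (restr F)) (ae_abs (restrE F)) hF => x -> -> h.
by have [x0|x0] := leP 0 x; [rewrite ger0_norm|rewrite ltr0_norm].
Qed.

Lemma refl_even G : refl (ext_even G) = ext_even G.
Proof.
have aeF := ae_filter_ringOfSetsType mu; apply: CLspace_ext.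
apply: filterS3 (reflE (ext_even G)) (ext_evenE G) (ae_opp (ext_evenE G)) => x -> -> ->.
by rewrite normrN.
Qed.

Lemma L2plusE (F : L2plus R) : {ae mu, forall x, x < 0 -> (F : L2R) x = 0}.
Proof. by have /asboolP := valP F. Qed.

(** On each side of 0 one of the summands vanishes. This identity merges the Wiener-Hopf and the
    Hankel term into one operator. *)
Lemma L2plus_even (F : L2plus R) : (F : L2R) + refl F = ext_even (restr F).
Proof.
have aeF := ae_filter_ringOfSetsType mu; apply: CLspace_ext.
apply: filterS3 (filterI (CLspace_addE (F : L2R) (refl F)) (reflE F)) (filterI
    (ext_evenE (restr F)) (ae_abs (restrE F)))
  (filterI ae_neq0 (filterI (L2plusE F) (ae_opp (L2plusE F)))).
move=> x [-> ->] [-> ->] [x0 [h1 h2]].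
have [xp|xn|xE] := ltgtP 0 x.
- by rewrite h2 ?oppr_lt0// addr0 gtr0_norm.
- by rewrite h1// add0r ltr0_norm.
- by rewrite -xE eqxx in x0.
Qed.

Lemma restrK (F : L2plus R) : ext0 (restr F) = F.
Proof.
apply: val_inj => /=; have aeF := ae_filter_ringOfSetsType mu; apply: CLspace_ext.
apply: filterS3 (ext0E (restr F)) (restrE F) (filterI ae_neq0 (L2plusE F)) =>
    x + h1 [x0 h2].
move=> /= ->; rewrite /posf; have [xp|xn|xE] := ltgtP 0 x.
- by rewrite h1.
- by rewrite h2.
- by rewrite -xE eqxx in x0.
Qed.

Lemma restr_linear (c : R[i]) F F' : restr (c *: F + F') = c *: restr F + restr F'.
Proof.
have aeF := ae_filter_ringOfSetsType mu; apply: L2pos_ext.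
have h1 := (ae_posP _).1 (CLspace_addE (c *: restr F) (restr F')).
have h2 := (ae_posP _).1 (CLspace_scaleE c (restr F)).
apply: filterS3 (filterI (restrE (c *: F + F')) (filterI (restrE F) (restrE F')))
  (filterI (CLspace_addE (c *: F) F') (CLspace_scaleE c F)) (filterI h1 h2).
by move=> x [r [rF rF']] [a s] [k1 k2] x0; rewrite r// k1// k2// rF// rF'// a s.
Qed.

Lemma ext_even_linear (c : R[i]) G G' : ext_even (c *: G + G') = c *: ext_even G +
    ext_even G'.
Proof.
have aeF := ae_filter_ringOfSetsType mu; apply: CLspace_ext.
have h1 := ae_abs ((ae_posP _).1 (CLspace_addE (c *: G) G')).
have h2 := ae_abs ((ae_posP _).1 (CLspace_scaleE c G)).
apply: filterS3 (filterI (ext_evenE (c *: G + G')) (filterI (ext_evenE G) (ext_evenE G')))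
  (filterI (CLspace_addE (c *: ext_even G) (ext_even G')) (CLspace_scaleE c (ext_even
      G))) (filterI h1 h2).
by move=> x [r [rF rF']] [a s] [k1 k2]; rewrite r k1 k2 a s rF rF'.
Qed.

Lemma ext0_linear (c : R[i]) G G' : ext0 (c *: G + G') = c *: ext0 G + ext0 G'.
Proof.
have aeF := ae_filter_ringOfSetsType mu; apply: val_inj; rewrite /=.
apply: (@CLspace_ext _ _ _ mu _ (lee1n 2)).
have h1 := (ae_posP _).1 (CLspace_addE (c *: G) G').
have h2 := (ae_posP _).1 (CLspace_scaleE c G).
apply: filterS3 (filterI (ext0E (c *: G + G')) (filterI (ext0E G) (ext0E G')))
  (filterI (CLspace_addE (c *: (ext0 G : L2R)) (ext0 G')) (CLspace_scaleE c (ext0 G :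
      L2R))) (filterI h1 h2).
move=> x [r [rF rF']] [a s] [k1 k2]; move: r => /= ->.
move: a => /= ->; move: s => /= ->; move: rF rF' => /= -> ->.
rewrite /posf; case: ifP => x0; first by rewrite k1// k2.
by rewrite mulr0 addr0.
Qed.

Lemma rnorm_restr_le F : rnorm (restr F) <= rnorm F.
Proof.
have FL := in_CL2_pos (CLspaceP F); have [mF _] := FL.
rewrite -ler_sqr ?nnegrE ?rnorm_ge0// -lee_fin rnorm_class// rnorm_sqint sqint_pos//.
exact: sqint_posf_le.
Qed.

(** Even extension doubles the square of the norm; the constant 2 in place of its root spares a
    square root. *)
Lemma rnorm_ext_even_le G : rnorm (ext_even G) <= 2 * rnorm G.
Proof.
have [mG _] := CLspaceP G.
rewrite -ler_sqr ?nnegrE ?rnorm_ge0 ?mulr_ge0 ?rnorm_ge0// -lee_fin.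
rewrite rnorm_class; last exact: in_CL2_even.
apply: (le_trans (sqint_even mG)); rewrite -rnorm_sqint -EFinD lee_fin.
by have := sqr_ge0 (rnorm G); nra.
Qed.

Lemma rnorm_ext0 G : rnorm (ext0 G : L2R) = rnorm G.
Proof.
have [mG _] := CLspaceP G.
apply/eqP; rewrite -(@eqrXn2 _ 2%N) ?rnorm_ge0//; apply/eqP.
have [] : ((rnorm (ext0 G : L2R)) ^+ 2)%:E = ((rnorm G) ^+ 2)%:E; last by [].
rewrite rnorm_class; last exact/in_CL2_posf/CLspaceP.
by rewrite rnorm_sqint sqint_pos.
Qed.

End half_line.

(** * The operators F^-1 phi F *)

Section convolution_operators.
Context (R : realType).
Local Notation mu := (@lebesgue_measure R).
Local Notation T := (measurableTypeR R).
Local Notation L2R := (CLspace mu (lee1n 2)).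
Local Notation LooR := (CLspace mu (leey 1%E)).
Local Notation refl := (@reflection R 2%:E (lee1n 2)).
Implicit Types (F G : L2R) (phi psi : LooR).

Let twopi_neq0 : (2 * pi)%:C != 0 :> R[i].
Proof. by rewrite eq_complex/= eqxx andbT mulf_neq0// gt_eqF// pi_gt0. Qed.

Lemma fourier_inj F G : fourier F = fourier G -> F = G.
Proof.
move=> FG; have := fourier_inversion F; rewrite FG fourier_inversion.
by move=> /(scalerI twopi_neq0).
Qed.

(** [fourier_inv] chooses some preimage. The inversion formula exhibits one and also yields
    injectivity, hence this is the chosen one. *)
Lemma fourier_invE F : fourier_inv F = (2 * pi)%:C^-1 *: refl (fourier F).
Proof.
have h : fourier ((2 * pi)%:C^-1 *: refl (fourier F)) = F.
  by rewrite fourierZ fourier_inversion scalerA mulVf// scale1r.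
by apply: xget_unique => // G /= GF; apply: fourier_inj; rewrite h.
Qed.

Lemma fourier_invK F : fourier (fourier_inv F) = F.
Proof. by rewrite fourier_invE fourierZ fourier_inversion scalerA mulVf// scale1r. Qed.

Lemma fourierK F : fourier_inv (fourier F) = F.
Proof. by apply: fourier_inj; rewrite fourier_invK. Qed.

Lemma fourier_inv_linear (c : R[i]) F G :
  fourier_inv (c *: F + G) = c *: fourier_inv F + fourier_inv G.
Proof.
by apply: fourier_inj; rewrite fourier_linear !fourier_invK.
Qed.

Lemma conv_op_linear phi (c : R[i]) F G :
  conv_op phi (c *: F + G) = c *: conv_op phi F + conv_op phi G.
Proof. by rewrite /conv_op fourier_linear mulop_linear fourier_inv_linear. Qed.

Lemma conv_op_linear_l (c : R[i]) phi psi F :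
  conv_op (c *: phi + psi) F = c *: conv_op phi F + conv_op psi F.
Proof. by rewrite /conv_op mulop_linear_l fourier_inv_linear. Qed.

Lemma conv_opM phi psi F : conv_op (phi * psi) F = conv_op phi (conv_op psi F).
Proof. by rewrite /conv_op fourier_invK mulopM. Qed.

Lemma conv_op1 F : conv_op 1 F = F.
Proof. by rewrite /conv_op mulop1 fourierK. Qed.

Lemma conv_op_e a F : conv_op (e_ a) F = translate a F.
Proof. by rewrite /conv_op -fourier_shift fourierK. Qed.

Lemma conv_opB phi F G : conv_op phi (F - G) = conv_op phi F - conv_op phi G.
Proof. by rewrite addrC -scaleN1r conv_op_linear scaleN1r addrC. Qed.

Lemma reflectionE phi : {ae mu, forall x, reflection phi x = phi (- x)}.
Proof.
apply: CLclassE; have /in_CLooP[mp [M hM]] := CLspaceP phi; apply/in_CLooP.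
split; first exact: cmeasurable_opp.
by exists M; exact: (ae_opp hM).
Qed.

Lemma refl_mulop phi F : refl (mulop phi F) = mulop (reflection phi) (refl F).
Proof.
have aeF := ae_filter_ringOfSetsType mu; apply: CLspace_ext.
apply: filterS3 (filterI (reflE (mulop phi F)) (ae_opp (mulopE phi F)))
  (mulopE (reflection phi) (refl F)) (filterI (reflectionE phi) (reflE F)).
by move=> x [-> ->] -> [-> ->].
Qed.

Lemma refl_fourier_inv F : refl (fourier_inv F) = fourier_inv (refl F).
Proof. by apply: fourier_inj; rewrite fourier_refl !fourier_invK. Qed.

Lemma refl_conv_op phi F : refl (conv_op phi F) = conv_op (reflection phi) (refl F).
Proof. by rewrite /conv_op refl_fourier_inv refl_mulop fourier_refl. Qed.

(** One constant serves all symbols: the bound is linear in the norm of the symbol, as closedness of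
    the minus symbols requires. *)
Lemma rnorm_conv_op_le : exists2 C : R, 0 <= C &
  forall phi F, rnorm (conv_op phi F) <= C * rnorm phi * rnorm F.
Proof.
have p0 : 0 <= (2 * pi)^-1 :> R by rewrite invr_ge0 mulr_ge0// pi_ge0.
have [K K0 hK] : exists2 K : R, 0 <= K & forall F, rnorm (fourier F) <= K * rnorm F.
  by exists (fourier_bound R); [exact: fourier_bound_ge0|exact: rnorm_fourier_le].
exists ((2 * pi)^-1 * (K * K)); first by rewrite !mulr_ge0.
move=> phi F; rewrite /conv_op fourier_invE rnormZ rnorm_refl.
have -> : normc ((2 * pi)%:C^-1 : R[i]) = (2 * pi)^-1.
  by rewrite -[(2 * pi)%:C^-1](fmorphV (real_complex R)) normc_real ger0_norm.
have -> : (2 * pi)^-1 * (K * K) * rnorm phi * rnorm F =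
    (2 * pi)^-1 * (K * (rnorm phi * (K * rnorm F))) by ring.
apply: (ler_wpM2l p0); apply: (le_trans (hK _)); apply: (ler_wpM2l K0).
apply: (le_trans (rnorm_mulop_le _ _)); apply: (ler_wpM2l (rnorm_ge0 _)).
exact: hK.
Qed.

(** The choice in [Loo_inv] thus returns any inverse at hand, in particular the one known to lie in
    AP^-. *)
Lemma Loo_inv_unique phi psi : phi * psi = 1 -> Loo_inv phi = psi.
Proof.
move=> pp; apply: xget_unique => // chi /= pc.
by rewrite -[chi]mulr1 -pp mulrA [chi * phi]mulrC pc mul1r.
Qed.

End convolution_operators.

(** * Symbols that preserve vanishing on the half-line *)

Section minus_symbols.
Context (R : realType).
Local Notation mu := (@lebesgue_measure R).
Local Notation L2R := (CLspace mu (lee1n 2)).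
Local Notation LooR := (CLspace mu (leey 1%E)).
Implicit Types (F G : L2R) (phi psi : LooR).

(* [r_+ F^-1 phi F] depends on the restriction to the half-line only. *)
Definition minus_symbol phi : Prop :=
  forall F, restr F = 0 -> restr (conv_op phi F) = 0.

Lemma restrB F G : restr (F - G) = restr F - restr G.
Proof. by rewrite addrC -scaleN1r restr_linear scaleN1r addrC. Qed.

Lemma minus_symbolP phi F G : minus_symbol phi -> restr F = restr G ->
  restr (conv_op phi F) = restr (conv_op phi G).
Proof.
move=> mphi FG; apply/eqP; rewrite -subr_eq0 -restrB -conv_opB; apply/eqP/mphi.
by rewrite restrB FG subrr.
Qed.

Lemma restr0 : restr (0 : L2R) = 0.
Proof. by rewrite -[X in restr X](subrr 0) restrB subrr. Qed.

(** With the kernel exp(i xi x), [e_ a] acts as F(x - a); for a <= 0 and x > 0 this reads [F] on R_+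
    only. *)
Lemma minus_symbol_e a : a <= 0 -> minus_symbol (e_ a).
Proof.
move=> a0 F F0; rewrite conv_op_e -restr0; apply/restr_eqP.
have /restr_eqP h : restr F = restr (0 : L2R) by rewrite F0 restr0.
have aeF := ae_filter_ringOfSetsType mu.
have hz := CLzeroE mu (lee1n 2).
apply: filterS3 (shiftE a F) (ae_shift a h) (filterI hz (ae_shift a hz)) =>
    x -> h1 [h2 h3] x0.
have xa : 0 < x - a by rewrite (lt_le_trans x0)// lerBrDr gerDl.
by rewrite (h1 xa) [LHS]h3 [RHS]h2.
Qed.

(** Closedness: if [psi] is a minus symbol near [phi] and [F] vanishes on R_+, the operators with
    symbols [phi] and [phi - psi] give [F] images with the same restriction, whose norm is at most C
    times that of [phi - psi] times that of [F]. Products come from composition. *)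
Lemma minus_symbol_subalgebra : closed_subalgebra (minus_symbol : set LooR).
Proof.
have [C C0 hC] := rnorm_conv_op_le R.
split.
- move=> phi cphi F F0; apply: rnorm_eq0; apply/eqP; rewrite eq_le rnorm_ge0 andbT.
  apply/ler_addgt0Pr => e e0; rewrite add0r.
  have K0 : 0 <= C * rnorm F by rewrite mulr_ge0// rnorm_ge0.
  have [del d0 dK] : exists2 del : R, 0 < del & del * (C * rnorm F) <= e.
    exists (e / (C * rnorm F + 1)); first by rewrite divr_gt0// ltr_wpDl.
    rewrite -mulrA ler_piMr ?(ltW e0)// mulrC ler_pdivrMr ?ltr_wpDl// mul1r lerDl.
    by [].
  have d0C : 0 < del%:C :> R[i] by rewrite ltcR.
  have [psi [mpsi bpsi]] := cphi _ (nbhsx_ballx phi _ d0C).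
  have : `|phi - psi| < del%:C by move: bpsi; rewrite -ball_normE.
  rewrite CLspace_normE ltcR => dist.
  have -> : conv_op phi F = 1 *: conv_op psi F + conv_op (phi - psi) F.
    by rewrite -conv_op_linear_l scale1r addrC subrK.
  rewrite restr_linear (mpsi _ F0) scaler0 add0r.
  apply: (le_trans (rnorm_restr_le _)); apply: (le_trans (hC _ _)).
  apply: le_trans dK; rewrite [C * _]mulrC -mulrA ler_wpM2r//.
  exact: ltW.
- move=> F F0; have -> : conv_op 0 F = 0.
    by rewrite -[X in conv_op X](addNr 1) -scaleN1r conv_op_linear_l conv_op1 scaleN1r
        addNr.
  exact: restr0.
- move=> c phi psi mphi mpsi F F0.
  by rewrite conv_op_linear_l restr_linear mphi// mpsi// scaler0 addr0.
- by move=> phi psi mphi mpsi F F0; rewrite conv_opM; apply: mphi; exact: mpsi.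
Qed.

Lemma APminus_minus_symbol phi : APminus phi -> minus_symbol phi.
Proof.
apply: (smallest_sub minus_symbol_subalgebra) => _ [a a0 <-].
exact: minus_symbol_e.
Qed.

End minus_symbols.

(** * The operators T_phi and their multiplication rules *)

Section truncated_operators.
Context (R : realType).
Local Notation mu := (@lebesgue_measure R).
Local Notation L2R := (CLspace mu (lee1n 2)).
Local Notation LP := (CLspace (@lebesgue_pos R) (lee1n 2)).
Local Notation LooR := (CLspace mu (leey 1%E)).
Local Notation refl := (@reflection R 2%:E (lee1n 2)).
Implicit Types (F : L2R) (g : LP) (phi psi : LooR).

Definition even_truncated phi g : LP := restr (conv_op phi (ext_even g)).

(** The inner l^e r_+ alters its argument only outside R_+, which a minus symbol does not see. *)
Lemma even_truncatedM_minus phi psi g : minus_symbol phi ->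
  even_truncated phi (even_truncated psi g) = even_truncated (phi * psi) g.
Proof.
move=> mphi; rewrite /even_truncated conv_opM; apply: minus_symbolP => //.
exact: ext_evenK.
Qed.

(** Here the inner l^e r_+ acts on an even function, which it leaves unchanged. *)
Lemma even_truncatedM_even phi psi g : reflection psi = psi ->
  even_truncated phi (even_truncated psi g) = even_truncated (phi * psi) g.
Proof.
move=> epsi; rewrite /even_truncated conv_opM restr_evenK//.
by rewrite refl_conv_op epsi refl_even.
Qed.

Lemma even_truncated1 g : even_truncated 1 g = g.
Proof. by rewrite /even_truncated conv_op1 ext_evenK. Qed.

Lemma even_truncated_linear phi (c : R[i]) g g' :
  even_truncated phi (c *: g + g') = c *: even_truncated phi g + even_truncated phi g'.
Proof. by rewrite /even_truncated ext_even_linear conv_op_linear restr_linear. Qed.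

Lemma rnorm_even_truncated_le phi :
  exists2 M : R, 0 <= M & forall g, rnorm (even_truncated phi g) <= M * rnorm g.
Proof.
have [C C0 hC] := rnorm_conv_op_le R.
have P0 : 0 <= C * rnorm phi by rewrite mulr_ge0// rnorm_ge0.
exists (C * rnorm phi * 2); first by rewrite mulr_ge0.
move=> g; apply: (le_trans (rnorm_restr_le _)); apply: (le_trans (hC _ _)).
by rewrite -[leRHS]mulrA ler_wpM2l// rnorm_ext_even_le.
Qed.

Lemma reflectionM phi psi : reflection (phi * psi) = reflection phi * reflection psi.
Proof.
have aeF := ae_filter_ringOfSetsType mu; apply: CLspace_ext.
apply: filterS3 (filterI (reflectionE (phi * psi)) (ae_opp (CLmulE phi psi)))
  (CLmulE (reflection phi) (reflection psi)) (filterI (reflectionE phi) (reflectionE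
      psi)).
by move=> x [-> ->] -> [-> ->].
Qed.

Lemma reflection1 : reflection (1 : LooR) = 1.
Proof.
have aeF := ae_filter_ringOfSetsType mu; apply: CLspace_ext.
apply: filterS3 (reflectionE 1) (CLoneE mu) (ae_opp (CLoneE mu)).
by move=> x -> h1 h2; rewrite [LHS]h2 [RHS]h1.
Qed.

(** Reflection is multiplicative, so [reflection psi] is another inverse of [phi]. *)
Lemma reflection_inverse phi psi : reflection phi = phi -> phi * psi = 1 ->
  reflection psi = psi.
Proof.
move=> ephi pp; have pr : phi * reflection psi = 1.
  by rewrite -{1}ephi -reflectionM pp reflection1.
by rewrite -[RHS](Loo_inv_unique pp) (Loo_inv_unique pr).
Qed.

Lemma e_NK (a : R) : e_ (- a) * e_ a = 1.
Proof.
have aeF := ae_filter_ringOfSetsType mu; apply: CLspace_ext.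
apply: filterS3 (CLmulE (e_ (- a)) (e_ a)) (filterI (e_E (- a)) (e_E a)) (CLoneE mu).
by move=> x [] -> [-> ->] h; rewrite [RHS]h mulNr expiNM.
Qed.

Lemma wiener_hopf_plus_hankelE phi (F : L2plus R) :
  wiener_hopf_plus_hankel phi F = even_truncated phi (restr F).
Proof.
rewrite /wiener_hopf_plus_hankel /wiener_hopf /hankel -[X in X + _]scale1r.
by rewrite -restr_linear -conv_op_linear scale1r L2plus_even.
Qed.

End truncated_operators.

Theorem theorem5p2 (R : realType) (phi phi_minus : Loo R) (lambda : R)
    (phi_e : Loo R) (ell : {linear L2pos R -> L2 R}) :
  invertibles (@AP R) phi ->
  AP_asymmetric_factorization phi phi_minus lambda phi_e ->
  extension_operator ell ->
  let WH : L2plus R -> L2pos R := wiener_hopf_plus_hankel phi in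
  let WHm : L2pos R -> L2plus R := fun f =>
    ext0 (restr (conv_op (Loo_inv phi_e)
      (ext_even (restr (conv_op (e_ (- lambda))
        (ext_even (restr (conv_op (Loo_inv phi_minus) (ell f))))))))) in
  [/\ reflexive_generalized_inverse WH WHm,
      lambda < 0 -> WH \o WHm = idfun,
      lambda > 0 -> WHm \o WH = idfun &
      lambda = 0 -> WH \o WHm = idfun /\ WHm \o WH = idfun].
Proof.
move=> _ [phiE [am [b bm ab]] [_ [c _ ec]] ee] ellE WH WHm.
have {am} am := APminus_minus_symbol am; have {bm} bm := APminus_minus_symbol bm.
have ebE : reflection c = c := reflection_inverse ee ec.
(* The even factor is split off on the right, then the minus factor on the left. *)
have WHE F : WH F = even_truncated phi_minus (even_truncated (e_ lambda)
    (even_truncated phi_e (restr F))).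
  rewrite /WH wiener_hopf_plus_hankelE phiE -(even_truncatedM_even _ _ ee).
  by rewrite -(even_truncatedM_minus _ _ am).
have WHmE f : WHm f = ext0 (even_truncated c (even_truncated (e_ (- lambda))
    (even_truncated b f))).
  (* Since [b], the inverse of [phi_minus], lies in AP^-, the arbitrary extension may be exchanged
     for the even one. *)
  have bf : restr (conv_op b (ell f)) = restr (conv_op b (ext_even f)).
    by apply: (minus_symbolP bm); rewrite ellE ext_evenK.
  rewrite /WHm (Loo_inv_unique ab) (Loo_inv_unique ec) /even_truncated.
  exact: (congr1 (fun h => ext0 (restr (conv_op c (ext_even
    (restr (conv_op (e_ (- lambda)) (ext_even h))))))) bf).
have aK g : even_truncated phi_minus (even_truncated b g) = g.
  by rewrite (even_truncatedM_minus b g am) ab even_truncated1.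
have bK g : even_truncated b (even_truncated phi_minus g) = g.
  by rewrite (even_truncatedM_minus _ g bm) mulrC ab even_truncated1.
have eK g : even_truncated phi_e (even_truncated c g) = g.
  by rewrite (even_truncatedM_even _ g ebE) ec even_truncated1.
have cK g : even_truncated c (even_truncated phi_e g) = g.
  by rewrite (even_truncatedM_even _ g ee) mulrC ec even_truncated1.
(* The outer factors cancel for every lambda. In the middle, the rule for minus symbols needs the
   exponent of the left factor to be <= 0: it is [lambda] here and [- lambda] in [left]. *)
have right : lambda <= 0 -> WH \o WHm = idfun.
  move=> l0; apply/funext => f /=; rewrite WHmE WHE ext0K eK.
  rewrite (even_truncatedM_minus _ _ (minus_symbol_e l0)).
  by rewrite mulrC e_NK even_truncated1 aK.
have left : 0 <= lambda -> WHm \o WH = idfun.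
  move=> l0; apply/funext => F /=; rewrite WHmE WHE bK.
  have l0' : - lambda <= 0 by rewrite oppr_le0.
  rewrite (even_truncatedM_minus _ _ (minus_symbol_e l0')).
  by rewrite e_NK even_truncated1 cK restrK.
split; [|by move=> /ltW|by move=> /ltW|by move=> l0; split; [apply: right|apply: left];
    rewrite l0].
split.
- split=> [k F G|].
    have rL : restr ((k *: F + G : L2plus R) : L2 R) = k *: restr F + restr G.
      exact: (restr_linear k (F : L2 R) G).
    by rewrite !WHE rL !even_truncated_linear.
  have [M1 M10 h1] := rnorm_even_truncated_le phi.
  exists M1%:C => F; rewrite /WH wiener_hopf_plus_hankelE.
  rewrite CLspace_normE (_ : `|F| = (rnorm (F : CLspace (@lebesgue_measure R) (lee1n
      2)))%:C)//.
  rewrite -rmorphM lecR (le_trans (h1 _))// ler_wpM2l// rnorm_restr_le//.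
- split=> [k f g|].
    by rewrite !WHmE !even_truncated_linear ext0_linear.
  have [M1 M10 h1] := rnorm_even_truncated_le c.
  have [M2 M20 h2] := rnorm_even_truncated_le (e_ (- lambda)).
  have [M3 M30 h3] := rnorm_even_truncated_le b.
  exists (M1 * (M2 * M3))%:C => f; rewrite WHmE.
  set g := even_truncated c _.
  rewrite (_ : `|ext0 g| = (rnorm (ext0 g : CLspace (@lebesgue_measure R) (lee1n
      2)))%:C)//.
  rewrite rnorm_ext0 CLspace_normE -rmorphM lecR -!mulrA.
  apply: (le_trans (h1 _)); apply: (ler_wpM2l M10).
  apply: (le_trans (h2 _)); apply: (ler_wpM2l M20).
  exact: h3.
(* Whatever the sign of [lambda], one of the two compositions is the identity, and either one gives
   both identities of a generalized inverse. *)
- have [/right h|/ltW/left h] := leP lambda 0; first by rewrite h.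
  by rewrite -compA h.
- have [/right h|/ltW/left h] := leP lambda 0; last by rewrite h.
  by rewrite -compA h.
Qed.
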